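(* Let $a>0$, let $S_a$ be the first passage time at level $a$ of a three-dimensional Bessel process started at $0$, let $S_a'$ be an independent copy of $S_a$, and set $W_a=S_a+S_a'$. Then the distribution of $W_a$ is a generalized gamma convolution with Thorin measure $$\nu(dc)=2\sum_{n=1}^\infty \delta_{n^2/a^2}(dc).$$
   Context: A three-dimensional Bessel process started at $0$ is the Euclidean norm of a standard Brownian motion in $\mathbf{R}^3$ started at the origin. Its first passage time at $a$ is the first time it reaches $a$; its Laplace transform is $E[e^{-\lambda^2 S_a/2}]=\lambda a/\sinh(\lambda a)$. For $\omega,c>0$, the gamma distribution $\Gamma_{\omega,c}$ is the probability distribution on $(0,\infty)$ with density $\frac{c^{\omega}}{\Gamma(\omega)}t^{\omega-1}e^{-ct}$; its Laplace transform is $\lambda\mapsto(1+\lambda/c)^{-\omega}$, and the Lévy exponent of the gamma convolution semigroup (with respect to the parameter $\omega$) is $\psi_c(\lambda)=\log(1+\lambda/c)=\int_0^\infty(1-e^{-\lambda t})\frac{e^{-ct}}{t}\,dt$. Generalized gamma convolutions are the distributions of linear combinations, with positive coefficients, of independent gamma variables, and their weak limits. They are also characterized as the infinitely divisible distributions with Laplace transform $E[e^{-\lambda X}]=e^{-\psi(\lambda)}$, where the Lévy exponent has the form $$\psi(\lambda)=\int_0^\infty\psi_c(\lambda)\,\nu(dc)$$ for some positive measure $\nu$ which integrates $1/c$ at $\infty$. The measure $\nu$ is called the Thorin measure of the distribution. Here $\delta_y$ denotes the Dirac mass at $y$.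
   Formalization: The atoms of the Thorin measure are at π²n²/(2a²) instead of n²/a²: the printed constant is false for every a, since E[W_a]=2a²/3 while the printed measure would give mean π²a²/3. *)

(* Defs.v *)
From HB Require Import structures.
From mathcomp Require Import all_boot all_order all_algebra.
From mathcomp Require Import all_classical all_reals all_analysis.
From mathcomp Require Import measurable_realfun.

Set Implicit Arguments.
Unset Strict Implicit.
Unset Printing Implicit Defensive.

Import Order.TTheory GRing.Theory Num.Theory.
Import numFieldNormedType.Exports.

Local Open Scope classical_set_scope.
Local Open Scope ring_scope.

Definition has_law (R : realType) (d d' : measure_display)
    (T : measurableType d) (T' : measurableType d') (P : probability T R)
    (X : T -> T') (mu : set T' -> \bar R) : Prop :=
  measurable_fun setT X /\
  forall A : set T', measurable A -> P (X @^-1` A) = mu A.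

(* Mutual independence. The index type is finite, so the product rule for
   subfamilies is the case where some of the [A i] are [setT]. *)
Definition independent (R : realType) (d d' : measure_display)
    (T : measurableType d) (T' : measurableType d') (P : probability T R)
    (I : finType) (X : I -> T -> T') : Prop :=
  forall A : I -> set T', (forall i, measurable (A i)) ->
    P (\bigcap_(i in [set: I]) (X i @^-1` A i)) =
    (\prod_(i : I) P (X i @^-1` A i))%E.

(* Standard [n]-dimensional Brownian motion started at the origin; [B i t w] is
   the [i]-th coordinate at time [t >= 0] (negative times are irrelevant).
   An N(0, (t - s) I_n) increment has independent N(0, t - s) coordinates, so
   independent Gaussian increments amount to mutual independence over
   (coordinate, time interval).  The second argument of [normal_prob] is the
   standard deviation. *)
Definition standard_brownian_motion (R : realType) (d : measure_display)
    (T : measurableType d) (P : probability T R) (n : nat)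
    (B : 'I_n -> R -> T -> R) : Prop :=
  [/\ forall i t, 0 <= t -> measurable_fun setT (B i t),
      forall i w, B i 0 w = 0,
      forall i w, {within `[0, +oo[%classic, continuous (fun t => B i t w)},
      forall i s t, 0 <= s -> s < t ->
        has_law P (fun w => B i t w - B i s w)
                  (normal_prob 0 (Num.sqrt (t - s)))
    & forall (k : nat) (t : nat -> R), 0 <= t 0%N ->
        (forall j, (j < k)%N -> t j < t j.+1) ->
        independent P (fun (ij : 'I_n * 'I_k) (w : T) =>
          B ij.1 (t ij.2.+1) w - B ij.1 (t ij.2) w)].

(* The norm of matrices in the library is the sup norm, hence the explicit
   Euclidean norm. *)
Definition bessel3 (R : realType) (T : Type) (B : 'I_3 -> R -> T -> R)
    (t : R) (w : T) : R :=
  Num.sqrt (\sum_(i < 3) B i t w ^+ 2).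

(* Equal to [+oo] on the paths which never reach [a]. *)
Definition first_passage (R : realType) (T : Type) (X : R -> T -> R)
    (a : R) (w : T) : \bar R :=
  ereal_inf [set t%:E | t in [set t : R | 0 <= t /\ X t w = a]].

Definition gamma_function (R : realType) (w : R) : R :=
  Rintegral lebesgue_measure `]0, +oo[%classic
    (fun t : R => t `^ (w - 1) * expR (- t)).

Definition gamma_pdf (R : realType) (w c t : R) : R :=
  if 0 < t then c `^ w / gamma_function w * t `^ (w - 1) * expR (- (c * t))
  else 0.

Definition gamma_prob (R : realType) (w c : R) (A : set R) : \bar R :=
  (\int[lebesgue_measure]_(t in A) (gamma_pdf w c t)%:E)%E.

Definition gamma_combination (R : realType)
    (mu : probability (measurableTypeR R) R) : Prop :=
  exists (d : measure_display) (T : measurableType d) (P : probability T R)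
         (n : nat) (X : 'I_n -> T -> R) (b w c : 'I_n -> R),
    [/\ forall i, [/\ 0 < b i, 0 < w i & 0 < c i],
        forall i, has_law P (X i) (gamma_prob (w i) (c i)),
        independent P X
      & has_law P (fun x => \sum_(i < n) b i * X i x) mu].

Definition weakly_converges (R : realType)
    (mus : nat -> probability (measurableTypeR R) R)
    (mu : probability (measurableTypeR R) R) : Prop :=
  forall f : R -> R, continuous f -> (exists M : R, forall x, `|f x| <= M) ->
    ((fun n => \int[mus n]_x (f x)%:E) @ \oo --> \int[mu]_x (f x)%:E)%E.

Definition generalized_gamma_convolution (R : realType)
    (mu : probability (measurableTypeR R) R) : Prop :=
  exists mus : nat -> probability (measurableTypeR R) R,
    (forall n, gamma_combination (mus n)) /\ weakly_converges mus mu.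

Definition infinitely_divisible (R : realType)
    (mu : probability (measurableTypeR R) R) : Prop :=
  forall n : nat, (0 < n)%N ->
  exists (mun : probability (measurableTypeR R) R)
         (d : measure_display) (T : measurableType d) (P : probability T R)
         (X : 'I_n -> T -> R),
    [/\ forall i, has_law P (X i) mun,
        independent P X
      & has_law P (fun x => \sum_(i < n) X i x) mu].

Definition gamma_exponent (R : realType) (c l : R) : R := ln (1 + l / c).

Definition thorin_exponent (R : realType)
    (nu : {measure set (measurableTypeR R) -> \bar R}) (l : R) : \bar R :=
  (\int[nu]_(c in `]0%R, +oo[%classic) (gamma_exponent c l)%:E)%E.

(* [nu] is a measure on (0, +oo), encoded as a measure on the line which does
   not charge the nonpositive half-line.  The last clause forces
   [thorin_exponent nu l] to be finite, the left-hand side being positive. *)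
Definition is_thorin_measure (R : realType)
    (mu : probability (measurableTypeR R) R)
    (nu : {measure set (measurableTypeR R) -> \bar R}) : Prop :=
  [/\ mu `]-oo, 0[%classic = 0%E,
      infinitely_divisible mu,
      nu `]-oo, 0]%classic = 0%E,
      (\int[nu]_(c in `[1%R, +oo[%classic) (c^-1)%:E < +oo)%E
    & forall l : R, 0 <= l ->
        (\int[mu]_x (expR (- (l * x)))%:E = expeR (- thorin_exponent nu l))%E].

(* From  sinh x = x \prod_(n >= 1) (1 + x^2 / (pi^2 n^2))  at
   x = a sqrt (2 l),  E[exp (- l S_a)] = a sqrt (2 l) / sinh (a sqrt (2 l)) is
   the product of the gamma factors (1 + l / c_n)^-1 with
   c_n = pi^2 n^2 / (2 a^2). *)
Definition passage_rate (R : realType) (a : R) (n : nat) : R :=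
  pi ^+ 2 / 2 * (n%:R ^+ 2 / a ^+ 2).

Definition passage_thorin_measure (R : realType) (a : R) :
    {measure set (measurableTypeR R) -> \bar R} :=
  mscale 2%:nng
    (mseries (fun n : nat => dirac (passage_rate a n : measurableTypeR R)) 1).

(* Main.v *)
(** The function F(s, x) = s^(-3/2) exp(|x|^2 / 2s) satisfies
    E F(s, x + D) = F(s - h, x) for D ~ N(0, h I_3), so it is an exact martingale
    along the discrete walks j |-> B_(jh). Stopping at the exit from the ball of
    radius a and letting h -> 0 (Fatou for the upper bound, a Gaussian bound on
    the overshoot for the lower one) gives
      E[(t + S)^(-3/2) exp(a^2 / 2(t + S))] = t^(-3/2).
    As s^(-3/2) exp(a^2 / 2s) is, up to a constant, the integral over k of
    k sinh(ka) exp(- k^2 s / 2), uniqueness of Laplace transforms in t turns this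
    into E exp(- k^2 S / 2) = ka / sinh(ka).

    Euler's product for sinh, obtained as a limit of the factorization of
    sinh((2m+1)z) as a polynomial in sinh z, then exhibits the Laplace transform of
    S + S' as an infinite product of exponential ones, each rate occurring twice;
    by the Laplace continuity theorem the law is the weak limit of the finite
    convolutions. For infinite divisibility, the factors (1 + l/c)^(-1/n) are
    Laplace transforms of gamma laws of shape 1/n; the distribution functions of
    their partial convolutions decrease, and the limit is a convolution n-th root. *)

Require Import Defs.
From HB Require Import structures.
From mathcomp Require Import all_boot all_order all_algebra.
From mathcomp Require Import all_classical all_reals all_analysis.
From mathcomp Require Import measurable_realfun.
From mathcomp Require Import ring lra.

Set Implicit Arguments.
Unset Strict Implicit.
Unset Printing Implicit Defensive.

Import Order.TTheory GRing.Theory Num.Theory.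
Import numFieldNormedType.Exports.

Local Open Scope classical_set_scope.
Local Open Scope ring_scope.

(** The classical route stops exp(- k^2 t / 2) sinh(k |B_t|) / |B_t| in continuous time. That
    function does not split over the coordinates; F does, being a product of three one-dimensional
    factors, so its mean-value property is one completion of the square and discrete walks suffice.
    There are two prices. F grows like a Gaussian in x, so a jump of the walk past the sphere has to
    be controlled; this is why a second radius b > a, tending to a, appears in both bounds. And the
    transform of S must be recovered afterwards: k sinh(ka) E exp(- k^2 S / 2) and a k^2 turn out to
    have the same Gaussian transform in k, the second one coming from the starting point x = 0, and
    the monotonicity of k |-> E exp(- k^2 S / 2) upgrades the equality of the two measures to
    equality at every k. Paths that never reach the level get weight 0; that they form a null set is
    read off the transform near 0. *)

Definition mk_mfun d d' (T : measurableType d) (T' : measurableType d')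
    (f : T -> T') (mf : measurable_fun setT f) : {mfun T >-> T'} :=
  HB.pack f (@isMeasurableFun.Build _ _ _ _ f mf).

Definition image_prob (R : realType) d d' (T : measurableType d)
    (T' : measurableType d') (P : probability T R)
    (f : T -> T') (mf : measurable_fun setT f) : probability T' R :=
  distribution P (mk_mfun mf).

Lemma ge0_integral_image_prob (R : realType) d d' (T : measurableType d)
    (T' : measurableType d') (P : probability T R)
    (f : T -> T') (mf : measurable_fun setT f) (g : T' -> \bar R) :
  measurable_fun setT g -> (forall y, 0 <= g y)%E ->
  (\int[image_prob P mf]_y g y = \int[P]_x g (f x))%E.
Proof. by move=> mg g0; rewrite /image_prob ge0_integral_distribution. Qed.

(** * Independence *)

Section independent_sigma_algebras.
Context (R : realType) d (T : measurableType d) (P : probability T R).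

(** For a fixed event [C], the finite measures sending [A] to [P (A & C)] and to [P A * P C] agree
    on a pi-system containing the whole space, hence on the sigma-algebra it generates. This is
    applied once in each argument. *)
Lemma independent_generators (G1 G2 : set (set T)) :
  G1 `<=` measurable -> G2 `<=` measurable ->
  setI_closed G1 -> setI_closed G2 -> G1 setT -> G2 setT ->
  (forall A B, G1 A -> G2 B -> P (A `&` B) = P A * P B)%E ->
  forall A B, <<s G1 >> A -> <<s G2 >> B -> (P (A `&` B) = P A * P B)%E.
Proof.
move=> mG1 mG2 IG1 IG2 G1T G2T G12.
have key (G : set (set T)) (C : set T) : G `<=` measurable -> setI_closed G ->
    G setT -> measurable C ->
    (forall A, G A -> P (A `&` C) = P A * P C)%E ->
    forall A, <<s G >> A -> (P (A `&` C) = P A * P C)%E.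
  move=> mG IG GT mC GC A sA.
  have PC0 : (0 <= fine (P C)) by rewrite fine_ge0.
  have PCE : ((fine (P C))%:E = P C)%E by rewrite fineK// fin_num_measure.
  have cov : \bigcup_(k : nat) [set: T] = setT by apply: bigcup_const; exists 0%N.
  have := @g_sigma_algebra_measure_unique _ R T G mG (fun=> setT) (fun=> GT)
    cov (mrestr P mC) (mscale (NngNum PC0) P) IG.
  have mE B : (mscale (NngNum PC0) P B = P B * P C)%E.
    by rewrite -[in RHS]PCE muleC.
  move=> key; have -> : (P A * P C = mscale (NngNum PC0) P A)%E by rewrite mE.
  apply: (key _ _ A sA) => [B GB|k]; first exact: etrans (GC B GB) (esym (mE B)).
  rewrite (le_lt_trans (probability_le1 P _)) ?ltry//.
  by apply: measurableI.
have sm (G : set (set T)) : G `<=` measurable -> <<s G >> `<=` measurable.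
  by move=> mG; apply: smallest_sub => //; exact: sigma_algebra_measurable.
move=> A B sA sB; apply: (key G1) => //; first exact: (sm G2).
move=> A' GA'; rewrite setIC muleC; apply: (key G2) => //; first exact: mG1.
by move=> B' GB'; rewrite setIC muleC; exact: G12.
Qed.

(** Independence of two sub-sigma-algebras says that the law of the diagonal map, into the product
    of the two coarser measurable spaces, is the product measure. Tonelli for that product gives the
    double integral. *)
Lemma independent_fubini (G1 G2 : set (set T)) :
  G1 `<=` measurable -> G2 `<=` measurable ->
  (forall A B, <<s G1 >> A -> <<s G2 >> B -> (P (A `&` B) = P A * P B)%E) ->
  forall f : g_sigma_algebraType G1 * g_sigma_algebraType G2 -> \bar R,
  measurable_fun setT f -> (forall z, 0 <= f z)%E ->
  (\int[P]_x f (x, x) = \int[P]_x \int[P]_y f (x, y))%E.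
Proof.
move=> mG1 mG2 G12 f mf f0.
have sm (G : set (set T)) : G `<=` measurable -> <<s G >> `<=` measurable.
  by move=> mG; apply: smallest_sub => //; exact: sigma_algebra_measurable.
have mid (G : set (set T)) : G `<=` measurable ->
    measurable_fun setT (fun x : T => x : g_sigma_algebraType G).
  by move=> mG _ A mA; rewrite setTI; exact: (sm G).
pose P1 := image_prob P (mid _ mG1); pose P2 := image_prob P (mid _ mG2).
have mdiag : measurable_fun setT
    (fun x : T => (x : g_sigma_algebraType G1, x : g_sigma_algebraType G2)).
  by apply/measurable_fun_pairP; split; [exact: (mid _ mG1)|exact: (mid _ mG2)].
pose Q := image_prob P mdiag.
have PQ X : measurable X -> (P1 \x P2)%E X = Q X.
  move=> mX; exact: product_measure_unique.
transitivity (\int[Q]_z f z)%E.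
  exact/esym/(ge0_integral_image_prob P mdiag mf f0).
transitivity (\int[(P1 \x P2)%E]_z f z)%E.
  by apply: eq_measure_integral => A mA _; rewrite /= PQ.
rewrite (@fubini_tonelli1 _ _ _ _ _ P1 P2 f)// ge0_integral_image_prob//=.
- apply: eq_integral => x _; rewrite /fubini_F ge0_integral_image_prob//.
  exact: measurableT_comp.
- exact: measurable_fun_fubini_tonelli_F.
- by move=> x; apply: integral_ge0.
Qed.

End independent_sigma_algebras.

Section independent_families.
Context (R : realType) d d' (T : measurableType d) (T' : measurableType d').
Context (P : probability T R) (K : finType) (X : K -> T -> T').
Hypothesis mX : forall i, measurable_fun setT (X i).
Hypothesis iX : independent P X.

(** A pi-system generating the sigma-algebra of the [X i] with [i] in [J]. Sets are given for all
    indices, with [setT] outside [J], so that [independent] applies to them as it stands. *)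
Definition rectangles (J : pred K) : set (set T) :=
  [set E | exists A : K -> set T', [/\ forall i, measurable (A i),
     forall i, ~~ J i -> A i = setT &
     E = \bigcap_(i in [set: K]) (X i @^-1` A i)]].

Lemma rectangles_measurable J : rectangles J `<=` measurable.
Proof.
move=> _ [A [mA _ ->]]; apply: fin_bigcap_measurable => // i _.
by rewrite -[_ @^-1` _]setTI; exact: mX.
Qed.

Lemma rectangles_setI J : setI_closed (rectangles J).
Proof.
move=> _ _ [A [mA AJ ->]] [B [mB BJ ->]].
exists (fun i => A i `&` B i); split => [i|i Ji|]; first exact: measurableI.
  by rewrite AJ// BJ// setIT.
by rewrite -bigcapI.
Qed.

Lemma rectangles_setT J : rectangles J setT.
Proof. by exists (fun=> setT); split => //; apply/esym/seteqP; split=> x. Qed.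

Lemma measurable_fun_rectangles (J : pred K) i : J i ->
  measurable_fun [set: g_sigma_algebraType (rectangles J)] (X i).
Proof.
move=> Ji _ A mA; rewrite setTI; apply: sub_sigma_algebra.
exists (fun j => if j == i then A else setT); split => [j|j|].
- by case: eqP.
- by case: eqP => // ->; rewrite Ji.
- apply/seteqP; split => x /=; first by move=> Ax j _ /=; case: eqP => // ->.
  by move=> /(_ i I); rewrite /= eqxx.
Qed.

(** A cylinder over [J] and one over its complement meet in a cylinder over all indices; in each
    coordinate one of the two factors is [setT], so the product of probabilities splits. *)
Lemma independent_split (J : pred K) E F :
  <<s rectangles J >> E -> <<s rectangles (predC J) >> F ->
  (P (E `&` F) = P E * P F)%E.
Proof.
apply: independent_generators; try exact: rectangles_measurable;
  try exact: rectangles_setI; try exact: rectangles_setT.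
move=> _ _ [A [mA AJ ->]] [B [mB BJ ->]].
rewrite -bigcapI !iX//.
have -> : \bigcap_(i in [set: K]) (X i @^-1` A i `&` X i @^-1` B i) =
    \bigcap_(i in [set: K]) (X i @^-1` (A i `&` B i)) by [].
rewrite iX; last by move=> i; exact: measurableI.
rewrite -big_split/=; apply: eq_bigr => i _; have [Ji|Ji] := boolP (J i).
  by rewrite (BJ i) ?negbK// setIT preimage_setT probability_setT mule1.
by rewrite (AJ i)// setTI preimage_setT probability_setT mul1e.
Qed.

Lemma independent_split_fubini (J : pred K)
    (f : g_sigma_algebraType (rectangles J) *
         g_sigma_algebraType (rectangles (predC J)) -> \bar R) :
  measurable_fun setT f -> (forall z, 0 <= f z)%E ->
  (\int[P]_x f (x, x) = \int[P]_x \int[P]_y f (x, y))%E.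
Proof.
apply: independent_fubini; try exact: rectangles_measurable.
exact: independent_split.
Qed.

(** Induction on a duplicate-free enumeration of the indices: the product over the tail is
    measurable for the indices other than [i], so the factor of [i] splits off by
    [independent_split_fubini]. *)
Lemma independent_expectation_prod (f : K -> T' -> \bar R) :
  (forall i, measurable_fun setT (f i)) -> (forall i y, 0 <= f i y)%E ->
  (\int[P]_x \prod_i f i (X i x) = \prod_i \int[P]_x f i (X i x))%E.
Proof.
move=> mf f0.
have [s s_uniq sI] : exists2 s : seq K, uniq s & index_enum K = s.
  by exists (index_enum K) => //; exact: index_enum_uniq.
rewrite sI {sI}; elim: s s_uniq => [_|i s IHs /= /andP[is_ us]].
  rewrite big_nil; under eq_integral do rewrite big_nil.
  by rewrite integral_cst//= probability_setT mule1.
rewrite big_cons -IHs//.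
pose F (z : g_sigma_algebraType (rectangles (pred1 i)) *
            g_sigma_algebraType (rectangles (predC (pred1 i)))) :=
  (f i (X i z.1) * \prod_(j <- s) f j (X j z.2))%E.
have mFi : measurable_fun setT
    (fun x : g_sigma_algebraType (rectangles (pred1 i)) => f i (X i x)).
  apply: measurableT_comp => //; apply: measurable_fun_rectangles; exact: eqxx.
have mFs : measurable_fun setT
    (fun x : g_sigma_algebraType (rectangles (predC (pred1 i))) =>
      \prod_(j <- s) f j (X j x))%E.
  elim: s {IHs us F} is_ => [_|j s IHs].
    by under eq_fun do rewrite big_nil; exact: measurable_cst.
  rewrite inE negb_or => /andP[ij is_].
  under eq_fun do rewrite big_cons.
  apply: emeasurable_funM; last exact: IHs.
  by apply: measurableT_comp => //; apply: measurable_fun_rectangles; rewrite /= eq_sym.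
transitivity (\int[P]_x F (x, x))%E.
  by apply: eq_integral => x _; rewrite big_cons.
rewrite independent_split_fubini; last 2 first.
- apply: emeasurable_funM.
    exact: (measurableT_comp mFi).
  exact: (measurableT_comp mFs).
- by move=> z; apply: mule_ge0 => //; apply: prode_ge0.
under eq_integral => x _.
  rewrite /F/= ge0_integralZl//; last 2 first.
  - move=> _ A mA; rewrite setTI.
    have := mFs measurableT A mA; rewrite setTI => h.
    exact: (smallest_sub (@sigma_algebra_measurable _ T)
              (@rectangles_measurable _)) h.
  - by move=> y _; apply: prode_ge0.
  over.
rewrite ge0_integralZr//.
- exact: measurableT_comp.
- by apply: integral_ge0 => x _; apply: prode_ge0.
Qed.

End independent_families.

Import HBNNSimple.

Lemma integral_indicT d (T : measurableType d) (R : realType)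
    (mu : {measure set T -> \bar R}) A : measurable A ->
  (\int[mu]_x (\1_A x)%:E = mu A)%E.
Proof. by move=> mA; rewrite integral_indic// setIT. Qed.

(** * Probability laws given by densities *)

Section densities.
Context (R : realType).
Notation leb := (@lebesgue_measure R).

Lemma density_prob_exists (f : R -> R) :
  measurable_fun setT f -> (forall x, 0 <= f x) ->
  (\int[leb]_x (f x)%:E = 1)%E ->
  exists p : probability (measurableTypeR R) R,
    forall A, measurable A -> p A = (\int[leb]_(x in A) (f x)%:E)%E.
Proof.
move=> mf f0 f1.
pose nu (A : set (measurableTypeR R)) := (\int[leb]_(x in A) (f x)%:E)%E.
have nu0 : nu set0 = 0%E by rewrite /nu integral_set0.
have nu_ge0 A : (0 <= nu A)%E by apply: integral_ge0 => x _; rewrite lee_fin.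
have nu_sigma : semi_sigma_additive nu.
  move=> /= F mF tF mUF; rewrite /nu; apply: cvg_toP.
    apply: ereal_nondecreasing_is_cvgn => m n mn.
    by apply: lee_sum_nneg_natr => // k _ _; exact: nu_ge0.
  rewrite ge0_integral_bigcup//=.
  - by apply/measurable_EFinP; exact: measurable_funTS.
  - by move=> x _; rewrite lee_fin.
pose nuM : {measure set (measurableTypeR R) -> \bar R} :=
  HB.pack nu (isMeasure.Build _ _ _ nu nu0 nu_ge0 nu_sigma).
pose nuP : probability (measurableTypeR R) R :=
  HB.pack nu (Measure.on nuM) (Measure_isProbability.Build _ _ _ nuM f1).
by exists nuP.
Qed.

(** Checked on simple functions, level set by level set, and extended by monotone convergence on
    both sides. *)
Lemma ge0_integral_density (p : {measure set (measurableTypeR R) -> \bar R})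
    (f : R -> R) (g : R -> R) :
  measurable_fun setT f -> (forall x, 0 <= f x) ->
  (forall A, measurable A -> p A = (\int[leb]_(x in A) (f x)%:E)%E) ->
  measurable_fun setT g -> (forall x, 0 <= g x) ->
  (\int[p]_x (g x)%:E = \int[leb]_x (g x * f x)%:E)%E.
Proof.
move=> mf f0 pE mg g0.
have mEg : measurable_fun [set: R] (EFin \o g) by apply/measurable_EFinP.
pose g_ := nnsfun_approx measurableT mEg.
have g_cvg x : (fun n => (g_ n x)%:E) @ \oo --> (g x)%:E.
  by apply: (cvg_nnsfun_approx measurableT mEg) => // y _; rewrite lee_fin.
have nd_g x : {homo (fun n => (g_ n x)%:E) : n m / (n <= m)%N >-> (n <= m)%E}.
  by move=> m n mn; rewrite lee_fin; exact/lefP/nd_nnsfun_approx.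
have mg_ n : measurable_fun setT (fun x : R => (g_ n x)%:E).
  by apply/measurable_EFinP; exact: measurable_funPT.
have mgf n : measurable_fun setT (fun x : R => (g_ n x * f x)%:E).
  by apply/measurable_EFinP; apply: measurable_funM => //; exact: measurable_funPT.
have simple n : (\int[p]_x (g_ n x)%:E = \int[leb]_x (g_ n x * f x)%:E)%E.
  have mr r : measurable (g_ n @^-1` [set r]) by exact: measurable_sfunP.
  have mind r : measurable_fun setT (fun x => r * \1_(g_ n @^-1` [set r]) x).
    apply: measurable_funM => //; exact: measurable_indic.
  under [LHS]eq_integral do rewrite fimfunE -fsumEFin//.
  rewrite [LHS]ge0_integral_fsum//; last 2 first.
  - by move=> r; apply/measurable_EFinP; exact: (mind r).
  - by move=> r x _; rewrite EFinM nnfun_muleindic_ge0.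
  have gfE x : ((g_ n x * f x)%:E = \sum_(r \in range (g_ n))
      ((r * \1_(g_ n @^-1` [set r]) x)%:E * (f x)%:E))%E.
    rewrite fimfunE EFinM -fsumEFin// ge0_mule_fsuml// => r.
    by rewrite EFinM nnfun_muleindic_ge0.
  under [RHS]eq_integral do rewrite gfE.
  rewrite [RHS]ge0_integral_fsum//; last 2 first.
  - move=> r; apply/measurable_EFinP; apply: measurable_funM => //.
    exact: (mind r).
  - move=> r x _; rewrite lee_fin mulr_ge0//.
    by rewrite -lee_fin EFinM nnfun_muleindic_ge0.
  apply: eq_fsbigr => r _.
  have [r0|r0] := ltP r 0.
    rewrite preimage_nnfun0//.
    by rewrite !integral0_eq// => x _; rewrite indicE in_set0 mulr0 ?mul0e.
  have mi : measurable_fun setT (fun x => (\1_(g_ n @^-1` [set r]) x)%:E : \bar R).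
    by apply/measurable_EFinP; exact: measurable_indic.
  under eq_integral do rewrite EFinM.
  rewrite ge0_integralZl//.
  have -> : (\int[p]_x (\1_(g_ n @^-1` [set r]) x)%:E = p (g_ n @^-1` [set r]))%E.
    exact: (integral_indicT p (mr r)).
  rewrite (pE _ (mr r)).
  under [RHS]eq_integral do rewrite EFinM -muleA.
  rewrite ge0_integralZl//; last 2 first.
  - apply: emeasurable_funM => //; exact/measurable_EFinP.
  - by move=> x _; rewrite mule_ge0// lee_fin.
  congr (_ * _)%E.
  rewrite [LHS]integral_mkcond.
  apply: eq_integral => x _.
  by rewrite patchE indicE; case: ifPn => _; rewrite ?mul1e ?mul0e.
transitivity (lim (\int[p]_x (g_ n x)%:E @[n --> \oo])%E).
  rewrite -monotone_convergence//=.
  - by apply: eq_integral => x _; exact/esym/cvg_lim.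
  - by move=> n x _; rewrite lee_fin.
transitivity (lim (\int[leb]_x (g_ n x * f x)%:E @[n --> \oo])%E).
  by apply: congr_lim; apply/funext => n; exact: simple.
rewrite -monotone_convergence//=.
- apply: eq_integral => x _; apply/cvg_lim => //.
  under eq_fun do rewrite EFinM.
  by rewrite EFinM; apply: cvgeZr => //.
- by move=> n x _; rewrite lee_fin mulr_ge0.
- by move=> x _ m n mn; rewrite lee_fin ler_wpM2r// -lee_fin; exact: nd_g.
Qed.

End densities.

Definition laplace (R : realType) (mu : probability (measurableTypeR R) R)
    (l : R) : \bar R :=
  (\int[mu]_x (expR (- (l * x)))%:E)%E.

(** * Gamma laws *)

Section gamma_laws.
Context (R : realType).
Notation leb := (@lebesgue_measure R).
Implicit Types (c l s x : R) (n : nat).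

Lemma measurable_expRN l : measurable_fun setT (fun x : R => expR (- (l * x))).
Proof. by apply: measurableT_comp => //; exact: measurableT_comp. Qed.

Lemma ge0_integralZl_EFin_fun (D : set R) k (g : R -> R) :
  measurable D -> measurable_fun setT g -> (forall x, 0 <= g x) -> 0 <= k ->
  (\int[leb]_(x in D) (k%:E * (g x)%:E) = k%:E * \int[leb]_(x in D) (g x)%:E)%E.
Proof.
move=> mD mg g0 k0; rewrite ge0_integralZl//.
- by apply/measurable_EFinP; exact: measurable_funTS.
- by move=> x _; rewrite lee_fin.
Qed.

Lemma integral_expRN s : 0 < s ->
  (\int[leb]_(x in `[0%R, +oo[%classic) (expR (- (s * x)))%:E = (s^-1)%:E)%E.
Proof.
move=> s0; have I1 := @integral_exponential_pdf R s s0.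
have : (\int[leb]_(x in `[0%R, +oo[%classic) (s%:E * (expR (- (s * x)))%:E) = 1)%E.
  rewrite -I1 [LHS]integral_mkcond; apply: eq_integral => x _.
  by rewrite /exponential_pdf !patchE; case: ifP => _; rewrite ?mulNr.
rewrite ge0_integralZl_EFin_fun; [|by []|exact: measurable_expRN|by move=> ?; rewrite expR_ge0|by rewrite ?expR_ge0 ?ltW//].
move=> sI; have : (s^-1%:E * (s%:E * \int[leb]_(x in `[0%R, +oo[%classic)
    (expR (- (s * x)))%:E) = s^-1%:E)%E by rewrite sI mule1.
by rewrite muleA -EFinM mulVf ?gt_eqF// mul1e.
Qed.

Lemma integral_expRN_oy s : 0 < s ->
  (\int[leb]_(x in `]0%R, +oo[%classic) (expR (- (s * x)))%:E = (s^-1)%:E)%E.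
Proof.
move=> s0; rewrite integral_itv_obnd_cbnd ?integral_expRN//.
by apply/measurable_EFinP; apply: measurable_funTS; exact: measurable_expRN.
Qed.

Lemma gamma_function1 : gamma_function (1 : R) = 1.
Proof.
rewrite /gamma_function /Rintegral.
under eq_integral do rewrite subrr powRr0 mul1r -[X in - X]mul1r.
by rewrite integral_expRN_oy// invr1.
Qed.

Lemma gamma_pdf1E c x : 0 < c ->
  gamma_pdf 1 c x = if 0 < x then c * expR (- (c * x)) else 0.
Proof.
move=> c0; rewrite /gamma_pdf; case: ifPn => // x0.
by rewrite gamma_function1 powRr1 ?ltW// divr1 subrr powRr0 mulr1.
Qed.

(** Shape one is enough for the weak approximation: an atom of mass 2 of the Thorin measure
    corresponds to two exponential laws of the same rate. *)
Lemma gamma1_exists c : 0 < c -> exists p : probability (measurableTypeR R) R,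
  [/\ forall A, measurable A -> p A = gamma_prob 1 c A,
      p `]-oo, 0[%classic = 0%E &
      forall l, 0 <= l -> laplace p l = ((1 + l / c)^-1)%:E].
Proof.
move=> c0.
have f0 x : 0 <= gamma_pdf 1 c x.
  by rewrite gamma_pdf1E//; case: ifP => // _; rewrite mulr_ge0 ?expR_ge0// ltW.
have mf : measurable_fun setT (gamma_pdf 1 c).
  rewrite (_ : gamma_pdf 1 c = fun x => c * expR (- (c * x)) * \1_(`]0%R, +oo[%classic) x).
    by apply: measurable_funM => //; apply: measurable_funM => //; exact: measurable_expRN.
  apply/funext => x; rewrite gamma_pdf1E// indicE.
  have -> : (x \in `]0%R, +oo[%classic) = (0 < x).
    by apply/idP/idP; rewrite inE/= in_itv/= andbT.
  by case: ifP => _; rewrite ?mulr1 ?mulr0.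
have lapE l : 0 <= l ->
    (\int[leb]_x (expR (- (l * x)) * gamma_pdf 1 c x)%:E = ((1 + l / c)^-1)%:E)%E.
  move=> l0; have cl0 : 0 < c + l by rewrite ltr_wpDr.
  transitivity (\int[leb]_(x in `]0%R, +oo[%classic)
      (c%:E * (expR (- ((c + l) * x)))%:E))%E.
    rewrite [RHS]integral_mkcond; apply: eq_integral => x _.
    rewrite patchE gamma_pdf1E//.
    have -> : (x \in `]0%R, +oo[%classic) = (0 < x).
      by apply/idP/idP; rewrite inE/= in_itv/= andbT.
    case: ifP => _; last by rewrite mulr0.
    rewrite -EFinM mulrCA -expRD; congr ((_ * expR _)%:E); lra.
  rewrite ge0_integralZl_EFin_fun; [|by []|exact: measurable_expRN|by move=> ?; rewrite expR_ge0|by rewrite ?expR_ge0 ?ltW//].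
  rewrite integral_expRN_oy// -EFinM; congr (_%:E).
  by field; rewrite ?gt_eqF.
have f1 : (\int[leb]_x (gamma_pdf 1 c x)%:E = 1)%E.
  have := lapE 0 (lexx 0); rewrite mul0r addr0 invr1 => <-.
  by apply: eq_integral => x _; rewrite mul0r oppr0 expR0 mul1r.
have [p pE] := density_prob_exists mf f0 f1.
exists p; split => //.
  rewrite pE//; apply: integral0_eq => x /=; rewrite in_itv/= => x0.
  by rewrite gamma_pdf1E// ltNge (ltW x0).
move=> l l0; rewrite /laplace (ge0_integral_density mf f0 pE) ?lapE//.
exact: measurable_expRN.
Qed.

Lemma measurable_expRNX c n :
  measurable_fun setT (fun x : R => expR (- (c * x ^+ n))).
Proof.
apply: measurableT_comp => //; apply: measurableT_comp => //.
by apply: measurable_funM => //; exact: exprn_measurable.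
Qed.

Let Z n s := (\int[leb]_(x in `[0%R, +oo[%classic) (expR (- (s * x ^+ n)))%:E)%E.

(** Substitution of [k * x] for [x]. This homogeneity yields the ratio of two values of [Z], so the
    value itself, a Gamma integral, never has to be computed. *)
Let Z_scale n s k : 0 < s -> 0 < k -> (Z n s = k%:E * Z n (s * k ^+ n))%E.
Proof.
move=> s0 k0.
have dk : (fun x : R => k * x)^`()%classic = cst k.
  by apply/funext => x; rewrite derive1Ml// derive1_id mulr1.
rewrite /Z; have := @increasing_ge0_integration_by_substitutiony R
  (fun x => k * x) (fun x => expR (- (s * x ^+ n))) 0.
rewrite mulr0 dk => ->.
- rewrite -ge0_integralZl_EFin_fun; [|by []|exact: measurable_expRNX|by move=> ?; rewrite expR_ge0|by rewrite ?expR_ge0 ?ltW//].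
  apply: eq_integral => x _; rewrite -EFinM; congr (_%:E).
  by rewrite -[LHS]/(expR (- (s * (k * x) ^+ n)) * k) exprMn mulrA mulrC.
- by move=> x y _ _; rewrite ltr_pM2l.
- by move=> x _; exact: cst_continuous.
- exact: is_cvg_cst.
- exact: is_cvg_cst.
- split; first by move=> x _; exact: ex_derive.
  by apply: cvg_at_right_filter; apply: cvgM; [exact: cvg_cst|exact: cvg_id].
- exact: gt0_cvgMry.
- apply: continuous_subspaceT => x.
  apply: continuous_comp; last exact: continuous_expR.
  apply: continuousN; apply: continuousM; first exact: cst_continuous.
  exact: exprn_continuous.
- by move=> x _; exact: expR_ge0.
Qed.

(** From below the integrand is at least exp(- s) on [0, 1]; from above it is at most exp(s) exp(- s
    x), because x - 1 <= x^n for x >= 0. *)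
Let Z_bounds n s : (0 < n)%N -> 0 < s -> (0 < Z n s < +oo)%E.
Proof.
move=> n0 s0; apply/andP; split.
  apply: (@lt_le_trans _ _ (\int[leb]_(x in `[0%R, 1%R]%classic) (expR (- s))%:E)%E).
    rewrite integral_cst//= lebesgue_measure_itv/= lte_fin ltr01 oppr0 adde0 mule1.
    by rewrite lte_fin expR_gt0.
  apply: (@le_trans _ _ (\int[leb]_(x in `[0%R, 1%R]%classic) (expR (- (s * x ^+ n)))%:E)%E).
    apply: ge0_le_integral => //=.
    - by apply/measurable_EFinP; apply: measurable_funTS; exact: measurable_expRNX.
    - move=> x; rewrite in_itv/= => /andP[x0 x1].
      by rewrite lee_fin ler_expR lerN2 ler_piMr ?exprn_ile1// ltW.
  apply: ge0_subset_integral => //=.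
  - by apply/measurable_EFinP; apply: measurable_funTS; exact: measurable_expRNX.
  - by apply: subset_itvl.
apply: (@le_lt_trans _ _ (\int[leb]_(x in `[0%R, +oo[%classic)
   ((expR s)%:E * (expR (- (s * x)))%:E))%E).
  apply: ge0_le_integral => //=.
  - by apply/measurable_EFinP; apply: measurable_funTS; exact: measurable_expRNX.
  - apply: measurable_funTS; apply: emeasurable_funM => //.
    by apply/measurable_EFinP; exact: measurable_expRN.
  - move=> x; rewrite in_itv/= andbT => x0.
    rewrite -EFinM lee_fin -expRD ler_expR.
    suff : s * (x - 1) <= s * x ^+ n by lra.
    rewrite ler_pM2l//; have [x1|x1] := lerP x 1.
      by apply: (@le_trans _ _ 0); rewrite ?subr_le0// exprn_ge0.
    rewrite (@le_trans _ _ x)//; first lra.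
    by rewrite -[leLHS]expr1 ler_eXn2l.
rewrite ge0_integralZl_EFin_fun; [|by []|exact: measurable_expRN|by move=> ?; rewrite expR_ge0|by rewrite ?expR_ge0 ?ltW//].
by rewrite integral_expRN// -EFinM ltry.
Qed.

(* The law of Y ^+ n, where Y > 0 has density proportional to
   exp (- c y ^+ n), is the gamma law of shape 1 / n. *)
Lemma gamma_root_exists n c : (0 < n)%N -> 0 < c ->
  exists p : probability (measurableTypeR R) R,
  p `]-oo, 0[%classic = 0%E /\
  forall l, 0 <= l -> laplace p l = ((1 + l / c)^-1 `^ (n%:R^-1))%:E.
Proof.
move=> n0 c0; have /andP[Z0 Zoo] := Z_bounds n0 c0.
have Zfin : (Z n c) \is a fin_num by rewrite ge0_fin_numE// ltW.
pose z := fine (Z n c).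
have zE : Z n c = z%:E by rewrite fineK.
have z0 : 0 < z by rewrite fine_gt0// Z0.
pose f x := z^-1 * (expR (- (c * x ^+ n)) * \1_(`[0%R, +oo[%classic) x).
have f0 x : 0 <= f x.
  apply: mulr_ge0; first by rewrite invr_ge0 ltW.
  by apply: mulr_ge0; [exact: expR_ge0|rewrite indicE].
have mf : measurable_fun setT f.
  by do 2 apply: measurable_funM => //; exact: measurable_expRNX.
have lapE l : 0 <= l ->
    (\int[leb]_x (expR (- (l * x ^+ n)) * f x)%:E = z^-1%:E * Z n (c + l))%E.
  move=> l0; transitivity (\int[leb]_(x in `[0%R, +oo[%classic)
      (z^-1%:E * (expR (- ((c + l) * x ^+ n)))%:E))%E.
    rewrite [RHS]integral_mkcond; apply: eq_integral => x _.
    rewrite patchE /f indicE; case: ifP => _; last by rewrite !mulr0.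
    rewrite mulr1 mulrCA -expRD -EFinM; congr ((_ * expR _)%:E); lra.
  rewrite ge0_integralZl_EFin_fun; [by []|by []|exact: measurable_expRNX|by move=> ?; rewrite expR_ge0|by rewrite invr_ge0 ltW//].
have f1 : (\int[leb]_x (f x)%:E = 1)%E.
  have := lapE 0 (lexx 0); rewrite addr0 zE -EFinM mulVf ?gt_eqF// => <-.
  by apply: eq_integral => x _; rewrite mul0r oppr0 expR0 mul1r.
have [p pE] := density_prob_exists mf f0 f1.
have mX : measurable_fun [set: measurableTypeR R] (fun x : R => x ^+ n : measurableTypeR R).
  exact: exprn_measurable.
exists (image_prob p mX); split.
  rewrite -[LHS]/(p ((fun x : R => x ^+ n) @^-1` `]-oo, 0[%classic)) pE; last first.
    by rewrite -[X in measurable X]setTI; apply: mX => //; exact: measurable_itv.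
  apply: integral0_eq => x /=; rewrite in_itv/= => xn0.
  rewrite /f indicE; case: (boolP (_ \in _)); last by rewrite !mulr0.
  by rewrite inE/= in_itv/= andbT => x0; rewrite ltNge exprn_ge0 in xn0.
move=> l l0; rewrite /laplace ge0_integral_image_prob//; last first.
  by apply/measurable_EFinP; exact: measurable_expRN.
rewrite (ge0_integral_density mf f0 pE)//; last exact: measurable_expRNX.
rewrite lapE//.
have cl0 : 0 < 1 + l / c by rewrite ltr_wpDr// divr_ge0// ltW.
(* Scaling by [k] turns the rate [c] into [c + l], so the quotient of the two normalizing integrals
   is [k^-1], the desired transform. *)
pose k := (1 + l / c) `^ (n%:R^-1).
have k0 : 0 < k by rewrite powR_gt0.
have kn : k ^+ n = 1 + l / c.
  by rewrite -powR_mulrn ?ltW// -powRrM mulVf ?powRr1 ?ltW// pnatr_eq0 -lt0n.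
have := Z_scale n c0 k0; rewrite kn mulrDr mulr1 mulrCA divff ?gt_eqF// mulr1 zE.
have /andP[Z'0 Z'oo] := Z_bounds n0 (ltr_wpDr l0 c0).
have : (Z n (c + l)) \is a fin_num by rewrite ge0_fin_numE// ltW.
move=> /fineK <-; rewrite -!EFinM => -[] zk; congr (_%:E).
rewrite -powR_inv1 ?ltW// -powRrM mulN1r powRN -/k zk.
have y0 : fine (Z n (c + l)) != 0.
  by apply: contraTneq z0 => y0; rewrite zk y0 mulr0 ltxx.
by field; rewrite y0 gt_eqF.
Qed.

End gamma_laws.

Section product_rectangles.
Context (R : realType) d1 d2 (T1 : measurableType d1) (T2 : measurableType d2).
Variables (P1 : probability T1 R) (P2 : probability T2 R).

Lemma product_prob_setXT A : measurable A ->
  (P1 \x P2)%E (A `*` setT) = P1 A.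
Proof.
move=> mA; rewrite product_measure1E// -[RHS]mule1; congr (_ * _)%E.
exact: probability_setT.
Qed.

Lemma product_prob_setTX A : measurable A ->
  (P1 \x P2)%E (setT `*` A) = P2 A.
Proof.
move=> mA; rewrite product_measure1E// -[RHS]mul1e; congr (_ * _)%E.
exact: probability_setT.
Qed.

End product_rectangles.

(** * Laws on the line and their convolutions *)

Section laws_on_the_line.
Context (R : realType).
Notation law := (probability (measurableTypeR R) R).
Implicit Types (mu nu : law).

Lemma law_eq_cdf mu nu :
  (forall r : R, mu `]-oo, r]%classic = nu `]-oo, r]%classic) ->
  forall A, measurable A -> mu A = nu A.
Proof.
move=> mn; pose g n : set (measurableTypeR R) := `](- n%:R), n%:R]%classic.
apply: (@measure_unique _ R (measurableTypeR R) (@ocitv R) g) => //.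
- by move=> A B; exact: ocitvI.
- by move=> i; exact: is_ocitv.
- rewrite -subTset => x _ /=; exists (Num.truncn `|x|).+1 => //=.
  have := truncnS_gt `|x|; rewrite ltr_norml /g /= in_itv/= => /andP[-> xt] /=.
  exact: ltW.
- move=> _ [[a b] _ <-] /=.
  have E (p : law) : p `]a, b]%classic = (p (`]-oo, b]%classic `\` `]-oo, a]%classic)).
    congr (p _); apply/seteqP; split => x /=; rewrite !in_itv/=.
      by move=> /andP[ax xb]; split => //; rewrite leNgt ax.
    by move=> [-> /negP]; rewrite -ltNge => ->.
  have [ba|ab] := leP b a; first by rewrite set_itv_ge ?measure0// bnd_simp -leNgt.
  have D (p : law) : p (`]-oo, b]%classic `\` `]-oo, a]%classic) =
      (p `]-oo, b]%classic - p `]-oo, a]%classic)%E.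
    rewrite measureD//; last by rewrite (le_lt_trans (probability_le1 p _)) ?ltry.
    congr (_ - p _)%E; apply/seteqP; split => x /=; rewrite !in_itv/=; first by case.
    by move=> xa; split => //; rewrite (le_trans xa)// ltW.
  by rewrite !E !D !mn.
- move=> k; apply: le_lt_trans (ltry 1); apply: probability_le1; exact: measurable_itv.
Qed.

Lemma cdf_law_exists (f : R -> R) :
  nondecreasing f -> right_continuous f -> f @ -oo --> (0 : R) ->
  f @ +oo --> (1 : R) ->
  exists mu : law, forall r : R, mu `]-oo, r]%classic = (f r)%:E.
Proof.
move=> nf rf fN fP.
pose F : cumulativeBounded (0 : R) (1 : R) :=
  HB.pack f (isCumulative.Build R _ R f nf rf)
    (isCumulativeBounded.Build R 0 1 f fN fP).
exists (lebesgue_stieltjes_measure F) => r.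
exact: (cdf_lebesgue_stieltjes_id F r).
Qed.

Lemma measurable_sum2 :
  measurable_fun [set: measurableTypeR R * measurableTypeR R]
    (fun z => z.1 + z.2 : measurableTypeR R).
Proof. exact: (measurable_funD measurable_fst measurable_snd). Qed.

Definition convolution mu nu : law :=
  image_prob (mu \x nu)%E measurable_sum2.

Lemma laplace_convolution mu nu l :
  laplace (convolution mu nu) l = (laplace mu l * laplace nu l)%E.
Proof.
have mE : measurable_fun [set: measurableTypeR R]
    (fun x : R => (expR (- (l * x)))%:E).
  by apply/measurable_EFinP; exact: measurable_expRN.
rewrite /laplace ge0_integral_image_prob//.
pose f (z : measurableTypeR R * measurableTypeR R) :=
  ((expR (- (l * z.1)))%:E * (expR (- (l * z.2)))%:E : \bar R)%E.
transitivity (\int[(mu \x nu)%E]_z f z)%E.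
  apply: eq_integral => z _; rewrite /f -EFinM -expRD; congr (expR _)%:E; ring.
rewrite (@fubini_tonelli1 _ _ _ _ _ mu nu f); last 2 first.
- by apply: emeasurable_funM; [exact: (measurableT_comp mE measurable_fst)
    |exact: (measurableT_comp mE measurable_snd)].
- by move=> z; rewrite mule_ge0// lee_fin expR_ge0.
rewrite /fubini_F/= -ge0_integralZr//; last by apply: integral_ge0 => x _; rewrite lee_fin expR_ge0.
by apply: eq_integral => x _; rewrite /f/= ge0_integralZl// lee_fin expR_ge0.
Qed.

(** Outside the null event that the second summand is negative, the sum lies in [A] only if the
    first summand lies in [B]. *)
Lemma convolution_le mu nu (A B : set R) :
  measurable A -> measurable B -> nu `]-oo, 0[%classic = 0%E ->
  (forall x y, 0 <= y -> A (x + y) -> B x) ->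
  (convolution mu nu A <= mu B)%E.
Proof.
move=> mA mB nu0 AB.
have mBT : measurable (B `*` [set: R] : set (measurableTypeR R * measurableTypeR R)).
  exact: measurableX.
have mTN : measurable ([set: R] `*` `]-oo, 0[%classic :
    set (measurableTypeR R * measurableTypeR R)).
  exact: measurableX.
apply: (@le_trans _ _ ((mu \x nu)%E
   ((B `*` [set: R]) `|` ([set: R] `*` `]-oo, 0[%classic)))).
  rewrite -[leLHS]/((mu \x nu)%E ((fun z : R * R => z.1 + z.2) @^-1` A)).
  apply: le_measure; rewrite ?inE//.
  - by rewrite -[X in measurable X]setTI; exact: measurable_sum2.
  - exact: measurableU.
  - move=> [x y] /= Axy; have [y0|y0] := ltP y 0; first by right; rewrite in_itv.
    by left; split => //; exact: AB Axy.
have E1 : (mu \x nu)%E (B `*` [set: measurableTypeR R]) = mu B.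
  exact: product_prob_setXT.
have E2 : (mu \x nu)%E ([set: measurableTypeR R] `*` `]-oo, 0[%classic) = 0%E.
  by rewrite -[RHS]nu0; exact: product_prob_setTX.
apply: (le_trans (measureU2 _ _ _)) => //.
apply: (@le_trans _ _ (mu B + 0)%E); last by rewrite adde0.
by apply: leeD; [rewrite -E1|rewrite -E2]; exact: lexx.
Qed.

Lemma convolution_nonneg mu nu : mu `]-oo, 0[%classic = 0%E ->
  nu `]-oo, 0[%classic = 0%E -> convolution mu nu `]-oo, 0[%classic = 0%E.
Proof.
move=> mu0 nu0; apply/eqP; rewrite eq_le measure_ge0 andbT -mu0.
apply: convolution_le => // x y y0 /=; rewrite !in_itv/= => xy.
by rewrite (le_lt_trans _ xy)// lerDl.
Qed.

(** Adding an independent nonnegative term lowers the distribution function. This is the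
    monotonicity that [laplace_limit_law] asks for. *)
Lemma cdf_convolution_le mu nu r : nu `]-oo, 0[%classic = 0%E ->
  (convolution mu nu `]-oo, r]%classic <= mu `]-oo, r]%classic)%E.
Proof.
move=> nu0; apply: convolution_le => // x y y0 /=; rewrite !in_itv/= => xy.
by rewrite (le_trans _ xy)// lerDl.
Qed.

Fixpoint convolution_seq (nu : nat -> law) (m : nat) : law :=
  if m is k.+1 then convolution (convolution_seq nu k) (nu k)
  else dirac (0 : measurableTypeR R).

Lemma laplace_convolution_seq (nu : nat -> law) m l :
  laplace (convolution_seq nu m) l = (\prod_(j < m) laplace (nu j) l)%E.
Proof.
elim: m => [|m IHm]; last by rewrite big_ord_recr/= laplace_convolution IHm.
rewrite big_ord0 /laplace integral_dirac//=.
  by rewrite diracT mul1e mulr0 oppr0 expR0.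
by apply/measurable_EFinP; exact: measurable_expRN.
Qed.

Lemma convolution_seq_nonneg (nu : nat -> law) m :
  (forall j, nu j `]-oo, 0[%classic = 0%E) ->
  convolution_seq nu m `]-oo, 0[%classic = 0%E.
Proof.
move=> nu0; elim: m => [|m IHm]; last exact: convolution_nonneg.
by rewrite /= diracE; case: (boolP (_ \in _)) => //; rewrite inE/= in_itv/= ltxx.
Qed.

(** Each further variable adds one factor, the line with its law, to the sample space;
    [unlift ord_max] recognizes the new index. For the empty family any probability space will
    do. *)
Lemma independent_family_exists (nu : nat -> law) m :
  exists (d : measure_display) (T : measurableType d) (P : probability T R)
    (X : 'I_m -> T -> R), (forall i, has_law P (X i) (nu i)) /\ independent P X.
Proof.
elim: m => [|m [d [T [P [X [lX iX]]]]]].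
  exists _, (measurableTypeR R), (nu 0%N), (fun _ => id); split; first by case.
  move=> A mA; rewrite big_ord0 (_ : \bigcap_(i in _) _ = setT) ?probability_setT//.
  by apply/seteqP; split => // x _ [].
pose X' (i : 'I_m.+1) (z : T * measurableTypeR R) : R :=
  if unlift ord_max i is Some j then X j z.1 else z.2.
have XS j z : X' (lift ord_max j) z = X j z.1 by rewrite /X' liftK.
have XM z : X' ord_max z = z.2 by rewrite /X' unlift_none.
have mXi j A : measurable A -> measurable (X j @^-1` A).
  by move=> mA; rewrite -[X in measurable X]setTI; exact: (lX j).1.
have law i : has_law (P \x nu m)%E (X' i) (nu i).
  case: (unliftP ord_max i) => [j|] ->; split.
  - rewrite (_ : X' _ = X j \o fst); last by apply/funext => z; rewrite XS.
    exact: (measurableT_comp (lX j).1).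
  - move=> A mA; rewrite (_ : X' _ @^-1` A = (X j @^-1` A) `*` [set: R]).
      apply: etrans (product_prob_setXT P (nu m) (mXi j A mA)) _.
      by rewrite (lX j).2// lift_max.
    apply/seteqP; split => z /=; rewrite XS; first by split.
    by case.
  - rewrite (_ : X' _ = snd); last by apply/funext => z; rewrite XM.
    exact: measurable_snd.
  - move=> A mA; rewrite (_ : X' _ @^-1` A = [set: T] `*` A).
      exact: product_prob_setTX.
    apply/seteqP; split => z /=; rewrite XM; first by split.
    by case.
exists _, (T * measurableTypeR R)%type, (P \x nu m)%E, X'; split => // A mA.
have -> : \bigcap_(i in [set: 'I_m.+1]) (X' i @^-1` A i) =
    (\bigcap_(j in [set: 'I_m]) (X j @^-1` A (lift ord_max j))) `*` A ord_max.
  apply/seteqP; split => [z Xz|z [/= Xz Az] i _].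
    split; last by have := Xz ord_max I; rewrite /= XM.
    by move=> j _; have := Xz (lift ord_max j) I; rewrite /= XS.
  case: (unliftP ord_max i) => [j|] -> /=; last by rewrite XM.
  by rewrite XS; exact: Xz.
have mcap : measurable (\bigcap_(j in [set: 'I_m]) (X j @^-1` A (lift ord_max j))).
  by apply: fin_bigcap_measurable => // j _; exact: mXi.
apply: etrans (product_measure1E P (nu m) mcap (mA ord_max)) _.
have := iX (fun j => A (lift ord_max j)) (fun j => mA _) => /= ->.
rewrite big_ord_recr/=; congr (_ * _)%E; last by rewrite (law ord_max).2.
apply: eq_bigr => j _; rewrite (_ : widen_ord _ j = lift ord_max j); last first.
  by apply: val_inj; exact: (esym (lift_max j)).
by rewrite (lX j).2// (law _).2// lift_max.
Qed.

End laws_on_the_line.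

(** * Weierstrass approximation *)

Section weierstrass.
Context (R : realType).
Implicit Types (f : R -> R) (x y e : R).

(** Uniform continuity in the form that a variance can absorb: the Bernstein operator turns the
    quadratic term into a variance. *)
Lemma compact_quadratic_modulus f e : continuous f -> 0 < e ->
  exists2 K, 0 <= K & forall x y, x \in `[0, 1]%R -> y \in `[0, 1]%R ->
    `|f x - f y| <= e + K * (x - y) ^+ 2.
Proof.
move=> cf e0.
have [M M0 fM] : exists2 M, 0 <= M & forall y, y \in `[0, 1]%R -> `|f y| <= M.
  have c1 : {within `[0%R, 1%R]%classic, continuous (fun y => `|f y|)}.
    apply: continuous_subspaceT => y.
    by apply: continuous_comp; [exact: cf|exact: norm_continuous].
  have [c _ cM] := EVT_max ler01 c1.
  by exists `|f c|.
pose Q (i : R) x := forall y, y \in `[0, 1]%R ->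
  `|f x - f y| <= e + i * (x - y) ^+ 2.
have : \forall i \near +oo, `[0%R, 1%R]%classic `<=` Q i.
  have /compact_near_coveringP := @segment_compact R 0 1.
  apply => x x01.
  have e2 : 0 < e / 2 by rewrite divr_gt0.
  have := cf x; move=> /cvgrPdist_lt/(_ _ e2) [d /= d0 dP].
  have d2 : 0 < d / 2 by rewrite divr_gt0.
  (* Points [y] within [d / 2] of [x'] are covered by the term [e]. For the others
     [i * (d / 2) ^+ 2] already exceeds [2 * M + e]; the summand [e] is there because [x'] itself
     may lie outside [0, 1], where [M] bounds nothing. *)
  exists (ball x (d / 2), [set i | (2 * M + e) / (d / 2) ^+ 2 <= i]) => /=.
    split; first exact: nbhsx_ballx.
    by exists ((2 * M + e) / (d / 2) ^+ 2); split; [exact: num_real|move=> z /ltW].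
  move=> [x' i] /= [xx' ii] y y01.
  have fxx' : `|f x - f x'| < e / 2.
    by apply: dP; rewrite /= (lt_trans xx')//; lra.
  have i0 : 0 <= i.
    by apply: le_trans ii; rewrite divr_ge0// ?sqr_ge0//; lra.
  have [yx'|yx'] := ltP `|x' - y| (d / 2).
    have fxy : `|f x - f y| < e / 2.
      apply: dP => /=; rewrite (_ : x - y = (x - x') + (x' - y)); last by ring.
      by rewrite (le_lt_trans (ler_normD _ _))//; move: xx'; rewrite /ball/=; lra.
    have h := ler_distD (f x) (f x') (f y); rewrite (distrC (f x') (f x)) in h.
    have := mulr_ge0 i0 (sqr_ge0 (x' - y)); lra.
  have h1 : `|f x' - f y| <= 2 * M + e.
    have h2 := ler_distD (f x) (f x') (f y); rewrite (distrC (f x') (f x)) in h2.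
    have h3 := ler_normB (f x) (f y).
    have h4 := fM _ x01; have h5 := fM _ y01; lra.
  apply: (le_trans h1); rewrite -[leLHS]add0r lerD ?(ltW e0)//.
  have d20 : 0 < (d / 2) ^+ 2 by rewrite exprn_gt0.
  move: ii; rewrite ler_pdivrMr// => /le_trans; apply.
  rewrite ler_wpM2l// -[leRHS]real_normK ?num_real//.
  by rewrite ler_pXn2r// nnegrE// ltW.
move=> [K [_ KP]]; exists (`|K| + 1); first by rewrite addr_ge0.
move=> x y x01 y01; apply: KP => //.
by rewrite (le_lt_trans (ler_norm K))// ltrDl.
Qed.

(* The n-th Bernstein polynomial of k |-> a k, by conditioning on the first
   of n Bernoulli trials with success probability 'X. *)
Fixpoint bernstein n (a : nat -> R) : {poly R} :=
  if n is m.+1 then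
    'X * bernstein m (fun k => a k.+1) + (1 - 'X) * bernstein m a
  else (a 0%N)%:P.

Lemma bernstein_ge0 n a x : x \in `[0, 1]%R ->
  (forall k, (k <= n)%N -> 0 <= a k) -> 0 <= (bernstein n a).[x].
Proof.
rewrite in_itv/= => /andP[x0 x1].
elim: n a => [|n IHn] a a0; first by rewrite /= hornerC a0.
rewrite /= !hornerE addr_ge0// mulr_ge0//; first by apply: IHn => k kn; exact: a0.
  by rewrite subr_ge0.
by apply: IHn => k kn; apply: a0; exact: leqW.
Qed.

Lemma bernsteinD n a b : bernstein n (fun k => a k + b k) =
  bernstein n a + bernstein n b.
Proof.
elim: n a b => [|n IHn] a b /=; first by rewrite polyCD.
by rewrite !IHn; ring.
Qed.

Lemma bernsteinZ n c a : bernstein n (fun k => c * a k) = c *: bernstein n a.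
Proof.
elim: n a => [|n IHn] a /=; first by rewrite polyCM mul_polyC.
by rewrite !IHn -!mul_polyC; ring.
Qed.

Lemma bernstein_cst n c : bernstein n (fun=> c) = c%:P.
Proof. by elim: n => [|n IHn] //=; rewrite IHn; ring. Qed.

(** The second moment of a shifted binomial variable. The shift [c] has to be general in the
    induction, since a success in the first trial replaces [c] by [c + 1]. *)
Lemma bernstein_variance n x c :
  (bernstein n (fun k => (k%:R + c) ^+ 2)).[x] =
  (n%:R * x + c) ^+ 2 + n%:R * (x * (1 - x)).
Proof.
elim: n c => [|n IHn] c /=; first by rewrite hornerC !mul0r addr0.
have -> : (fun k => (k.+1%:R + c) ^+ 2) = (fun k => (k%:R + (c + 1)) ^+ 2).
  by apply/funext => k; rewrite -[k.+1%:R]natr1; congr (_ ^+ 2); ring.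
rewrite hornerD !hornerM hornerX hornerD hornerN hornerX hornerC !IHn -natr1.
by ring.
Qed.

(** The Bernstein operator is positive and fixes constants, so it may be applied to the quadratic
    modulus between [f x] and the sampled values: the error is at most e/2 + K x (1 - x) / n. *)
Lemma weierstrass f e : continuous f -> 0 < e ->
  exists p : {poly R}, forall x, x \in `[0, 1]%R -> `|f x - p.[x]| <= e.
Proof.
move=> cf e0; have e2 : 0 < e / 2 by rewrite divr_gt0.
have [K K0 fK] := compact_quadratic_modulus cf e2.
have [n n0 nK] : exists2 n : nat, (0 < n)%N & K / (e / 2) < n%:R.
  by exists (Num.truncn (K / (e / 2))).+1 => //; exact: truncnS_gt.
pose N : R := n%:R; have N0 : 0 < N by rewrite ltr0n.
exists (bernstein n (fun k => f (k%:R / N))) => x x01.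
pose b k := e / 2 + K * ((k%:R - N * x) ^+ 2 / N ^+ 2).
have bE : (bernstein n b).[x] = e / 2 + K * (x * (1 - x) / N).
  have -> : b = fun k => e / 2 + (K / N ^+ 2) * (k%:R + (- (N * x))) ^+ 2.
    by apply/funext => k; rewrite /b; ring.
  rewrite (bernsteinD _ (fun=> e / 2)).
  rewrite (bernsteinZ _ _ (fun k => (k%:R + - (N * x)) ^+ 2)).
  rewrite bernstein_cst hornerD hornerC hornerZ.
  rewrite bernstein_variance -/N; field.
  by rewrite gt_eqF.
have be : (bernstein n b).[x] <= e.
  rewrite bE [leRHS]splitr lerD2l.
  move: x01; rewrite in_itv/= => /andP[x0 x1].
  apply: (@le_trans _ _ (K / N)).
    rewrite ler_wpM2l// -[leRHS]mul1r ler_wpM2r ?invr_ge0 ?(ltW N0)//; nra.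
  by rewrite ler_pdivrMr// mulrC -ler_pdivrMr// ltW.
have kb k : (k <= n)%N -> `|f x - f (k%:R / N)| <= b k.
  move=> kn; have k01 : k%:R / N \in `[0, 1]%R.
    by rewrite in_itv/= divr_ge0 ?ler0n ?(ltW N0)//= ler_pdivrMr// mul1r ler_nat.
  have := fK _ _ x01 k01; rewrite /b.
  suff -> : (k%:R - N * x) ^+ 2 / N ^+ 2 = (x - k%:R / N) ^+ 2 by [].
  by field; rewrite gt_eqF.
rewrite (le_trans _ be)// ler_norml; apply/andP; split.
- have := @bernstein_ge0 n (fun k => b k + (f x + (-1) * f (k%:R / N))) x x01.
  rewrite (bernsteinD _ b) (bernsteinD _ (fun=> f x)).
  rewrite (bernsteinZ _ _ (fun k => f (k%:R / N))) bernstein_cst.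
  rewrite !hornerD hornerC hornerZ mulN1r.
  move=> h; suff : 0 <= (bernstein n b).[x] + (f x - (bernstein n (fun k => f (k%:R / N))).[x]) by lra.
  by apply: h => k /kb; rewrite ler_norml; lra.
- have := @bernstein_ge0 n (fun k => b k + (- f x + f (k%:R / N))) x x01.
  rewrite (bernsteinD _ b) (bernsteinD _ (fun=> - f x)) bernstein_cst.
  rewrite !hornerD hornerC.
  move=> h; suff : 0 <= (bernstein n b).[x] + (- f x + (bernstein n (fun k => f (k%:R / N))).[x]) by lra.
  by apply: h => k /kb; rewrite ler_norml; lra.
Qed.

End weierstrass.

(** * Real integrals of bounded functions *)

Section bounded_functions.
Context (R : realType) d (T : measurableType d) (P : probability T R).
Implicit Types (D : set T) (f g : T -> R) (M : R).

Lemma bounded_integrable D f M : measurable D -> measurable_fun D f ->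
  (forall x, D x -> `|f x| <= M) -> P.-integrable D (EFin \o f).
Proof.
move=> mD mf fM; apply: measurable_bounded_integrable => //.
  by rewrite (le_lt_trans (probability_le1 P _)) ?ltry.
exists M; split; first exact: num_real.
by move=> z Mz x Dx /=; rewrite (le_trans (fM x Dx))// ltW.
Qed.

Lemma EFin_Rintegral D f : measurable D -> P.-integrable D (EFin \o f) ->
  ((Rintegral P D f)%:E = \int[P]_(x in D) (f x)%:E)%E.
Proof. by move=> mD fi; rewrite fineK//; exact: integrable_fin_num. Qed.

Lemma integrableB_EFin D f g : measurable D ->
  P.-integrable D (EFin \o f) -> P.-integrable D (EFin \o g) ->
  P.-integrable D (EFin \o (fun x => f x - g x)).
Proof. by move=> mD fi gi; have := integrableB mD fi gi; apply: eq_integrable. Qed.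

Lemma integrableD_EFin D f g : measurable D ->
  P.-integrable D (EFin \o f) -> P.-integrable D (EFin \o g) ->
  P.-integrable D (EFin \o (fun x => f x + g x)).
Proof. by move=> mD fi gi; have := integrableD mD fi gi; apply: eq_integrable. Qed.

Lemma bounded_convergence D (f_ : nat -> T -> R) f M : measurable D ->
  (forall n, measurable_fun D (f_ n)) -> measurable_fun D f ->
  (forall n x, D x -> `|f_ n x| <= M) ->
  (forall x, D x -> f_ n x @[n --> \oo] --> f x) ->
  Rintegral P D (f_ n) @[n --> \oo] --> Rintegral P D f.
Proof.
move=> mD mf_ mf f_M f_f.
have fM x : D x -> `|f x| <= M.
  move=> Dx; have := f_f x Dx => /cvg_norm fx.
  by apply: (cvgr_to_le fx); apply: nearW => n; exact: f_M.
have mEf_ n : measurable_fun D (fun x => (f_ n x)%:E) by exact/measurable_EFinP.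
have mEf : measurable_fun D (fun x => (f x)%:E) by exact/measurable_EFinP.
have cf : {ae P, forall x, D x -> (f_ n x)%:E @[n --> \oo] --> (f x)%:E}.
  by apply: aeW => x Dx; apply: cvg_EFin; [exact: nearW|exact: f_f].
have bf : {ae P, forall x n, D x -> (`|(f_ n x)%:E| <= M%:E)%E}.
  by apply: aeW => x n Dx; rewrite lee_fin; exact: f_M.
have [_ _ h] := dominated_convergence mD mEf_ mEf cf
  (finite_measure_integrable_cst P M mD) bf.
by apply: fine_cvg; rewrite EFin_Rintegral//; exact: bounded_integrable fM.
Qed.

End bounded_functions.

(** * Continuity of the Laplace transform *)

Section laplace_continuity.
Context (R : realType).
Notation law := (probability (measurableTypeR R) R).
Implicit Types (p mu nu : law) (f g : R -> R) (l k x : R).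

Let D : set R := `[0%R, +oo[%classic.
Let J p f : R := Rintegral p D f.

Lemma Rintegral_nonneg_law p f M : p `]-oo, 0[%classic = 0%E ->
  measurable_fun setT f -> (forall x, `|f x| <= M) ->
  (\int[p]_x (f x)%:E = (\int[p]_(x in `[0%R, +oo[) (f x))%:E)%E.
Proof.
move=> p0 mf fM.
have fi : p.-integrable setT (EFin \o f) by exact: (@bounded_integrable _ _ _ _ _ _ M).
rewrite EFin_Rintegral//; last exact: integrableS fi.
rewrite (negligible_integral _ _ fi p0)//; congr (integral _ _ _).
apply/seteqP; split => x /=; rewrite !in_itv/= andbT.
  by move=> [_ /negP]; rewrite -leNgt.
by move=> x0; split => //; apply/negP; rewrite -leNgt.
Qed.

Let expD_le1 l x : 0 <= l -> D x -> `|expR (- (l * x))| <= 1.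
Proof.
rewrite /D/= in_itv/= andbT => l0 x0.
by rewrite ger0_norm ?expR_ge0// -[leRHS]expR0 ler_expR oppr_le0 mulr_ge0.
Qed.

Let mD : measurable (D : set (measurableTypeR R)). Proof. exact: measurable_itv. Qed.

Lemma laplaceE p l : p `]-oo, 0[%classic = 0%E -> 0 <= l ->
  laplace p l = (J p (fun x => expR (- (l * x))))%:E.
Proof.
move=> p0 l0.
have mE : measurable_fun setT (fun x : R => expR (- (l * x))).
  exact: measurable_expRN.
rewrite /laplace /J EFin_Rintegral//; last first.
  by apply: (@bounded_integrable _ _ _ _ _ _ 1) => //; [exact: measurable_funTS|by move=> x Dx; apply: expD_le1].
rewrite -[in LHS](setUv D) ge0_integral_setU//=; last 3 first.
- exact: measurableC.
- by rewrite setUv; apply/measurable_EFinP.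
- exact/disj_setPCl.
rewrite (_ : ~` D = `]-oo, 0[%classic); last first.
  by apply/seteqP; split => x; rewrite /D/= !in_itv/= andbT ltNge => /negP.
rewrite (null_set_integral _ _ p0) ?adde0//.
by apply/measurable_EFinP; exact: measurable_funTS.
Qed.

Lemma half_line_law p : p `]-oo, 0[%classic = 0%E -> p `[0%R, +oo[%classic = 1%E.
Proof.
move=> p0; rewrite -(probability_setT p) -(setUv D) measureU//; last 2 first.
- exact: measurableC.
- by rewrite setICr.
apply: etrans (esym (adde0 _)) _; congr (_ + _)%E; rewrite -p0; congr (p _).
by apply/seteqP; split => x; rewrite /D/= !in_itv/= andbT ltNge => /negP.
Qed.

Let J_cst p c : p `]-oo, 0[%classic = 0%E -> J p (fun=> c) = c.
Proof.
move=> p0; rewrite /J Rintegral_cst// -[RHS]mulr1; congr (_ * _).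
exact: (congr1 fine (half_line_law p0)).
Qed.

Lemma laplace_cvg1 p : p `]-oo, 0[%classic = 0%E ->
  J p (fun x => expR (- (n.+1%:R^-1 * x))) @[n --> \oo] --> (1 : R).
Proof.
move=> p0; rewrite -[X in _ --> X](J_cst 1 p0).
apply: (@bounded_convergence _ _ _ _ _ _ _ 1) => //.
- by move=> n; apply: measurable_funTS; exact: measurable_expRN.
- by move=> n x; apply: expD_le1.
- move=> x _; rewrite -[X in _ --> X]expR0; apply: continuous_cvg; first exact: continuous_expR.
  rewrite -[X in _ --> X]oppr0; apply: cvgN; rewrite -[X in _ --> X](mul0r x).
  by apply: cvgMl; exact: cvg_harmonic.
Qed.

Let integrable_poly_exp p (q : {poly R}) k l : 0 <= k -> 0 <= l ->
  p.-integrable D (EFin \o (fun x => q.[expR (- (k * x))] * expR (- (l * x)))).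
Proof.
move=> k0 l0.
have mq (q' : {poly R}) : measurable_fun setT (fun x : R => q'.[expR (- (k * x))]).
  apply: (measurableT_comp (f := fun y : R => q'.[y])); last exact: measurable_expRN.
  by apply: continuous_measurable_fun; exact: continuous_horner.
have [M qM] : exists M, forall x, D x -> `|q.[expR (- (k * x))]| <= M.
  elim/poly_ind: q => [|q c [M qM]].
    by exists 0 => x _; rewrite horner0 normr0.
  exists (M + `|c|) => x Dx; rewrite hornerMXaddC (le_trans (ler_normD _ _))//.
  rewrite lerD2r normrM -[leRHS]mulr1 ler_pM//; first exact: qM.
  exact: expD_le1.
apply: (@bounded_integrable _ _ _ _ _ _ M) => //.
- apply: measurable_funTS; apply: measurable_funM; first exact: mq.
  exact: measurable_expRN.
- move=> x Dx; rewrite normrM -[leRHS]mulr1 ler_pM//; first exact: qM.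
  exact: expD_le1.
Qed.

(** The extra factor [expR (- (l * x))] carries the induction: multiplying the polynomial by ['X]
    amounts to raising [l] by [k]. *)
Let poly_exp_cvg (mus : nat -> law) mu (q : {poly R}) k l : 0 <= k -> 0 <= l ->
  (forall l, 0 <= l -> J (mus n) (fun x => expR (- (l * x))) @[n --> \oo] -->
     J mu (fun x => expR (- (l * x)))) ->
  J (mus n) (fun x => q.[expR (- (k * x))] * expR (- (l * x))) @[n --> \oo] -->
  J mu (fun x => q.[expR (- (k * x))] * expR (- (l * x))).
Proof.
move=> k0 + L; elim/poly_ind: q l => [|q c IHq] l l0.
  have E p : J p (fun x => (0 : {poly R}).[expR (- (k * x))] * expR (- (l * x))) = 0.
    rewrite /J; under eq_Rintegral do rewrite horner0 mul0r.
    by rewrite Rintegral_cst// mul0r.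
  by rewrite E; under eq_fun do rewrite E; exact: cvg_cst.
have E p : J p (fun x => (q * 'X + c%:P).[expR (- (k * x))] * expR (- (l * x))) =
    J p (fun x => q.[expR (- (k * x))] * expR (- ((l + k) * x))) +
    c * J p (fun x => expR (- (l * x))).
  rewrite /J -RintegralZl//; last first.
    apply: (@bounded_integrable _ _ _ _ _ _ 1) => //; last by move=> x; exact: expD_le1.
    by apply: measurable_funTS; exact: measurable_expRN.
  rewrite -RintegralD//.
  - apply: eq_Rintegral => x _; rewrite hornerMXaddC mulrDl -mulrA -expRD.
    by congr (_ * expR _ + _); ring.
  - by apply: integrable_poly_exp; rewrite ?addr_ge0.
  - have := integrable_poly_exp p (c%:P) k0 l0.
    by under eq_fun do rewrite hornerC.
rewrite E; under eq_fun do rewrite E.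
by apply: cvgD; [apply: IHq; rewrite addr_ge0|apply: cvgMr; exact: L].
Qed.

(** This is exp(- k x) f(x) read in the variable y = exp(- k x). The function [f] has no limit at
    infinity in general; the factor [y] together with boundedness restores continuity at 0. *)
Lemma continuous_exp_rescaling f k M : 0 < k -> continuous f ->
  (forall x, `|f x| <= M) ->
  continuous (fun y : R => if 0 < y then y * f (- (ln y / k)) else 0 : R).
Proof.
move=> k0 cf fM y; have M0 : 0 <= M := le_trans (normr_ge0 _) (fM 0).
have [y0|y0|y0] := ltrgtP y 0.
- rewrite /continuous_at ltNge (ltW y0)/=; apply/cvgrPdist_le => e e0; near=> z.
  have z0 : z < 0 by near: z; exact: lt_nbhsl.
  by rewrite ltNge (ltW z0)/= subrr normr0 ltW.
- rewrite /continuous_at y0.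
  have c : (fun y : R => y * f (- (ln y / k))) z @[z --> (y : R)] --> y * f (- (ln y / k)).
    apply: cvgM; first exact: cvg_id.
    apply: (continuous_comp (f := fun y : R => - (ln y / k))); last exact: cf.
    apply: cvgN; apply: cvgMl; exact: continuous_ln.
  apply: cvg_trans c; apply: near_eq_cvg; near=> z.
  by rewrite ifT//; near: z; exact: lt_nbhsr.
- rewrite y0 /continuous_at ltxx; apply/cvgrPdist_le => e e0.
  have M1 : 0 < M + 1 by rewrite ltr_wpDl.
  exists (e / (M + 1)); first by rewrite /= divr_gt0.
  move=> z /=; rewrite !sub0r !normrN ltr_pdivlMr// => ze.
  case: ifPn => [z0|]; last by rewrite normr0 ltW.
  rewrite normrM (le_trans _ (ltW ze))//.
  by rewrite ler_wpM2l// (le_trans (fM _))// lerDl.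
Unshelve. all: end_near. Qed.

(** For small [k] the limit law gives little weight to 1 - exp(- k x), and by convergence of the
    transform at [k] so do the laws of the sequence; this serves as tightness. What remains is exp(-
    k x) f(x), a continuous function of y = exp(- k x) in [0, 1], uniformly close to a polynomial in
    y, whose integrals converge. *)
Theorem laplace_continuity (mus : nat -> law) mu :
  (forall n, mus n `]-oo, 0[%classic = 0%E) -> mu `]-oo, 0[%classic = 0%E ->
  (forall l, 0 <= l -> laplace (mus n) l @[n --> \oo] --> laplace mu l) ->
  weakly_converges mus mu.
Proof.
move=> mus0 mu0 Lcvg f cf [M0 fM0].
pose M := M0 + 1.
have fM x : `|f x| <= M by rewrite (le_trans (fM0 x))// lerDl.
have M_gt0 : 0 < M by rewrite ltr_wpDl// (le_trans _ (fM0 0)).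
have mf : measurable_fun setT f by exact: continuous_measurable_fun.
have L l : 0 <= l -> J (mus n) (fun x => expR (- (l * x))) @[n --> \oo] -->
     J mu (fun x => expR (- (l * x))).
  move=> l0; have := Lcvg l l0; rewrite laplaceE//.
  under eq_fun do rewrite laplaceE//.
  by move/fine_cvg.
suff : J (mus n) f @[n --> \oo] --> J mu f.
  rewrite (Rintegral_nonneg_law mu0 mf fM).
  have -> : (fun n => \int[mus n]_x (f x)%:E)%E = (fun n => (J (mus n) f)%:E).
    by apply/funext => n; exact: Rintegral_nonneg_law (mus0 n) mf fM.
  by move=> h; apply: cvg_EFin => //; exact: nearW.
apply/cvgrPdist_le => e e0.
(* The errors add up to at most 3 e' + 3 M e': (1 + M) e' for the limit law, (1 + 2 M) e' for the
   law number [n], whose transform at [k] is only known up to a further e', and e' between the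
   polynomial integrals. *)
pose e' := e / (4 * M + 4).
have d0 : 0 < 4 * M + 4 by rewrite addr_gt0// mulr_gt0.
have e'0 : 0 < e' by rewrite divr_gt0.
have [k k0 Lk] : exists2 k, 0 < k & 1 - e' <= J mu (fun x => expR (- (k * x))).
  have /cvgrPdist_le/(_ _ e'0)[n _ /(_ n (leqnn n))] := laplace_cvg1 mu0.
  rewrite /= => h; exists n.+1%:R^-1; first by rewrite invr_gt0.
  by move: h; rewrite ler_norml; lra.
pose h (y : R) : R := if 0 < y then y * f (- (ln y / k)) else 0.
have ch : continuous h by exact: continuous_exp_rescaling fM.
have hE x : h (expR (- (k * x))) = expR (- (k * x)) * f x.
  rewrite /h expR_gt0 expRK; congr (_ * f _).
  by rewrite mulNr opprK mulrC mulKf// gt_eqF.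
have [q qh] := weierstrass ch e'0.
have mexp : measurable_fun D (fun x : R => expR (- (k * x))).
  by apply: measurable_funTS; exact: measurable_expRN.
have mq : measurable_fun D (fun x : R => q.[expR (- (k * x))]).
  apply: measurable_funTS.
  apply: (measurableT_comp (f := fun y : R => q.[y])); last exact: measurable_expRN.
  by apply: continuous_measurable_fun; exact: continuous_horner.
have iexp p : p.-integrable D (EFin \o (fun x => expR (- (k * x)))).
  by apply: (@bounded_integrable _ _ _ _ _ _ 1) => // x; exact/expD_le1/ltW.
have iq p : p.-integrable D (EFin \o (fun x => q.[expR (- (k * x))])).
  have := integrable_poly_exp p q (ltW k0) (lexx 0).
  by under eq_fun do rewrite mul0r oppr0 expR0 mulr1.
have i_f p : p.-integrable D (EFin \o f).
  by apply: (@bounded_integrable _ _ _ _ _ _ M) => //; exact: measurable_funTS.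
(* Replacing f by exp(- k x) f costs at most [M] times the integral of 1 - exp(- k x), and then the
   polynomial costs e'. The bound is uniform in the law, so it serves for the limit and for the
   sequence. *)
have bound p : p `]-oo, 0[%classic = 0%E ->
    `|J p f - J p (fun x => q.[expR (- (k * x))])| <=
    e' + M * (1 - J p (fun x => expR (- (k * x)))).
  move=> p0.
  have ic c : p.-integrable D (EFin \o (fun=> c)).
    exact: finite_measure_integrable_cst.
  have iMe : p.-integrable D (EFin \o (fun x => M * (1 - expR (- (k * x))))).
    apply: (@bounded_integrable _ _ _ _ _ _ M) => //.
      by apply: measurable_funM => //; exact: measurable_funB.
    move=> x Dx; have := expD_le1 (ltW k0) Dx; have := expR_ge0 (- (k * x)).
    move=> e_0; rewrite ger0_norm// => e_1.
    rewrite normrM (ger0_norm (ltW M_gt0)) ger0_norm ?subr_ge0//.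
    by rewrite ler_piMr ?(ltW M_gt0)// lerBlDr lerDl.
  rewrite /J -RintegralB; [|exact: mD|exact: i_f|exact: iq].
  apply: le_trans.
    apply: le_normr_Rintegral => //; exact: (integrableB_EFin mD (i_f p) (iq p)).
  have <- : J p (fun x => e' + M * (1 - expR (- (k * x)))) =
      e' + M * (1 - J p (fun x => expR (- (k * x)))).
    rewrite /J RintegralD; [|exact: mD|exact: ic|exact: iMe].
    rewrite RintegralZl; [|exact: mD|exact: (integrableB_EFin mD (ic 1) (iexp p))].
    rewrite RintegralB; [|exact: mD|exact: ic|exact: iexp].
    by rewrite -/(J p (fun=> e')) -/(J p (fun=> 1)) !J_cst.
  apply: le_Rintegral => //.
  - exact: (integrable_norm (integrableB_EFin mD (i_f p) (iq p))).
  - exact: (integrableD_EFin mD (ic e') iMe).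
  - move=> x Dx; have e1 := expD_le1 (ltW k0) Dx.
    have e_0 := expR_ge0 (- (k * x)); rewrite ger0_norm// in e1.
    have := qh (expR (- (k * x))); rewrite in_itv/= e_0 e1 => /(_ isT).
    rewrite hE => hq.
    have -> : f x - q.[expR (- (k * x))] =
      (expR (- (k * x)) * f x - q.[expR (- (k * x))]) +
      f x * (1 - expR (- (k * x))) by ring.
    rewrite (le_trans (ler_normD _ _))// lerD// normrM.
    by rewrite (ger0_norm (_ : 0 <= 1 - _)) ?subr_ge0// ler_wpM2r// subr_ge0.
have Lkn := L k (ltW k0).
have Qcvg : J (mus n) (fun x => q.[expR (- (k * x))]) @[n --> \oo] -->
    J mu (fun x => q.[expR (- (k * x))]).
  have E p : J p (fun x => q.[expR (- (k * x))]) =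
      J p (fun x => q.[expR (- (k * x))] * expR (- (0 * x))).
    by apply: eq_Rintegral => x _; rewrite mul0r oppr0 expR0 mulr1.
  rewrite E; under eq_fun do rewrite E.
  exact: poly_exp_cvg (ltW k0) (lexx 0) L.
near=> n.
have h1 := bound _ (mus0 n); have h2 := bound _ mu0.
have h3 : `|J mu (fun x => expR (- (k * x))) -
    J (mus n) (fun x => expR (- (k * x)))| <= e'.
  by near: n; apply: (proj1 (cvgrPdist_le _ _) Lkn).
have h4 : `|J mu (fun x => q.[expR (- (k * x))]) -
    J (mus n) (fun x => q.[expR (- (k * x))])| <= e'.
  by near: n; apply: (proj1 (cvgrPdist_le _ _) Qcvg).
have eE : e = e' * (4 * M + 4) by rewrite /e' divfK// gt_eqF.
move: h1 h2 h3 h4 Lk.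
set a := J mu f; set b := J (mus n) f.
set u := J mu _; set v := J (mus n) _; set r := J mu _; set s := J (mus n) _.
rewrite !ler_norml => /andP[h1 h1'] /andP[h2 h2'] /andP[h3 h3'] /andP[h4 h4'] h5.
rewrite eE; apply/andP; split; nra.
Unshelve. all: end_near. Qed.

End laplace_continuity.

(** * Uniqueness of Laplace transforms and limits of decreasing distribution functions *)

Section laplace_limits.
Context (R : realType).
Notation law := (probability (measurableTypeR R) R).
Notation leb := (@lebesgue_measure R).
Implicit Types (p q mu nu : law) (l r t x : R).

(** For [n > 0], equal to 1 up to [r] and to 0 from [r + 1/n] on: continuous bounded functions that
    converge pointwise to the indicator of []-oo, r]]. *)
Let ramp (n : nat) r x : R := Num.max 0 (Num.min 1 (1 - n%:R * (x - r))).

Let ramp_continuous n r : continuous (ramp n r).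
Proof.
move=> x; apply: (@continuous_max R R (cst 0) (fun x => Num.min 1 (1 - n%:R * (x - r)))).
  exact: cst_continuous.
apply: (@continuous_min R R (cst 1) (fun x => 1 - n%:R * (x - r))).
  exact: cst_continuous.
apply: cvgB; first exact: cvg_cst.
by apply: cvgMr; apply: cvgB; [exact: cvg_id|exact: cvg_cst].
Qed.

Let ramp_ge0 n r x : 0 <= ramp n r x.
Proof. by rewrite /ramp le_max lexx. Qed.

Let ramp_le1 n r x : ramp n r x <= 1.
Proof. by rewrite /ramp ge_max ler01 ge_min lexx. Qed.

Let ramp_cvg r x : ramp n r x @[n --> \oo] --> (\1_(`]-oo, r]%classic) x : R).
Proof.
rewrite indicE; case: (boolP (x \in _)) => xr.
  move: xr; rewrite inE/= in_itv/= => xr.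
  suff -> : (fun n => ramp n r x) = (fun=> 1) by exact: cvg_cst.
  apply/funext => n; rewrite /ramp min_l; first by rewrite max_r.
  by rewrite lerDl oppr_ge0 mulr_ge0_le0// subr_le0.
move: xr; rewrite notin_setE/= in_itv/= => /negP; rewrite -ltNge -subr_gt0 => rx.
apply/cvgrPdist_le => e e0; exists (Num.truncn (x - r)^-1).+1 => // n /= nr.
rewrite /ramp max_l ?subrr ?normr0 ?(ltW e0)// ge_min; apply/orP; right.
rewrite subr_le0 -ler_pdivrMr// mul1r (le_trans (ltW (truncnS_gt _)))//.
by rewrite ler_nat.
Qed.

(** By the continuity theorem the constant sequence [mu] converges weakly to [nu], so both laws
    integrate the continuous ramps equally; the limit of the ramps gives equal distribution
    functions. *)
Theorem laplace_unique mu nu :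
  mu `]-oo, 0[%classic = 0%E -> nu `]-oo, 0[%classic = 0%E ->
  (forall l, 0 <= l -> laplace mu l = laplace nu l) ->
  forall A, measurable A -> mu A = nu A.
Proof.
move=> mu0 nu0 mn; apply: law_eq_cdf => r.
have W : weakly_converges (fun=> mu) nu.
  by apply: laplace_continuity => // l l0; rewrite mn//; exact: cvg_cst.
have mramp n : measurable_fun setT (ramp n r).
  by apply: continuous_measurable_fun; exact: ramp_continuous.
have E n : Rintegral mu setT (ramp n r) = Rintegral nu setT (ramp n r).
  rewrite /Rintegral; congr fine.
  have := W _ (@ramp_continuous n r).
  have bd : exists M, forall x, `|ramp n r x| <= M.
    by exists 1 => x; rewrite ger0_norm.
  by move=> /(_ bd) /cvg_lim <-//; rewrite lim_cst.
have C p : Rintegral p setT (ramp n r) @[n --> \oo] -->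
    Rintegral p setT (\1_(`]-oo, r]%classic) : R -> R).
  apply: (@bounded_convergence _ _ _ _ _ _ _ 1) => //.
  - by move=> n x _; rewrite ger0_norm.
have := C mu; under eq_fun do rewrite E.
have I p : Rintegral p setT (\1_(`]-oo, r]%classic) : R -> R) =
    fine (p `]-oo, r]%classic).
  by rewrite /Rintegral integral_indicT.
move=> /cvg_unique/(_ (C nu)); rewrite !I => fE.
have := congr1 EFin (fE (@norm_hausdorff _ _)).
by rewrite !fineK// fin_num_measure.
Qed.

Let cdfR p r := fine (p `]-oo, r]%classic).

Let cdfR_nd p : nondecreasing (cdfR p).
Proof.
move=> x y xy; rewrite /cdfR fine_le ?fin_num_measure//.
by rewrite le_measure ?inE//; exact: subitvPr.
Qed.

Let mcdfR p : measurable_fun [set: measurableTypeR R] (cdfR p).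
Proof. by apply: nondecreasing_measurable => //; exact: cdfR_nd. Qed.

Let cdfRE p r : p `]-oo, r]%classic = (cdfR p r)%:E.
Proof. by rewrite fineK// fin_num_measure. Qed.

Let cdfR_rc p : right_continuous (cdfR p).
Proof.
move=> a; apply: fine_cvg; rewrite -cdfRE.
have mid : measurable_fun [set: measurableTypeR R] (fun x => x : R).
  exact: measurable_id.
pose X : {mfun measurableTypeR R >-> R} := mk_mfun mid.
exact: (@cdf_right_continuous _ _ _ p X a).
Qed.

(** On the half-line exp(- l x) is at most 1 up to [r] and at most exp(- l r) beyond. Read
    backwards, a transform close to 1 forces the mass below [r] to be large. *)
Lemma laplace_cdf_le p l r : p `]-oo, 0[%classic = 0%E -> 0 <= l -> 0 <= r ->
  (laplace p l <= ((1 - expR (- (l * r))) * cdfR p r + expR (- (l * r)))%:E)%E.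
Proof.
move=> p0 l0 r0; set c := expR (- (l * r)).
have c1 : c <= 1 by rewrite -expR0 ler_expR oppr_le0 mulr_ge0.
have c0 : 0 <= c by exact: expR_ge0.
pose D : set (measurableTypeR R) := `[0%R, +oo[%classic.
pose A : set (measurableTypeR R) := `]-oo, r]%classic.
have mD : measurable D by exact: measurable_itv.
have mA : measurable A by exact: measurable_itv.
rewrite laplaceE// lee_fin.
have i1 : p.-integrable D (EFin \o (\1_A : measurableTypeR R -> R)).
  apply: (@bounded_integrable _ _ _ _ _ _ 1) => //.
  by move=> x _; rewrite indicE; case: (_ \in _); rewrite ?normr1 ?normr0.
have iZ : p.-integrable D (EFin \o (fun x => (1 - c) * \1_A x)).
  apply: (@bounded_integrable _ _ _ _ _ _ (1 - c)) => //.
    by apply: measurable_funM => //; exact: measurable_funTS.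
  move=> x _; rewrite normrM ger0_norm ?subr_ge0// ler_piMr ?subr_ge0//.
  by rewrite indicE; case: (_ \in _); rewrite ?normr1 ?normr0.
have ic : p.-integrable D (EFin \o (fun=> c)).
  exact: finite_measure_integrable_cst.
have pD : p D = 1%E by exact: half_line_law.
apply: (@le_trans _ _ (Rintegral p D (fun x => (1 - c) * \1_A x + c))).
  apply: le_Rintegral => //.
  - apply: (@bounded_integrable _ _ _ _ _ _ 1) => //.
      by apply: measurable_funTS; exact: measurable_expRN.
    move=> x; rewrite /D/= in_itv/= andbT => x0.
    by rewrite ger0_norm ?expR_ge0// -[leRHS]expR0 ler_expR oppr_le0 mulr_ge0.
  - exact: integrableD_EFin.
  - move=> x; rewrite /D/= in_itv/= andbT => x0; rewrite indicE.
    case: (boolP (x \in A)) => /= xA.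
      rewrite mulr1 subrK -[leRHS]expR0 ler_expR oppr_le0 mulr_ge0//.
    move: xA; rewrite notin_setE /A/= in_itv/= => /negP; rewrite -ltNge => rx.
    by rewrite mulr0 add0r ler_expR lerN2 ler_wpM2l// ltW.
rewrite RintegralD; [|exact: mD|exact: iZ|exact: ic].
rewrite RintegralZl; [|exact: mD|exact: i1].
rewrite Rintegral_cst; last exact: mD.
have pD' : fine (p D) = 1 by exact: (congr1 fine pD).
apply: lerD; last by rewrite -[leRHS]mulr1 -[X in _ <= _ * X]pD'; exact: lexx.
rewrite ler_wpM2l ?subr_ge0// /Rintegral integral_indic; [|exact: mD|exact: mA].
have mAD : measurable (A `&` D) by exact: measurableI.
rewrite /cdfR fine_le ?fin_num_measure//.
by apply: le_measure; rewrite ?inE//; exact: subIsetl.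
Qed.

Lemma exponential_law_exists l : 0 < l -> exists q : law, forall x,
  q `[x, +oo[%classic = (expR (- (l * Num.max 0 x)))%:E.
Proof.
move=> l0.
have [q qE] := density_prob_exists (measurable_exponential_pdf l)
  (exponential_pdf_ge0 (ltW l0)) (integral_exponential_pdf l0).
exists q => x.
have m1 a b : measurable ([set` Interval a b] : set (measurableTypeR R)).
  exact: measurable_itv.
have qneg : q `]-oo, 0[%classic = 0%E.
  rewrite qE//; apply: integral0_eq => y /=; rewrite in_itv/= => y0.
  by rewrite lt0_exponential_pdf.
have qC : q `[x, +oo[%classic = (1 - q `]-oo, x[%classic)%E.
  rewrite -probability_setC//; congr (q _); apply/seteqP.
  by split => y /=; rewrite !in_itv/= andbT leNgt => /negP.
have [x0|x0] := leP x 0.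
  rewrite qC mulr0 oppr0 expR0 (_ : q _ = 0%E) ?sube0//.
  apply/eqP; rewrite eq_le measure_ge0 andbT -qneg le_measure ?inE//.
  by apply: subset_itvl; rewrite bnd_simp.
rewrite qC.
have -> : q `]-oo, x[%classic = (1 - (expR (- (l * x)))%:E)%E.
  rewrite -mulNr -exponential_prob_itv0c//.
  have -> : `]-oo, x[%classic = `]-oo, 0[%classic `|` `[0, x[%classic :> set (measurableTypeR R).
    apply/seteqP; split => y /=; rewrite !in_itv/=.
      by have [y0|y0] := ltP y 0; [left|right].
    by move=> [y0|/andP[]//]; exact: lt_trans x0.
  rewrite measureU//; last first.
    apply/seteqP; split => y //= []; rewrite !in_itv/= => y0 /andP[y1 _].
    by move: y0; rewrite ltNge y1.
  apply: etrans (congr1 (fun z => (z + q `[0%R, x[%classic)%E) qneg) _.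
  rewrite add0e qE// /exponential_prob integral_itv_bndo_bndc//.
  by apply/measurable_EFinP; apply: measurable_funTS; exact: measurable_exponential_pdf.
by rewrite -!EFinB opprB addrCA subrr addr0.
Qed.

(* The law q is the exponential one of rate l: integrate by parts. *)
Lemma laplace_cdf l : 0 < l -> exists q : law, forall p,
  p `]-oo, 0[%classic = 0%E -> laplace p l = (Rintegral q setT (cdfR p))%:E.
Proof.
move=> l0; have [q qE] := exponential_law_exists l0; exists q => p p0.
have icdf : q.-integrable setT (EFin \o cdfR p).
  apply: (@bounded_integrable _ _ _ _ _ _ 1) => // x _.
  by rewrite /cdfR ger0_norm ?fine_ge0// -lee_fin fineK ?fin_num_measure// probability_le1.
rewrite EFin_Rintegral//.
pose B : set (measurableTypeR R * measurableTypeR R) := [set z | z.1 <= z.2].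
have mB : measurable B.
  have -> : B = (fun z => z.2 - z.1) @^-1` `[0%R, +oo[%classic.
    by apply/seteqP; split => z; rewrite /B/= in_itv/= andbT subr_ge0.
  rewrite -[X in measurable X]setTI.
  by apply: (measurable_funB measurable_snd measurable_fst) => //; exact: measurable_itv.
pose f (z : measurableTypeR R * measurableTypeR R) : \bar R := (\1_B z)%:E.
have mf : measurable_fun setT f by apply/measurable_EFinP.
have f0 z : (0 <= f z)%E by rewrite lee_fin.
have := @fubini_tonelli _ _ _ _ _ p q f mf f0.
have -> : (\int[p]_x \int[q]_y f (x, y) = laplace p l)%E.
  transitivity (\int[p]_x (expR (- (l * Num.max 0 x)))%:E)%E.
    apply: eq_integral => x _; rewrite -qE.
    rewrite -(integral_indicT q (measurable_itv `[x, +oo[)).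
    apply: eq_integral => y _; rewrite /f !indicE; congr ((nat_of_bool _)%:R)%:E.
    by apply/idP/idP; rewrite !inE /B/= in_itv/= andbT.
  rewrite laplaceE ?ltW//.
  have mm : measurable_fun setT (fun x : R => expR (- (l * Num.max 0 x))).
    apply: (measurableT_comp (measurable_expRN l)).
    exact: measurable_maxr.
  rewrite (@Rintegral_nonneg_law _ _ _ 1)//.
    congr EFin; apply: eq_Rintegral => x; rewrite inE/= in_itv/= andbT => x0.
    by rewrite max_r.
  move=> x; rewrite ger0_norm ?expR_ge0// -[leRHS]expR0 ler_expR oppr_le0.
  by rewrite mulr_ge0 ?(ltW l0)// le_max lexx.
move=> ->; apply: eq_integral => y _.
rewrite -cdfRE -(integral_indicT p (measurable_itv `]-oo, y])).
by apply: eq_integral => x _; rewrite /f !indicE; congr ((nat_of_bool _)%:R)%:E.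
Qed.

Lemma laplace0 p : laplace p 0 = 1%E.
Proof.
rewrite /laplace; under eq_integral do rewrite mul0r oppr0 expR0.
rewrite integral_cst//; exact: etrans (mul1e _) (probability_setT p).
Qed.

(** Monotonicity in [n] makes the distribution functions converge at every point, without extracting
    subsequences. The hypothesis on [phi] near 0 prevents mass from escaping to infinity, and
    [laplace_cdf] expresses the transform as a bounded integral of the distribution function, which
    passes to the limit. *)
Theorem laplace_limit_law (mus : nat -> law) (phi : R -> R) :
  (forall n, mus n `]-oo, 0[%classic = 0%E) ->
  (forall n r, mus n.+1 `]-oo, r]%classic <= mus n `]-oo, r]%classic)%E ->
  (forall l, 0 <= l -> laplace (mus n) l @[n --> \oo] --> (phi l)%:E) ->
  phi (n.+1%:R^-1) @[n --> \oo] --> (1 : R) ->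
  exists mu : law, mu `]-oo, 0[%classic = 0%E /\
    forall l, 0 <= l -> laplace mu l = (phi l)%:E.
Proof.
move=> mus0 mus_dec Lphi phi1.
pose F r : R := limn (fun n => cdfR (mus n) r).
have cdf01 p r : 0 <= cdfR p r <= 1.
  rewrite /cdfR fine_ge0//= -lee_fin fineK ?fin_num_measure//.
  by rewrite probability_le1.
have Fdec r : nonincreasing_seq (fun n => cdfR (mus n) r).
  by apply/nonincreasing_seqP => n; rewrite /cdfR fine_le ?fin_num_measure.
have Fcvg r : cdfR (mus n) r @[n --> \oo] --> F r.
  apply: nonincreasing_is_cvgn => //.
  by exists 0 => _ [n _ <-]; have /andP[] := cdf01 (mus n) r.
have Fle n r : F r <= cdfR (mus n) r.
  by apply: nonincreasing_cvgn_ge => //; apply/cvg_ex; exists (F r).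
have F0 r : 0 <= F r.
  by apply: (cvgr_to_ge (Fcvg r)); apply: nearW => n; have /andP[] := cdf01 (mus n) r.
have F1 r : F r <= 1.
  by apply: (cvgr_to_le (Fcvg r)); apply: nearW => n; have /andP[] := cdf01 (mus n) r.
have Fnd : nondecreasing F.
  move=> x y xy; apply: (ler_cvg_to (Fcvg x) (Fcvg y)); apply: nearW => n.
  exact: cdfR_nd.
have Fneg r : r < 0 -> F r = 0.
  move=> r0; apply/eqP; rewrite eq_le F0 andbT (le_trans (Fle 0%N r))//.
  rewrite -lee_fin -cdfRE.
  apply: (@le_trans _ _ (mus 0%N `]-oo, 0[%classic)); last by rewrite mus0.
  apply: le_measure; rewrite ?inE; [exact: measurable_itv|exact: measurable_itv|].
  by apply: subset_itvl; rewrite bnd_simp.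
(* [F] is an infimum of nondecreasing right-continuous functions: to the right of [a] it lies
   between [F a] and one function of the sequence that is already close to [F a] at [a]. *)
have Frc : right_continuous F.
  move=> a; apply/cvgrPdist_le => e e0.
  have e2 : 0 < e / 2 by rewrite divr_gt0.
  have /cvgrPdist_le/(_ _ e2)[n _ /(_ n (leqnn n))/= nP] := Fcvg a.
  have /cvgrPdist_le/(_ _ e2) cP := @cdfR_rc (mus n) a.
  near=> y.
  have ay : a <= y by apply: ltW; near: y; exact: nbhs_right_gt.
  have h1 : `|cdfR (mus n) a - cdfR (mus n) y| <= e / 2 by near: y.
  have h2 := Fle n y; have h3 := Fnd _ _ ay.
  move: nP h1; rewrite !ler_norml => /andP[n1 n2] /andP[h4 h5].
  by apply/andP; split; lra.
have FNy : F @ -oo --> (0 : R).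
  apply/cvgrPdist_le => e e0; near=> r.
  rewrite Fneg ?subrr ?normr0 ?(ltW e0)//.
(* The value of exp(- l r) for the pairing r = n + 1, l = 1 / (n + 1) used in the tail estimate. *)
pose c : R := expR (-1).
have c1 : c < 1 by rewrite -expR0 ltr_expR ltrN10.
have tail n : 1 - F n.+1%:R <= (1 - c)^-1 * (1 - phi (n.+1%:R^-1)).
  have n0 : (0 : R) < n.+1%:R by rewrite ltr0n.
  have l0 : (0 : R) <= n.+1%:R^-1 by rewrite invr_ge0 ltW.
  have := Lphi _ l0 => /fine_cvg Lf.
  have h : phi (n.+1%:R^-1) <= (1 - c) * F n.+1%:R + c.
    apply: (ler_cvg_to Lf).
      apply: cvgD; last exact: cvg_cst.
      apply: cvgMr; exact: (Fcvg n.+1%:R).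
    apply: nearW => m /=.
    have := laplace_cdf_le (mus0 m) l0 (ltW n0).
    rewrite mulVf ?gt_eqF// -/c laplaceE//.
  rewrite mulrC ler_pdivlMr ?subr_gt0//; lra.
have Fy : F @ +oo --> (1 : R).
  apply/cvgrPdist_le => e e0.
  have ec : 0 < e * (1 - c) by rewrite mulr_gt0// subr_gt0.
  have /cvgrPdist_le/(_ _ ec)[n _ /(_ n (leqnn n))/= nP] := phi1.
  near=> r.
  have nr : n.+1%:R <= r by near: r; apply: nbhs_pinfty_ge; exact: num_real.
  have h1 := Fnd _ _ nr; have h2 := F1 r; have h3 := tail n.
  have h4 : (1 - c)^-1 * (1 - phi (n.+1%:R^-1)) <= e.
    rewrite mulrC ler_pdivrMr ?subr_gt0//.
    by move: nP; rewrite ler_norml => /andP[].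
  by rewrite ler_norml; apply/andP; split; lra.
have [mu muE] := cdf_law_exists Fnd Frc FNy Fy.
have cdfmu r : cdfR mu r = F r by rewrite /cdfR muE.
have mu0 : mu `]-oo, 0[%classic = 0%E.
  have -> : `]-oo, 0[%classic = \bigcup_n `]-oo, - (n.+1%:R^-1)]%classic :> set (measurableTypeR R).
    apply/seteqP; split => x /=; rewrite in_itv/=.
      move=> x0; exists (Num.truncn (- x)^-1) => //=; rewrite in_itv/=.
      rewrite lerNr -[leRHS]invrK lef_pV2 ?posrE ?invr_gt0 ?oppr_gt0//.
      exact/ltW/truncnS_gt.
    move=> [n _] /=; rewrite in_itv/= => /le_lt_trans; apply.
    by rewrite oppr_lt0 invr_gt0.
  apply: measure_negligible; first by apply: bigcup_measurable => n _; exact: measurable_itv.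
  apply: negligible_bigcup => n; apply/negligibleP; first exact: measurable_itv.
  by apply: etrans (muE (- n.+1%:R^-1)) _; rewrite Fneg// oppr_lt0 invr_gt0.
exists mu; split => // l; rewrite le_eqVlt => /predU1P[<-|l0].
  rewrite laplace0; have := Lphi 0 (lexx 0); under eq_fun do rewrite laplace0.
  by move=> /cvg_lim <-//; rewrite lim_cst.
have [q qE] := laplace_cdf l0; rewrite qE//.
have := Lphi l (ltW l0); under eq_fun do rewrite qE//.
move=> /fine_cvg; under eq_fun do rewrite /=.
have B : Rintegral q setT (cdfR (mus n)) @[n --> \oo] --> Rintegral q setT (cdfR mu).
  apply: (@bounded_convergence _ _ _ _ _ _ _ 1) => //.
  - by move=> n x _; have /andP[a b] := cdf01 (mus n) x; rewrite ger0_norm.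
  - by move=> x _; rewrite cdfmu; exact: Fcvg.
by move=> /cvg_unique/(_ B) <-.
Unshelve. all: end_near.
Qed.

End laplace_limits.

(** * Euler's product for sinh *)

Section sinh_product.
Context (R : realType).
Implicit Types (x y z t : R) (m n k : nat).

Definition sinh x : R := (expR x - expR (- x)) / 2.

Lemma sinh0 : sinh 0 = 0. Proof. by rewrite /sinh oppr0 subrr mul0r. Qed.

(** Both sides come from [1 + t <= expR t] alone, used at [t] and at [- 2 t]. They pin down M sinh(x
    / M) as M grows. *)
Lemma sinh_bounds t : 0 <= t -> t / (1 + t) <= sinh t <= t * expR t.
Proof.
move=> t0; have t1 : 0 < 1 + t by rewrite ltr_pwDl.
have E : expR (- t) <= (1 + t)^-1.
  by rewrite expRN lef_pV2 ?posrE ?expR_gt0// expR_ge1Dx.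
apply/andP; split.
  rewrite /sinh ler_pdivlMr//; have := expR_ge1Dx t => h.
  apply: (@le_trans _ _ (1 + t - (1 + t)^-1)); last lra.
  rewrite -(ler_pM2r t1) mulrBl mulVf ?gt_eqF// mulrAC divfK ?gt_eqF//; nra.
have h : expR t * (1 - 2 * t) <= expR (- t).
  have -> : expR (- t) = expR t * expR (- (2 * t)) by rewrite -expRD; congr expR; ring.
  by rewrite ler_wpM2l ?expR_ge0//; have := expR_ge1Dx (- (2 * t)); lra.
rewrite /sinh ler_pdivrMr//; lra.
Qed.

Lemma sinh_gt0 t : 0 < t -> 0 < sinh t.
Proof.
by move=> t0; rewrite /sinh divr_gt0// subr_gt0 ltr_expR; lra.
Qed.

Lemma sinhD_sinhB x y : sinh (x + 2 * y) + sinh (x - 2 * y) =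
  2 * sinh x * (1 + 2 * sinh y ^+ 2).
Proof.
have h : expR y * expR (- y) = 1 by rewrite -expRD subrr expR0.
have yE : 2 * y = y + y by ring.
rewrite /sinh opprD opprB yE !opprD !expRD; move: h.
move: (expR y) (expR (- y)) (expR x) (expR (- x)) => a b p q ab.
have -> : ((a - b) / 2) ^+ 2 = (a ^+ 2 + b ^+ 2 - 2 * (a * b)) / 4 by field.
by rewrite ab; field.
Qed.

Lemma sin_bounds t : 0 <= t <= pi -> t * cos t <= sin t <= t.
Proof.
move=> /andP[t0 tpi].
have [c /[!in_itv]/= /andP[c0 ct]] := MVT_segment t0
  (fun x _ => is_derive_sin x) (continuous_subspaceT (@continuous_sin R)).
rewrite sin0 !subr0 => ->; rewrite mulrC; apply/andP; split.
  apply: ler_wpM2r => //; move: ct; rewrite le_eqVlt => /predU1P[->//|ct].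
  by rewrite ltW// ltr_cos// in_itv/= ?t0 ?c0// (le_trans (ltW ct)).
by rewrite ler_piMl// cos_le1.
Qed.

(** With u = t / 2, sin t = 2 cos u sin u >= t (cos u)^2, and (cos u)^2 >= 1/2 because cos t = 2
    (cos u)^2 - 1 is nonnegative. *)
Lemma sin_ge_half t : 0 <= t <= pi / 2 -> t / 2 <= sin t.
Proof.
move=> /andP[t0 tpi]; have pi0 := pi_gt0 R.
have [u uE] : exists u, t = u *+ 2 by exists (t / 2); rewrite mulr2n; lra.
have tu : t = 2 * u by rewrite uE mulr_natl.
have c0 : 0 <= cos t by apply: cos_ge0_pihalf; rewrite tpi andbT; lra.
have h : 0 <= u <= pi by apply/andP; split; lra.
have /andP[s1 _] := sin_bounds h.
have c2 : 0 <= cos u by apply: cos_ge0_pihalf; apply/andP; split; lra.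
have CE : cos t = cos u ^+ 2 *+ 2 - 1 by rewrite uE cos_mulr2n.
have SE : sin t = (cos u * sin u) *+ 2 by rewrite uE sin_mulr2n.
have h2 := ler_wpM2l c2 s1.
have u0 : 0 <= u by lra.
have h3 : 1 / 2 <= cos u ^+ 2 by rewrite CE -mulr_natr in c0; lra.
have h4 := ler_wpM2l u0 h3.
rewrite SE -mulr_natr tu.

rewrite (_ : cos u * (u * cos u) = u * cos u ^+ 2) in h2; last by ring.
lra.
Qed.

Lemma sinD_sinB x y : sin (x + 2 * y) + sin (x - 2 * y) =
  2 * sin x * (1 - 2 * sin y ^+ 2).
Proof.
by rewrite sinD sinB mulr_natl cos_mulr2n cos2sin2 -mulr_natr; ring.
Qed.

(** The odd multiples of sin and of sinh obey the same three-term recursion once (sin)^2 is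
    exchanged with - (sinh)^2, so a single polynomial serves both. Its roots are visible on the sine
    side and the factorization is used on the hyperbolic side, without complex numbers. *)
Let odd_multiple_poly m : exists U : {poly R}, [/\ (size U <= m.+1)%N,
  U.[0] = m.*2.+1%:R,
  forall z, sin (m.*2.+1%:R * z) = sin z * U.[sin z ^+ 2] &
  forall y, sinh (m.*2.+1%:R * y) = sinh y * U.[- sinh y ^+ 2]].
Proof.
pose Q m (U : {poly R}) := [/\ (size U <= m.+1)%N,
  U.[0] = m.*2.+1%:R,
  forall z, sin (m.*2.+1%:R * z) = sin z * U.[sin z ^+ 2] &
  forall y, sinh (m.*2.+1%:R * y) = sinh y * U.[- sinh y ^+ 2]].
suff : exists U V, Q m U /\ Q m.+1 V by move=> [U [V []]]; exists U.
(* Coefficient of the recursion U_(k+2) = L U_(k+1) - U_k, from [sinD_sinB] and [sinhD_sinhB] with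
   [x] an odd multiple of [y]. Two consecutive polynomials are carried along for its sake. *)
pose L : {poly R} := 2%:P - 4 *: 'X.
have sL : (size L <= 2)%N.
  rewrite (leq_trans (size_polyD _ _))// size_polyN geq_max.
  by rewrite (leq_trans (size_polyC_leq1 _))// (leq_trans (size_scale_leq _ _))// size_polyX.
have LE z : L.[z] = 2 - 4 * z by rewrite /L hornerD hornerN hornerZ hornerX hornerC.
have step k (U V : {poly R}) : Q k U -> Q k.+1 V -> Q k.+2 (L * V - U).
  move=> [sU U0 Us Uh] [sV V0 Vs Vh].
  have kE : k.+2.*2.+1%:R = k.+1.*2.+1%:R + 2 :> R by rewrite -natrD addn2.
  have kE' : k.*2.+1%:R = k.+1.*2.+1%:R - 2 :> R by rewrite doubleS -addn2 -addn1 !natrD; ring.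
  split.
  - rewrite (leq_trans (size_polyD _ _))// geq_max size_polyN.
    apply/andP; split; last by rewrite (leq_trans sU)// ltnS ltnW// ltnW.
    rewrite (leq_trans (size_polyMleq _ _))// -subn1 leq_subLR add1n.
    by rewrite (leq_trans (leq_add sL sV)).
  - by rewrite hornerD hornerN hornerM LE U0 V0 kE kE'; ring.
  - move=> z; rewrite hornerD hornerN hornerM LE mulrBr mulrCA -Vs -Us kE kE'.
    have := sinD_sinB (k.+1.*2.+1%:R * z) z; rewrite -mulrDl -mulrBl => h.
    by rewrite -[LHS](addrK (sin ((k.+1.*2.+1%:R - 2) * z))) h; ring.
  - move=> y; rewrite hornerD hornerN hornerM LE mulrBr mulrCA -Vh -Uh kE kE'.
    have := sinhD_sinhB (k.+1.*2.+1%:R * y) y.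
    rewrite (_ : _ * y + 2 * y = (k.+1.*2.+1%:R + 2) * y); last by ring.
    rewrite (_ : _ * y - 2 * y = (k.+1.*2.+1%:R - 2) * y); last by ring.
    move=> h.
    by rewrite -[LHS](addrK (sinh ((k.+1.*2.+1%:R - 2) * y))) h; ring.
elim: m => [|m [U [V [QU QV]]]]; last by exists V, (L * V - U); split => //; exact: step.
exists 1, (L + 1); split; split.
- by rewrite size_poly1.
- by rewrite hornerC.
- by move=> z; rewrite hornerC mul1r mulr1.
- by move=> y; rewrite hornerC mul1r mulr1.
- rewrite (leq_trans (size_polyD _ _))// geq_max size_poly1 andbT//.
- by rewrite hornerD LE hornerC (_ : 1.*2.+1 = 3)%N//; ring.
- move=> z; rewrite (_ : 1.*2.+1 = 3)%N//; have := sinD_sinB z z.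
  rewrite (_ : z - 2 * z = - z); last by ring.
  rewrite (_ : z + 2 * z = 3%:R * z); last by ring.
  rewrite sinN => h; rewrite -[LHS](subrK (sin z)) h hornerD LE hornerC; ring.
- move=> y; rewrite (_ : 1.*2.+1 = 3)%N//; have := sinhD_sinhB y y.
  rewrite (_ : y - 2 * y = - y); last by ring.
  rewrite (_ : y + 2 * y = 3%:R * y); last by ring.
  have -> : sinh (- y) = - sinh y by rewrite /sinh opprK -mulNr opprB.
  move=> h; rewrite -[LHS](subrK (sinh y)) h hornerD LE hornerC; ring.
Qed.

(** The polynomial [U] vanishes at the squares of sin(k pi / M), 1 <= k <= m, since there sin(M z) =
    0 while sin z is not. The candidate product [V] shares these [m] distinct roots and the value
    [M] at 0, so [U - V] has [m + 1] roots and size at most [m + 1]. *)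
Lemma sinh_finite_product m x : let M : R := m.*2.+1%:R in
  sinh x = M * sinh (x / M) *
    \prod_(k < m) (1 + sinh (x / M) ^+ 2 / sin (k.+1%:R * pi / M) ^+ 2).
Proof.
move=> M; have M0 : 0 < M by rewrite ltr0n.
have [U [sU U0 Us Uh]] := odd_multiple_poly m.
pose s k : R := sin (k.+1%:R * pi / M) ^+ 2.
have ang k : (k < m)%N -> 0 < k.+1%:R * pi / M < pi / 2.
  move=> km; rewrite !divr_gt0 ?mulr_gt0 ?pi_gt0 ?ltr0n//=.
  rewrite ltr_pdivrMr// mulrAC ltr_pdivlMr// mulrAC mulrC ltr_pM2l ?pi_gt0//.
  by rewrite -natrM ltr_nat muln2 ltnS leq_double.
have s0 k : (k < m)%N -> 0 < s k.
  by move=> km; rewrite exprn_gt0// sin_gt0_pihalf// ang.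
have sroot k : (k < m)%N -> U.[s k] = 0.
  move=> km; have := Us (k.+1%:R * pi / M); rewrite -/M mulrCA divff ?gt_eqF// mulr1.
  have -> : sin (k.+1%:R * pi) = 0 :> R.
    elim: (k.+1) => [|j IHj]; first by rewrite mul0r sin0.
    by rewrite -natr1 mulrDl mul1r sinD IHj sinpi mul0r mulr0 addr0.
  move/esym/eqP; rewrite mulf_eq0 => /orP[/eqP si0|/eqP//].
  by have := s0 _ km; rewrite /s si0 expr0n/= ltxx.
pose V : {poly R} := M *: \prod_(k < m) (1 - (s k)^-1 *: 'X).
have VE z : V.[z] = M * \prod_(k < m) (1 - z / s k).
  rewrite /V hornerZ horner_prod; congr (_ * _); apply: eq_bigr => k _.
  by rewrite hornerD hornerN hornerZ hornerX hornerC mulrC.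
have sV : (size V <= m.+1)%N.
  rewrite (leq_trans (size_scale_leq _ _))//.
  elim: (m) => [|j IHj]; first by rewrite big_ord0 size_poly1.
  rewrite big_ord_recr/= (leq_trans (size_polyMleq _ _))// -subn1 leq_subLR add1n.
  have h2 : (size ((1 - (s j)^-1 *: 'X)%R : {poly R}) <= 2)%N.
    rewrite (leq_trans (size_polyD _ _))// size_polyN geq_max size_poly1/=.
    by rewrite (leq_trans (size_scale_leq _ _))// size_polyX.
  by rewrite (leq_trans (leq_add IHj h2))// addn2.
have UV : U = V.
  apply/eqP; rewrite -subr_eq0; apply/eqP; apply: contraTeq isT => UV0.
  pose rs := 0 :: [seq s k | k <- iota 0 m].
  have /(max_poly_roots UV0) : all (root (U - V)) rs.
    apply/allP => z; rewrite inE => /predU1P[->|/mapP[k]].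
      rewrite rootE hornerD hornerN U0 VE big1 ?mulr1 ?subrr// => k _.
      by rewrite mul0r subr0.
    rewrite mem_iota add0n => /andP[_ km] ->.
    rewrite rootE hornerD hornerN sroot// VE (bigD1 (Ordinal km))//=.
    by rewrite divff ?(gt_eqF (s0 _ km))// subrr mul0r mulr0 subrr.
  have -> : uniq rs.
    rewrite /= map_inj_in_uniq ?iota_uniq ?andbT.
      apply/mapP => -[k]; rewrite mem_iota add0n => /andP[_ km] h.
      by have := s0 _ km; rewrite -h ltxx.
    move=> i j; rewrite !mem_iota !add0n => /andP[_ im] /andP[_ jm].
    rewrite /s => /eqP; rewrite eqrXn2 ?ltW ?sin_gt0_pihalf ?ang// => /eqP h.
    have := @sin_inj R (i.+1%:R * pi / M) (j.+1%:R * pi / M).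
    have /andP[i1 i2] := ang _ im; have /andP[j1 j2] := ang _ jm.
    have pi0 := pi_gt0 R.
    rewrite !in_itv/= => /(_ _ _ h); rewrite !(ltW i2) !(ltW j2) !andbT.
    move=> /(_ _ _)/= h'.
    have : i.+1%:R * pi / M = j.+1%:R * pi / M by apply: h'; apply: ltW; apply: lt_trans (_ : 0 < _) => //; lra.
    have Mpi : pi / M != 0 by rewrite mulf_neq0 ?invr_eq0 ?gt_eqF.
    rewrite -!mulrA => /(mulIf Mpi)/eqP; rewrite eqr_nat => /eqP [].
    by [].
  move=> /(_ isT); rewrite /= size_map size_iota => h.
  have := leq_trans h (size_polyD _ _); rewrite size_polyN leq_max.
  by rewrite !ltnNge sU sV.
have := Uh (x / M); rewrite -/M mulrCA divff ?gt_eqF// mulr1 => ->.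
rewrite UV VE mulrCA mulrA; congr (_ * _); apply: eq_bigr => k _.
by rewrite mulNr opprK.
Qed.


Let odd_inv_cvg : (fun m => (m.*2.+1%:R : R)^-1) @ \oo --> (0 : R).
Proof.
apply: (@squeeze_cvgr _ _ _ _ (fun=> 0) (@harmonic R) _).
- by near=> m; rewrite invr_ge0 ler0n/= /harmonic lef_pV2 ?posrE ?ltr0n// ler_nat ltnS -addnn leq_addr.
- exact: cvg_cst.
- exact: cvg_harmonic.
Unshelve. all: by end_near. Qed.

Let odd_quot_cvg x : (fun m => x / m.*2.+1%:R) @ \oo --> (0 : R).
Proof. by rewrite -(mulr0 x); apply: cvgMr; exact: odd_inv_cvg. Qed.

Let odd_sinh_cvg x : 0 < x -> (fun m => m.*2.+1%:R * sinh (x / m.*2.+1%:R)) @ \oo --> x.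
Proof.
move=> x0; have q0 m : 0 <= x / m.*2.+1%:R by rewrite divr_ge0 ?ltW.
apply: (@squeeze_cvgr _ _ _ _ (fun m => x / (1 + x / m.*2.+1%:R)) (fun m => x * expR (x / m.*2.+1%:R)) _).
- near=> m; have M0 : 0 < m.*2.+1%:R :> R by rewrite ltr0n.
  have /andP[h1 h2] := sinh_bounds (q0 m).
  have E : x = m.*2.+1%:R * (x / m.*2.+1%:R) by rewrite mulrC divfK ?gt_eqF.
  have := ler_wpM2l (ltW M0) h1; have := ler_wpM2l (ltW M0) h2.
  by rewrite !(mulrA _ (x / _)) -E => -> ->.
- have : (fun m => x / (1 + x / m.*2.+1%:R)) @ \oo --> x * (1 + 0)^-1.
    apply: cvgMr; apply: cvgV; first by rewrite addr0 oner_neq0.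
    by apply: cvgD; [exact: cvg_cst|exact: odd_quot_cvg].
  by rewrite addr0 invr1 mulr1.
- have : (fun m => x * expR (x / m.*2.+1%:R)) @ \oo --> x * expR 0.
    by apply: cvgMr; apply: continuous_cvg; [exact: continuous_expR|exact: odd_quot_cvg].
  by rewrite expR0 mulr1.
Unshelve. all: by end_near. Qed.

Let odd_sin_cvg k : (fun m => m.*2.+1%:R * sin (k.+1%:R * pi / m.*2.+1%:R)) @ \oo --> (k.+1%:R * pi : R).
Proof.
have pi0 := pi_gt0 R; set x := k.+1%:R * pi.
have x0 : 0 < x by rewrite mulr_gt0.
apply: (@squeeze_cvgr _ _ _ _ (fun m => x * cos (x / m.*2.+1%:R)) (fun=> x) _).
- near=> m; have M0 : 0 < m.*2.+1%:R :> R by rewrite ltr0n.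
  have h : 0 <= x / m.*2.+1%:R <= pi.
    rewrite divr_ge0 ?ltW//=.
    near: m; exact: (cvgr_lt _ (odd_quot_cvg x) _ pi0).
  have /andP[h1 h2] := sin_bounds h.
  have E : x = m.*2.+1%:R * (x / m.*2.+1%:R) by rewrite mulrC divfK ?gt_eqF.
  have := ler_wpM2l (ltW M0) h1; have := ler_wpM2l (ltW M0) h2.
  by rewrite !(mulrA _ (x / _)) -E => -> ->.
- have : (fun m => x * cos (x / m.*2.+1%:R)) @ \oo --> x * cos 0.
    by apply: cvgMr; apply: continuous_cvg; [exact: continuous_cos|exact: odd_quot_cvg].
  by rewrite cos0 mulr1.
- exact: cvg_cst.
Unshelve. all: by end_near. Qed.

(** Telescoping, since t^-2 <= 2/t - 2/(t + 1) for t >= 1. *)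
Lemma sum_inv_sqr_tail n m : (n <= m)%N ->
  \sum_(n <= k < m) (k.+1%:R ^- 2 : R) <= 2 / n.+1%:R.
Proof.
move=> nm; apply: (@le_trans _ _ (2 / n.+1%:R - 2 / m.+1%:R)); last by rewrite gerBl divr_ge0.
rewrite -(subnKC nm); elim: (m - n)%N => [|j IHj]; first by rewrite addn0 big_geq// subrr.
rewrite addnS big_nat_recr ?leq_addr//=.
suff h : (n + j).+1%:R ^- 2 <= 2 / (n + j).+1%:R - 2 / (n + j).+2%:R :> R
  by rewrite (le_trans (lerD IHj h))// addrA subrK.
have t1 : 1 <= (n + j).+1%:R :> R by rewrite ler1n.
rewrite -[(n + j).+2%:R]natr1; move: ((n + j).+1%:R) t1 => t t1.
have t0 : 0 < t by lra.
have -> : 2 / t - 2 / (t + 1) = t ^- 2 * (2 * t / (t + 1)).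
  by field; rewrite !gt_eqF//; lra.
by rewrite ler_pMr ?invr_gt0 ?exprn_gt0// ler_pdivlMr; lra.
Qed.

(** In the finite factorization of order [m] the first [n] factors converge as [m] grows, and the
    remaining ones have a product between 1 and exp(2 C / (n + 1)), uniformly in [m]. Letting [m]
    and then [n] go to infinity squeezes the partial products. *)
Lemma sinh_product x : 0 < x ->
  (fun n => \prod_(k < n) (1 + x ^+ 2 / (k.+1%:R * pi) ^+ 2)) @ \oo --> sinh x / x.
Proof.
move=> x0; have pi0 := pi_gt0 R.
pose r m k := sinh (x / m.*2.+1%:R) ^+ 2 / sin (k.+1%:R * pi / m.*2.+1%:R) ^+ 2.
pose f m := m.*2.+1%:R * sinh (x / m.*2.+1%:R).
have q0 m : 0 < x / m.*2.+1%:R by rewrite divr_gt0.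
have f0 m : 0 < f m by rewrite mulr_gt0// sinh_gt0.
have r0 m k : 0 <= r m k by rewrite divr_ge0 ?sqr_ge0.
have r_cvg k : (fun m => r m k) @ \oo --> x ^+ 2 / (k.+1%:R * pi) ^+ 2.
  have -> : (fun m => r m k) = (fun m => f m ^+ 2 / (m.*2.+1%:R * sin (k.+1%:R * pi / m.*2.+1%:R)) ^+ 2).
    apply/funext => m; rewrite /r /f -!expr_div_n -mulf_div divff ?mul1r//.
  apply: cvgM; first by rewrite !expr2; apply: cvgM; exact: odd_sinh_cvg.
  apply: cvgV; first by rewrite expf_neq0// mulf_neq0 ?gt_eqF.
  by rewrite !expr2; apply: cvgM; exact: odd_sin_cvg.
have prod_cvg n : (fun m => f m * \prod_(k < n) (1 + r m k)) @ \oo -->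
    x * \prod_(k < n) (1 + x ^+ 2 / (k.+1%:R * pi) ^+ 2).
  apply: cvgM; first exact: odd_sinh_cvg.
  elim: n => [|n IHn]; first by rewrite big_ord0; under eq_fun do rewrite big_ord0; exact: cvg_cst.
  rewrite big_ord_recr/=; under eq_fun do rewrite big_ord_recr/=.
  by apply: cvgM => //; apply: cvgD; [exact: cvg_cst|exact: r_cvg].
have split n m : (n <= m)%N ->
    sinh x = f m * (\prod_(k < n) (1 + r m k)) * \prod_(n <= k < m) (1 + r m k).
  move=> nm; rewrite [LHS](sinh_finite_product m) -[RHS]mulrA; congr (_ * _).
  rewrite -(big_mkord xpredT (fun k => 1 + r m k)).
  by rewrite -(big_mkord xpredT (fun k => 1 + r m k)) -big_cat_nat.
(* From sinh(x / M) <= (x / M) exp(x) and sin(k pi / M) >= k pi / (2 M): the powers of [M] cancel in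
   the quotient and leave C / k^2. *)
pose C := (2 * x * expR x / pi) ^+ 2.
have C0 : 0 <= C by exact: sqr_ge0.
have r_le m k : (k < m)%N -> r m k <= C / k.+1%:R ^+ 2.
  move=> km; have M0 : 0 < m.*2.+1%:R :> R by rewrite ltr0n.
  have M1 : 1 <= m.*2.+1%:R :> R by rewrite ler1n.
  have /andP[_ h1] := sinh_bounds (ltW (q0 m)).
  have h2 : sinh (x / m.*2.+1%:R) <= x / m.*2.+1%:R * expR x.
    rewrite (le_trans h1)// ler_pM2l// ler_expR ler_pdivrMr// ler_peMr//; exact: ltW.
  have t0 : 0 < k.+1%:R * pi / m.*2.+1%:R :> R by rewrite divr_gt0// mulr_gt0.
  have h3 : k.+1%:R * pi / m.*2.+1%:R / 2 <= sin (k.+1%:R * pi / m.*2.+1%:R) :> R.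
    apply: sin_ge_half; rewrite (ltW t0)/=.
    rewrite ler_pdivrMr// mulrAC ler_pdivlMr// mulrAC mulrC ler_pM2l ?pi_gt0//.
    by rewrite -natrM ler_nat muln2 leqW// leq_double.
  have -> : C / k.+1%:R ^+ 2 = (x / m.*2.+1%:R * expR x) ^+ 2 / (k.+1%:R * pi / m.*2.+1%:R / 2) ^+ 2.
    have K0 : k.+1%:R != 0 :> R by [].
    rewrite /C; move: (gt_eqF M0) K0 (gt_eqF pi0).
    move: (m.*2.+1%:R) (k.+1%:R) (expR x) (pi) => M K e p N0 L0 p0.
    by field; rewrite N0 L0 p0.
  rewrite /r; apply: ler_pM; rewrite ?sqr_ge0 ?invr_ge0 ?sqr_ge0//.
    by rewrite lerXn2r// nnegrE ltW ?sinh_gt0// mulr_gt0 ?expR_gt0.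
  have s0 : 0 < sin (k.+1%:R * pi / m.*2.+1%:R) :> R by apply: lt_le_trans h3; rewrite divr_gt0.
  rewrite lef_pV2 ?posrE ?exprn_gt0 ?(divr_gt0 t0)//.
  by rewrite lerXn2r// nnegrE ltW ?(divr_gt0 t0).
have lower n : x * \prod_(k < n) (1 + x ^+ 2 / (k.+1%:R * pi) ^+ 2) <= sinh x.
  apply: (cvgr_to_le (prod_cvg n)); exists n => // m /= nm.
  rewrite (split n m nm) ler_peMr//.
    by rewrite mulr_ge0 ?(ltW (f0 m))// prodr_ge0// => k _; rewrite addr_ge0.
  by elim/big_ind: _ => // [? ? ? ?|k _]; [exact: mulr_ege1|rewrite lerDl].
have upper n : sinh x * expR (- (2 * C / n.+1%:R)) <= x * \prod_(k < n) (1 + x ^+ 2 / (k.+1%:R * pi) ^+ 2).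
  apply: (cvgr_to_ge (prod_cvg n)); exists n => // m /= nm.
  rewrite expRN ler_pdivrMr ?expR_gt0// (split n m nm) ler_wpM2l//.
    by rewrite mulr_ge0 ?(ltW (f0 m))// prodr_ge0// => k _; rewrite addr_ge0.
  apply: (@le_trans _ _ (\prod_(n <= k < m) expR (C / k.+1%:R ^+ 2))).
    rewrite !big_nat; apply: ler_prod => k /andP[_ km]; rewrite addr_ge0//=.
    by rewrite (le_trans (expR_ge1Dx _))// ler_expR r_le.
  rewrite -expR_sum ler_expR -mulr_sumr [leRHS]mulrAC [leRHS]mulrC ler_wpM2l//.
  exact: sum_inv_sqr_tail.
apply: (@squeeze_cvgr _ _ _ _ (fun n => sinh x / x * expR (- (2 * C / n.+1%:R))) (fun=> sinh x / x) _).
- near=> n; rewrite mulrAC ler_pdivrMr// [leRHS]mulrC upper/=.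
  by rewrite ler_pdivlMr// mulrC lower.
- have : (fun n => sinh x / x * expR (- (2 * C / n.+1%:R))) @ \oo --> sinh x / x * expR (- (2 * C * 0)).
    apply: cvgMr; apply: continuous_cvg; first exact: continuous_expR.
    by apply: cvgN; apply: cvgMr; exact: cvg_harmonic.
  by rewrite mulr0 oppr0 expR0 mulr1.
- exact: cvg_cst.
Unshelve. all: by end_near. Qed.

End sinh_product.

(** * Gaussian transforms *)

Section gaussian_integrals.
Context (R : realType).
Notation leb := (@lebesgue_measure R).
Implicit Types (q s m k a t : R).

Lemma integral_gaussian q m : 0 < q ->
  (\int[leb]_x (expR (- ((x - m) ^+ 2 / (2 * q))))%:E =
   (Num.sqrt (2 * pi * q))%:E)%E.
Proof.
move=> q0; have sq0 : Num.sqrt q != 0 by rewrite gt_eqF// sqrtr_gt0.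
have E x : expR (- ((x - m) ^+ 2 / (2 * q))) =
    Num.sqrt (2 * pi * q) * normal_pdf m (Num.sqrt q) x.
  rewrite normal_pdfE// /normal_peak /normal_fun sqr_sqrtr ?(ltW q0)//.
  have -> : q * pi *+ 2 = 2 * pi * q by rewrite -mulr_natl; ring.
  rewrite mulrA divff ?mul1r; last by rewrite gt_eqF// sqrtr_gt0 !mulr_gt0// pi_gt0.
  by rewrite -mulNr mulr_natl.
under eq_integral do rewrite E EFinM.
rewrite ge0_integralZl//.
- by rewrite integral_normal_pdf mule1.
- by apply/measurable_EFinP; exact: measurable_normal_pdf.
- by move=> x _; rewrite lee_fin normal_pdf_ge0.
Qed.

Lemma measurable_gaussian m q :
  measurable_fun setT (fun x : R => expR (- ((x - m) ^+ 2 / (2 * q)))).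
Proof.
apply: measurableT_comp => //; apply: measurableT_comp => //.
by apply: measurable_funM => //; apply: measurable_funX; exact: measurable_funB.
Qed.

(** The factor of [F] in one coordinate: a centred Gaussian density of variance [s] with the sign of
    its exponent reversed, up to a constant. *)
Definition gauss_exp s x : R := (Num.sqrt s)^-1 * expR (x ^+ 2 / (2 * s)).

Lemma gauss_exp_ge0 s x : 0 <= gauss_exp s x.
Proof. by rewrite mulr_ge0 ?expR_ge0// invr_ge0 sqrtr_ge0. Qed.

Lemma measurable_gauss_exp s : measurable_fun setT (gauss_exp s).
Proof.
apply: measurable_funM => //; apply: measurableT_comp => //.
by apply: measurable_funM => //; exact: measurable_funX.
Qed.

(** Completion of the square in [y]. The coefficient of y^2 in the exponent is 1/(2s) - 1/(2t),
    negative because t < s, and a Gaussian of variance t s / (s - t) remains. *)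
Lemma gauss_exp_normal s t x y : 0 < t < s ->
  gauss_exp s (x + y) * normal_pdf 0 (Num.sqrt t) y =
  gauss_exp (s - t) x * ((Num.sqrt (2 * pi * (t * s / (s - t))))^-1 *
    expR (- ((y - x * t / (s - t)) ^+ 2 / (2 * (t * s / (s - t)))))).
Proof.
move=> /andP[t0 ts]; have st0 : 0 < s - t by rewrite subr_gt0.
have s0 : 0 < s by exact: lt_trans ts.
have st : Num.sqrt t != 0 by rewrite gt_eqF// sqrtr_gt0.
have pi0 := pi_gt0 R.
rewrite normal_pdfE// /normal_peak /normal_fun sqr_sqrtr ?(ltW t0)// subr0.
rewrite /gauss_exp mulrACA [RHS]mulrACA -!expRD -!invfM -!sqrtrM ?(ltW s0) ?(ltW st0)//.
congr ((Num.sqrt _)^-1 * expR _).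
  by rewrite -mulr_natl; field; rewrite gt_eqF.
by rewrite -mulr_natl; field; rewrite !gt_eqF.
Qed.

Lemma expectation_gauss_exp d (T : measurableType d) (P : probability T R)
    (D : T -> R) s t x : 0 < t < s ->
  has_law P D (normal_prob 0 (Num.sqrt t)) ->
  (\int[P]_w (gauss_exp s (x + D w))%:E = (gauss_exp (s - t) x)%:E)%E.
Proof.
move=> ts [mD' lawD]; have mD : measurable_fun setT (D : T -> measurableTypeR R) by [].
have /andP[t0 st] := ts.
have mg : measurable_fun setT (fun y => gauss_exp s (x + y)).
  by apply: (measurableT_comp (measurable_gauss_exp s)); exact: measurable_funD.
have -> : (\int[P]_w (gauss_exp s (x + D w))%:E =
    \int[image_prob P mD]_y (gauss_exp s (x + y))%:E)%E.
  rewrite (ge0_integral_image_prob P mD (g := fun y => (gauss_exp s (x + y))%:E))//.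
    exact/measurable_EFinP.
  by move=> y; rewrite lee_fin gauss_exp_ge0.
apply: etrans (ge0_integral_density (p := image_prob P mD) (f := normal_pdf 0 (Num.sqrt t)) _ _ _ _ _) _ => //.
- exact: measurable_normal_pdf.
- by move=> y; exact: normal_pdf_ge0.
- by move=> y; exact: gauss_exp_ge0.
- under eq_integral do rewrite gauss_exp_normal// EFinM.
  rewrite ge0_integralZl//; last 2 first.
  + apply/measurable_EFinP; apply: measurable_funM => //; exact: measurable_gaussian.
  + by rewrite lee_fin gauss_exp_ge0.
  under eq_integral do rewrite EFinM.
  rewrite ge0_integralZl//; last first.
  + by apply/measurable_EFinP; exact: measurable_gaussian.
  have q0 : 0 < t * s / (s - t).
    by rewrite divr_gt0 ?subr_gt0// mulr_gt0// (lt_trans t0).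
  rewrite integral_gaussian// -[X in (_ * X)%E]EFinM mulVf ?mule1//.
  by rewrite gt_eqF// sqrtr_gt0 mulr_gt0 ?pi_gt0// mulr_gt0 ?pi_gt0.
Qed.

Definition cosh x : R := (expR x + expR (- x)) / 2.

(** The integrand is even, so the integral is half of the one over the line, where it is a sum of
    two Gaussians of variance 1/s centred at a/s and - a/s. *)
Lemma integral_cosh_gaussian s a : 0 < s ->
  (\int[leb]_(k in `[0%R, +oo[%classic) (cosh (k * a) * expR (- (k ^+ 2 * s / 2)))%:E =
   (Num.sqrt (2 * pi) / 2 * gauss_exp s a)%:E)%E.
Proof.
move=> s0; pose g k := cosh (k * a) * expR (- (k ^+ 2 * s / 2)).
have g0 k : 0 <= g k by rewrite mulr_ge0 ?expR_ge0// divr_ge0// addr_ge0 ?expR_ge0.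
have cg : continuous g.
  have cf : continuous (fun k => - (k ^+ 2 * s / 2)).
    move=> k; apply: cvgN; apply: cvgMl; apply: cvgMl.
    exact: exprn_continuous.
  have ca : continuous (fun k => k * a) by move=> k; apply: cvgMl; exact: cvg_id.
  move=> k; apply: cvgM.
    apply: cvgMl; apply: cvgD.
      by apply: (continuous_comp (ca k)); exact: continuous_expR.
    apply: (@continuous_comp _ _ _ (fun k => - (k * a)) expR); last exact: continuous_expR.
    by apply: cvgN; exact: ca.
  by apply: (continuous_comp (cf k)); exact: continuous_expR.
have gE k : g k = expR (a ^+ 2 / (2 * s)) / 2 * (expR (- ((k - a / s) ^+ 2 / (2 * s^-1))) +
    expR (- ((k - - (a / s)) ^+ 2 / (2 * s^-1)))).
  rewrite /g /cosh mulrAC [RHS]mulrAC; congr (_ / 2).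
  rewrite mulrDl mulrDr -!expRD; congr (expR _ + expR _); field; exact: lt0r_neq0.
have evg : g =1 g \o -%R.
  by move=> k; rewrite /g/= /cosh sqrrN mulNr opprK [X in X / 2]addrC.
have := ge0_symfun_integralT g0 cg evg.
under eq_integral do rewrite gE EFinM.
rewrite ge0_integralZl//; last first.
- by apply/measurable_EFinP; apply: measurable_funD; exact: measurable_gaussian.
under eq_integral do rewrite EFinD.
rewrite ge0_integralD//; last 2 first.
- by apply/measurable_EFinP; exact: measurable_gaussian.
- by apply/measurable_EFinP; exact: measurable_gaussian.
rewrite !integral_gaussian ?invr_gt0// -EFinD -EFinM -set_itvcy => h.
have -> : (\int[leb]_(k in `[0%R, +oo[) (g k)%:E = 2^-1%:E * (2%:E * \int[leb]_(k in `[0%R, +oo[) (g k)%:E))%E.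
  by rewrite muleA -EFinM mulVf// mul1e.
rewrite -h -EFinM; congr EFin.
rewrite sqrtrM ?mulr_ge0 ?pi_ge0// sqrtrV ?(ltW s0)// /gauss_exp; field.
by rewrite gt_eqF ?sqrtr_gt0.
Qed.

End gaussian_integrals.
Section gaussian_parts.
Context (R : realType).
Notation leb := (@lebesgue_measure R).
Implicit Types (q s m k a t : R).

Let e s k := expR (- (k ^+ 2 * s / 2)).

Let is_derive_e s k : is_derive k 1 (e s) (- (k * s) * e s k).
Proof.
have -> : e s = (fun x => expR (- (x ^+ 2 * (s / 2)))).
  by apply/funext => x; rewrite /e mulrA.
by apply: is_derive_eq; rewrite /GRing.scale/=; field.
Qed.

Let continuous_e s : continuous (e s).
Proof. by move=> k; apply: differentiable_continuous; exact/derivable1_diffP. Qed.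

Let e_decay s c : 0 < s -> (fun n : nat => expR (c * n%:R) * e s n%:R) @ \oo --> (0 : R).
Proof.
move=> s0; apply: (@squeeze_cvgr _ _ _ _ (fun=> 0) (@harmonic R) _).
- near=> n; rewrite mulr_ge0 ?expR_ge0//= /e -expRD /harmonic.
  rewrite -[X in expR X]opprK expRN lef_pV2 ?posrE ?expR_gt0 ?ltr0n//.
  rewrite -natr1 addrC (le_trans (expR_ge1Dx _))// ler_expR.
  have n0 : 0 <= n%:R :> R by [].
  have h : (c + 1) * 2 / s <= n%:R by near: n; exact: nbhs_infty_ger.
  rewrite ler_pdivrMr// in h.
  have := ler_wpM2l n0 h; nra.
- exact: cvg_cst.
- exact: cvg_harmonic.
Unshelve. all: by end_near. Qed.

(** The exponential factor has derivative - k s times itself, so the primitive to use is [F], up to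
    sign g times this factor over s. The growth bound on [g] kills the boundary term, and positivity
    lets both integrals be reached by monotone convergence. It serves for [g] the identity and for
    [g] a hyperbolic sine. *)
Lemma gaussian_by_parts s (c : R) (g g' : R -> R) : 0 < s ->
  (forall x : R, is_derive x 1 g (g' x)) -> continuous g' -> g 0 = 0 ->
  (forall x, 0 <= x -> 0 <= g x <= expR (c * x)) ->
  (forall x, 0 <= x -> 0 <= g' x) ->
  (\int[leb]_(k in `[0%R, +oo[%classic) (k * g k * expR (- (k ^+ 2 * s / 2)))%:E =
   (s^-1)%:E * \int[leb]_(k in `[0%R, +oo[%classic) (g' k * expR (- (k ^+ 2 * s / 2)))%:E)%E.
Proof.
move=> s0 dg cg' g00 gb g'0.
have cg : continuous g.
  by move=> x; apply: differentiable_continuous; apply/derivable1_diffP; exact: ex_derive.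
pose u k := k * g k * e s k; pose v k := s^-1 * (g' k * e s k).
have cu : continuous u.
  by move=> x; apply: cvgM; [apply: cvgM; [exact: cvg_id|exact: cg]|exact: continuous_e].
have cv : continuous v.
  by move=> x; apply: cvgMr; apply: cvgM; [exact: cg'|exact: continuous_e].
pose F k := - (s^-1 * (g k * e s k)).
have dF k : is_derive k 1 F (u k - v k).
  rewrite /F /u /v; move: (is_derive_e s k); move: (e s) => ee dee.
  by apply: is_derive_eq; rewrite /GRing.scale/=; field; exact: lt0r_neq0.
have itg (f : R -> R) n : continuous f -> leb.-integrable `[0, n.+1%:R] (EFin \o f).
  move=> cf; apply: continuous_compact_integrable; first exact: segment_compact.
  exact: continuous_subspaceT.
(* In additive form, so that the passage to the limit never subtracts integrals that might be
   infinite. *)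
have parts (n : nat) : (\int[leb]_(k in `[0%R, n.+1%:R]) (u k)%:E +
    (s^-1 * (g n.+1%:R * e s n.+1%:R))%:E = \int[leb]_(k in `[0%R, n.+1%:R]) (v k)%:E)%E.
  have -> : (\int[leb]_(k in `[0%R, n.+1%:R]) (u k)%:E =
      \int[leb]_(k in `[0%R, n.+1%:R]) (u k - v k)%:E +
      \int[leb]_(k in `[0%R, n.+1%:R]) (v k)%:E)%E.
    rewrite -integralD//.
    - by apply: eq_integral => k _; rewrite -EFinD subrK.
    - by apply: itg => k; apply: cvgB; [exact: cu|exact: cv].
    - exact: itg.
  rewrite (@continuous_FTC2 _ (fun k => u k - v k) F).
  - rewrite {2}/F g00 mul0r mulr0 oppr0 sube0 addeAC -EFinD /F addNr.
    exact: add0e.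
  - by rewrite ltr0n.
  - by apply: continuous_subspaceT => k; apply: cvgB; [exact: cu|exact: cv].
  - have cF : continuous F.
      by move=> x; apply: differentiable_continuous; apply/derivable1_diffP; exact: ex_derive.
    split.
    + by move=> x _; exact: ex_derive.
    + exact: (cvg_at_right_filter (cF 0)).
    + exact: (cvg_at_left_filter (cF _)).
  - by move=> x _; rewrite derive1E derive_val.
have cup : \bigcup_n `[0%R, n.+1%:R]%classic = `[0%R, +oo[%classic :> set R.
  apply/seteqP; split => [x [n _]|x]/=; rewrite !in_itv/= ; first by case/andP=> ->.
  rewrite andbT => x0.
  exists (Num.truncn x) => //=; rewrite in_itv/= x0/=.
  by rewrite ltW// truncnS_gt.
have ndF : nondecreasing_seq (fun n => `[0%R, n.+1%:R]%classic : set R).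
  move=> m n mn; apply/subsetPset => x /=; rewrite !in_itv/= => /andP[-> xm]/=.
  by rewrite (le_trans xm)// ler_nat ltnS.
have itv0 (n : nat) (x : R) : `[0%R, n.+1%:R]%classic x -> 0 <= x.
  by rewrite /= in_itv/= => /andP[].
have mE (f : R -> R) (D : set R) : continuous f -> measurable_fun D (EFin \o f).
  by move=> cf; apply/measurable_EFinP; apply: measurable_funTS; exact: continuous_measurable_fun.
have u_cvg : (\int[leb]_(k in `[0%R, n.+1%:R]) (u k)%:E @[n --> \oo] -->
    \int[leb]_(k in `[0%R, +oo[) (u k)%:E)%E.
  rewrite -cup; apply: ge0_nondecreasing_set_cvg_integral => //.
  - by move=> n; exact: mE.
  - move=> n x /itv0 x0; have /andP[gx _] := gb _ x0.
    by rewrite lee_fin !mulr_ge0// expR_ge0.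
have v_cvg : (\int[leb]_(k in `[0%R, n.+1%:R]) (v k)%:E @[n --> \oo] -->
    \int[leb]_(k in `[0%R, +oo[) (v k)%:E)%E.
  rewrite -cup; apply: ge0_nondecreasing_set_cvg_integral => //.
  - by move=> n; exact: mE.
  - by move=> n x /itv0 x0; rewrite lee_fin !mulr_ge0 ?expR_ge0 ?invr_ge0 ?(ltW s0)// g'0.
have h_cvg : ((s^-1 * (g n.+1%:R * e s n.+1%:R))%:E @[n --> \oo] --> 0%:E)%E.
  apply: cvg_EFin; first exact: nearW.
  rewrite -(mulr0 s^-1); apply: cvgMr.
  have := e_decay c s0; rewrite -(cvg_shiftS (fun n : nat => expR (c * n%:R) * e s n%:R)) => dec.
  apply: (@squeeze_cvgr _ _ _ _ (fun=> 0) _ _ _ _ _ dec); last exact: cvg_cst.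
  near=> n; have /andP[g0 g1] := gb n.+1%:R (ler0n _ _).
  by rewrite mulr_ge0 ?expR_ge0// ler_wpM2r// expR_ge0.
transitivity (\int[leb]_(k in `[0%R, +oo[) (v k)%:E)%E; last first.
  rewrite -ge0_integralZl//.
  - by apply: mE => x; apply: cvgM; [exact: cg'|exact: continuous_e].
  - by move=> x /=; rewrite in_itv/= andbT => x0; rewrite lee_fin mulr_ge0 ?expR_ge0// g'0.
  - by rewrite lee_fin invr_ge0 ltW.
have := cvgeD _ u_cvg h_cvg; rewrite adde0 => /(_ _) => h1.
have : (\int[leb]_(k in `[0%R, n.+1%:R]) (u k)%:E + (s^-1 * (g n.+1%:R * e s n.+1%:R))%:E @[n --> \oo] -->
    \int[leb]_(k in `[0%R, +oo[) (u k)%:E)%E.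
  by apply: h1; rewrite fin_num_adde_defl.
under eq_fun do rewrite parts.
by move=> h; exact: (cvg_unique _ h v_cvg).
Unshelve. all: by end_near. Qed.

Lemma integral_sqr_gaussian s : 0 < s ->
  (\int[leb]_(k in `[0%R, +oo[%classic) (k * k * expR (- (k ^+ 2 * s / 2)))%:E =
   (Num.sqrt (2 * pi) / 2 * (gauss_exp s 0 / s))%:E)%E.
Proof.
move=> s0; rewrite (@gaussian_by_parts s 1 id (fun=> 1))//.
- have := integral_cosh_gaussian 0 s0.
  under eq_integral do rewrite mulr0 /cosh oppr0 expR0 (_ : (1 + 1) / 2 = 1) ?divff//.
  move=> h; apply: etrans (congr1 (fun z => (s^-1)%:E * z)%E h) _.
  by rewrite -EFinM; congr (_%:E); ring.
- by move=> x; exact: cvg_cst.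
- by move=> x x0; rewrite x0 mul1r (le_trans _ (expR_ge1Dx _))// lerDr.
Qed.

(** With the same constant as in [integral_sqr_gaussian]: the kernel on the sphere of radius [a] and
    the one at the origin are Gaussian transforms of k sinh(k a) / a and of k^2. *)
Lemma integral_sinh_gaussian s a : 0 < s -> 0 < a ->
  (\int[leb]_(k in `[0%R, +oo[%classic) (k * sinh (k * a) * expR (- (k ^+ 2 * s / 2)))%:E =
   (Num.sqrt (2 * pi) / 2 * (a * gauss_exp s a / s))%:E)%E.
Proof.
move=> s0 a0; have c0 k : 0 <= cosh (k * a) by rewrite divr_ge0// addr_ge0 ?expR_ge0.
have cc : continuous (fun k => cosh (k * a)).
  move=> x; apply: cvgMl; apply: cvgD.
    apply: (@continuous_comp _ _ _ (fun k => k * a) expR); last exact: continuous_expR.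
    by apply: cvgMl; exact: cvg_id.
  apply: (@continuous_comp _ _ _ (fun k => - (k * a)) expR); last exact: continuous_expR.
  by apply: cvgN; apply: cvgMl; exact: cvg_id.
have cce : continuous (fun k => cosh (k * a) * expR (- (k ^+ 2 * s / 2))).
  by move=> x; apply: cvgM; [exact: cc|exact: continuous_e].
have dsinh (x : R) : is_derive x 1 (fun k => sinh (k * a)) (a * cosh (x * a)).
  by rewrite /sinh /cosh; apply: is_derive_eq; rewrite /GRing.scale/=; field.
rewrite (gaussian_by_parts (c := a) s0 dsinh)//.
- under eq_integral do rewrite -mulrA EFinM.
  rewrite ge0_integralZl//.
  + by rewrite integral_cosh_gaussian// -!EFinM; congr EFin; field; exact: lt0r_neq0.
  + by apply/measurable_EFinP; apply: measurable_funTS; exact: continuous_measurable_fun.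
  + by move=> k _; rewrite lee_fin mulr_ge0 ?expR_ge0.
  + by rewrite lee_fin ltW.
- by move=> x; apply: cvgMr; exact: cc.
- by rewrite mul0r sinh0.
- move=> x x0; apply/andP; split.
    by rewrite divr_ge0// subr_ge0 ler_expR -subr_ge0 opprK addr_ge0// mulr_ge0// ltW.
  rewrite mulrC ler_pdivrMr//; have := expR_ge0 (- (a * x)); have := expR_ge0 (a * x); lra.
- by move=> x x0; rewrite mulr_ge0// ltW.
Qed.
End gaussian_parts.

(** * Uniqueness of Gaussian transforms *)

Section gaussian_transform.
Context (R : realType).
Notation leb := (@lebesgue_measure R).
Implicit Types (r s k a t l : R).

Let e s k : R := expR (- (k ^+ 2 * s / 2)).

Let measurable_e s : measurable_fun setT (e s).
Proof.
apply: measurableT_comp => //; apply: measurableT_comp => //.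
by apply: measurable_funM => //; apply: measurable_funM => //; exact: measurable_funX.
Qed.

Lemma integral_mul_indic d (T : measurableType d) (mu : {measure set T -> \bar R})
    (D : set T) (g : T -> R) :
  (\int[mu]_k (g k * \1_D k)%:E = \int[mu]_(k in D) (g k)%:E)%E.
Proof.
rewrite [RHS]integral_mkcond; apply: eq_integral => k _.
by rewrite patchE indicE; case: ifPn => _; rewrite ?mulr1 ?mulr0.
Qed.

(* Substituting u = k^2 / 2 turns the Gaussian transform into a Laplace one. *)
Lemma half_square_law (h : R -> R) (Z : R -> R) :
  measurable_fun setT h -> (forall k, 0 <= h k) -> 0 < Z 1 ->
  (forall s, 0 < s ->
    (\int[leb]_(k in `[0%R, +oo[%classic) (h k * expR (- (k ^+ 2 * s / 2)))%:E = (Z s)%:E)%E) ->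
  exists q : probability (measurableTypeR R) R,
  [/\ q `]-oo, 0[%classic = 0%E,
      forall l, 0 <= l -> laplace q l = (Z (1 + l) / Z 1)%:E &
      forall r s, 0 <= r -> 0 <= s -> q `](r ^+ 2 / 2)%R, (s ^+ 2 / 2)%R]%classic =
        ((Z 1)^-1%:E * \int[leb]_(k in `]r, s]%classic) (h k * expR (- (k ^+ 2 * 1 / 2)))%:E)%E].
Proof.
move=> mh h0 Z0 hZ.
have mhe s : measurable_fun setT (fun k => h k * e s k) by exact: measurable_funM.
have he0 s k : 0 <= h k * e s k by rewrite mulr_ge0 ?expR_ge0.
pose D : set R := `[0%R, +oo[%classic.
pose f k := (Z 1)^-1 * (h k * e 1 k) * \1_D k.
have i0 (A : set R) k : 0 <= \1_A k :> R by rewrite indicE.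
have f0 k : 0 <= f k by rewrite !mulr_ge0// ?expR_ge0// invr_ge0 ltW.
have mD : measurable D by exact: measurable_itv.
have mi (A : set R) : measurable A -> measurable_fun setT (\1_A : R -> R).
  by move=> mA; exact: measurable_indic.
have mf : measurable_fun setT f.
  by apply: measurable_funM; [exact: measurable_funM|exact: mi].
have scal (A : set R) s : measurable A -> (\int[leb]_k ((Z 1)^-1 * (h k * e s k) * \1_A k)%:E =
    (Z 1)^-1%:E * \int[leb]_(k in A) (h k * e s k)%:E)%E.
  move=> mA; rewrite integral_mul_indic; under eq_integral do rewrite EFinM.
  rewrite ge0_integralZl//.
  - by apply/measurable_EFinP; apply: measurable_funTS; exact: mhe.
  - by move=> k _; rewrite lee_fin.
  - by rewrite lee_fin invr_ge0 ltW.
have [p pE] : exists p : probability (measurableTypeR R) R,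
    forall A, measurable A -> p A = (\int[leb]_(x in A) (f x)%:E)%E.
  apply: density_prob_exists => //.
  by rewrite scal// hZ// -EFinM mulVf// gt_eqF.
have msq : measurable_fun [set: measurableTypeR R] (fun k => k ^+ 2 / 2 : measurableTypeR R).
  have : measurable_fun [set: R] (fun k : R => k ^+ 2 / 2).
    by apply: measurable_funM => //; exact: measurable_funX.
  by [].
exists (image_prob p msq); split.
- rewrite -[LHS]/(p _); rewrite (_ : _ @^-1` _ = set0) ?measure0//.
  apply/seteqP; split => // k /=; rewrite in_itv/= => h1.
  by have := sqr_ge0 k; lra.
- move=> l l0; rewrite /laplace.
  rewrite (ge0_integral_image_prob p msq (g := fun y => (expR (- (l * y)))%:E))//; last 1 first.
    by apply/measurable_EFinP; exact: measurable_expRN.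
  apply: etrans (ge0_integral_density (p := p) (f := f) (g := fun x => expR (- (l * (x ^+ 2 / 2)))) _ _ _ _ _) _ => //.
    apply: measurableT_comp => //; apply: measurableT_comp => //.
    by apply: measurable_funM => //; apply: measurable_funM => //; exact: measurable_funX.
  have -> : (Z (1 + l) / Z 1)%:E = ((Z 1)^-1%:E * (Z (1 + l))%:E)%E.
    by rewrite -EFinM mulrC.
  rewrite -hZ ?ltr_wpDr// -scal//; apply: eq_integral => k _; congr EFin.
  have -> : e (1 + l) k = expR (- (l * (k ^+ 2 / 2))) * e 1 k.
    by rewrite /e -expRD; congr expR; field.
  by rewrite /f /D; ring.
- move=> r s r0 s0; rewrite -[LHS]/(p _) pE; last first.
    rewrite -[X in measurable X]setTI.
    by apply: msq => //; exact: measurable_itv.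
  rewrite -scal// -integral_mul_indic; apply: eq_integral => k _; congr EFin.
  rewrite /f -[LHS]mulrA; congr (_ * _); rewrite !indicE -natrM mulnb; congr (_%:R); congr nat_of_bool.
  apply/idP/idP.
    rewrite /D => /andP[]; rewrite !inE/= !in_itv/= andbT => k0.
    by rewrite ltr_pM2r// ler_pM2r// ltr_pXn2r// ler_pXn2r.
  rewrite !inE/= !in_itv/= => /andP[rk ks].
  have k0 : 0 <= k by rewrite (le_trans r0)// ltW.
  rewrite /D; apply/andP; split; rewrite inE/= in_itv/= ?k0//.
  by rewrite ltr_pM2r// ler_pM2r// ltr_pXn2r// ler_pXn2r// rk.
Qed.

(* Only the measures h1 dk and h2 dk are known to agree, so h1 and h2 are
   compared on intervals. *)
Lemma gaussian_transform_unique (h1 h2 : R -> R) (Z : R -> R) :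
  measurable_fun setT h1 -> measurable_fun setT h2 ->
  (forall k, 0 <= h1 k) -> (forall k, 0 <= h2 k) -> 0 < Z 1 ->
  (forall s, 0 < s ->
    (\int[leb]_(k in `[0%R, +oo[%classic) (h1 k * expR (- (k ^+ 2 * s / 2)))%:E = (Z s)%:E)%E) ->
  (forall s, 0 < s ->
    (\int[leb]_(k in `[0%R, +oo[%classic) (h2 k * expR (- (k ^+ 2 * s / 2)))%:E = (Z s)%:E)%E) ->
  forall r s c, 0 <= r < s -> 0 < c -> ~ (forall k, r < k <= s -> h1 k + c <= h2 k).
Proof.
move=> mh1 mh2 h10 h20 Z0 hZ1 hZ2 r s c /andP[r0 rs] c0 h12.
have s0 : 0 <= s by rewrite (le_trans r0)// ltW.
have [q1 [n1 L1 E1]] := half_square_law mh1 h10 Z0 hZ1.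
have [q2 [n2 L2 E2]] := half_square_law mh2 h20 Z0 hZ2.
have L12 l : 0 <= l -> laplace q1 l = laplace q2 l by move=> l0; rewrite L1// L2.
have := laplace_unique n1 n2 L12 (measurable_itv (Interval (BRight (r ^+ 2 / 2)) (BRight (s ^+ 2 / 2)))).
rewrite E1// E2// => h.
pose I1 := (\int[leb]_(k in `]r, s]%classic) (h1 k * e 1 k)%:E)%E.
pose I2 := (\int[leb]_(k in `]r, s]%classic) (h2 k * e 1 k)%:E)%E.
have I12 : I1 = I2.
  have : ((Z 1)%:E * ((Z 1)^-1%:E * I1) = (Z 1)%:E * ((Z 1)^-1%:E * I2))%E by rewrite h.
  by rewrite !muleA -EFinM divff ?gt_eqF// !mul1e.
have mhe (D : set R) (h' : R -> R) : measurable_fun setT h' ->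
    measurable_fun D (EFin \o (fun k => h' k * e 1 k)).
  move=> mh'; apply/measurable_EFinP; apply: measurable_funTS.
  by apply: measurable_funM => //; exact: measurable_e.
have I1fin : I1 \is a fin_num.
  rewrite ge0_fin_numE ?integral_ge0// => [|k _]; last by rewrite lee_fin mulr_ge0 ?expR_ge0.
  apply: (@le_lt_trans _ _ (Z 1)%:E); last exact: ltry.
  rewrite -(hZ1 1)// ge0_subset_integral//.
  - exact: mhe.
  - by move=> k _; rewrite lee_fin mulr_ge0 ?expR_ge0.
  - move=> k /=; rewrite !in_itv/= => /andP[rk _]; rewrite andbT (le_trans r0)//; exact: ltW.
(* On []r, s]] the weight is at least its value at [s], so the gap [c] survives integration as a
   positive amount, against the equality of [I1] and [I2]. *)
have : (I1 + (c * e 1 s * (s - r))%:E <= I2)%E.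
  have -> : ((c * e 1 s * (s - r))%:E = \int[leb]_(k in `]r, s]%classic) (c * e 1 s)%:E)%E.
    have E : (leb `]r, s]%classic = (s - r)%:E)%E.
      by rewrite lebesgue_measure_itv/= lte_fin rs.
    rewrite integral_cst//; apply: etrans (congr1 (fun z => (c * e 1 s)%:E * z)%E (esym E)).
    by rewrite -EFinM.
  rewrite /I1 -ge0_integralD//; last 3 first.
  - by move=> k _; rewrite lee_fin mulr_ge0 ?expR_ge0.
  - exact: mhe.
  - by move=> k _; rewrite lee_fin mulr_ge0 ?expR_ge0// ltW.
  apply: ge0_le_integral => //.
  - by move=> k _; rewrite -EFinD lee_fin addr_ge0// mulr_ge0 ?expR_ge0// ltW.
  - by apply: emeasurable_funD; [exact: mhe|exact: measurable_cst].
  - exact: mhe.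
  - move=> k /=; rewrite in_itv/= => rks; rewrite -EFinD lee_fin.
    apply: (@le_trans _ _ ((h1 k + c) * e 1 k)); last by rewrite ler_wpM2r ?expR_ge0// h12.
    rewrite mulrDl lerD2l ler_pM2l// ler_expR lerN2 !mulr1 ler_pM2r//.
    have /andP[rk ks] := rks.
    by rewrite ler_pXn2r// nnegrE (le_trans r0)// ltW.
rewrite -I12 -(fineK I1fin) -EFinD lee_fin gerDl leNgt => /negP; apply.
by rewrite !mulr_gt0 ?expR_gt0// subr_gt0.
Qed.

End gaussian_transform.

Section finite_extension.
Context (R : realType).

(** The value 0 at [+oo] is the limit there of the functions extended below, the passage kernel and
    decaying exponentials: a path that never reaches the level contributes nothing. *)
Definition fin_ext (g : R -> R) (s : \bar R) : R := if s is r%:E then g r else 0.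

Lemma fin_extE g s : fin_ext g s = g (fine s) * \1_[set x : \bar R | x \is a fin_num] s.
Proof.
rewrite indicE; case: s => [r||]/=.
- by rewrite mem_set ?mulr1.
- by rewrite memNset ?mulr0.
- by rewrite memNset ?mulr0.
Qed.

Lemma measurable_fin_num : measurable [set x : \bar R | x \is a fin_num].
Proof.
by rewrite -[X in measurable X]setTI; exact: emeasurable_fin_num.
Qed.

Lemma measurable_fin_indic :
  measurable_fun setT (\1_[set x : \bar R | x \is a fin_num] : \bar R -> R).
Proof. by apply: measurable_indic; exact: measurable_fin_num. Qed.

Lemma measurable_fin_ext (g : R -> R) : measurable_fun setT g ->
  measurable_fun setT (fin_ext g).
Proof.
move=> mg; rewrite (_ : fin_ext g = fun s => g (fine s) * \1_[set x : \bar R | x \is a fin_num] s); last first.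
  by apply/funext => s; rewrite fin_extE.
apply: measurable_funM; last exact: measurable_fin_indic.
by apply: (measurableT_comp mg); exact: fine_measurable.
Qed.

End finite_extension.

(** * From the kernel identity to the Laplace transform *)

Section passage_inversion.
Context (R : realType).
Notation leb := (@lebesgue_measure R).
Implicit Types (r s k a t l : R).

(** The value of F(t + r, x) on the sphere of radius [a]. Clamping [r] at 0 keeps the time argument
    positive, hence the function continuous on the whole line. *)
Definition passage_kernel a t r : R :=
  gauss_exp (t + Num.max 0 r) a / (t + Num.max 0 r).

Lemma passage_kernelE a t r : 0 <= r ->
  passage_kernel a t r = gauss_exp (t + r) a / (t + r).
Proof. by move=> r0; rewrite /passage_kernel max_r. Qed.

Lemma passage_kernel_ge0 a t r : 0 < t -> 0 <= passage_kernel a t r.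
Proof.
by move=> t0; rewrite divr_ge0 ?gauss_exp_ge0// addr_ge0 ?(ltW t0)// le_max lexx.
Qed.

Lemma measurable_passage_kernel a t : 0 < t ->
  measurable_fun setT (passage_kernel a t).
Proof.
move=> t0; apply: continuous_measurable_fun => r.
have p0 : 0 < t + Num.max 0 r by rewrite ltr_pwDl// le_max lexx.
have cm : (fun r => t + Num.max 0 r) @ r --> t + Num.max 0 r.
  by apply: cvgD; [exact: cvg_cst|apply: (@continuous_max R R (cst 0) id); [exact: cvg_cst|exact: cvg_id]].
apply: cvgM; last by apply: cvgV => //; exact: lt0r_neq0.
apply: cvgM.
  apply: cvgV; first by rewrite gt_eqF// sqrtr_gt0.
  by apply: continuous_cvg => //; exact: sqrt_continuous.
apply: continuous_cvg; first exact: continuous_expR.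
apply: cvgMr; apply: cvgV; first by rewrite mulf_neq0// gt_eqF.
by apply: cvgMr.
Qed.

Let e s k : R := expR (- (k ^+ 2 * s / 2)).

Let measurable_e s : measurable_fun setT (e s).
Proof.
apply: measurableT_comp => //; apply: measurableT_comp => //.
by apply: measurable_funM => //; apply: measurable_funM => //; exact: measurable_funX.
Qed.

Let sinhN x : sinh (- x) = - sinh x :> R.
Proof. by rewrite /sinh opprK -mulNr opprB. Qed.

Let xsinh_ge0 k a : 0 < a -> 0 <= k * sinh (k * a).
Proof.
move=> a0; have [k0|k0|->] := ltgtP k 0; last by rewrite mul0r.
- by rewrite -mulrNN -sinhN -mulNr mulr_ge0 ?ltW ?sinh_gt0 ?mulr_gt0 ?oppr_gt0.
- by rewrite mulr_ge0 ?ltW ?sinh_gt0 ?mulr_gt0.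
Qed.

Let continuous_sinh a : continuous (fun k => sinh (k * a)).
Proof.
move=> x; apply: cvgMl; apply: cvgB.
  apply: (@continuous_comp _ _ _ (fun k => k * a) expR); last exact: continuous_expR.
  by apply: cvgMl; exact: cvg_id.
apply: (@continuous_comp _ _ _ (fun k => - (k * a)) expR); last exact: continuous_expR.
by apply: cvgN; apply: cvgMl; exact: cvg_id.
Qed.

(** By Tonelli, the hypothesis says that k sinh(k a) E exp(- k^2 S / 2) and a k^2 have the same
    Gaussian transform. Uniqueness of the transform compares them only on intervals; monotonicity of
    the expectation in [k] makes the comparison pointwise. *)
Theorem passage_inversion d (T : measurableType d) (P : probability T R)
    (S : T -> \bar R) a : measurable_fun setT S -> (forall w, 0 <= S w)%E -> 0 < a ->
  (forall t, 0 < t -> (\int[P]_w (fin_ext (passage_kernel a t) (S w))%:E =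
    (gauss_exp t 0 / t)%:E)%E) ->
  forall k, 0 < k ->
    (\int[P]_w (fin_ext (fun r => expR (- (k ^+ 2 / 2 * r))) (S w))%:E =
     (k * a / sinh (k * a))%:E)%E.
Proof.
move=> mS S0 a0 hS.
pose E k w : R := fin_ext (fun r => expR (- (k ^+ 2 / 2 * r))) (S w).
have E0 k w : 0 <= E k w by rewrite /E; case: (S w) => [r||]//=; rewrite expR_ge0.
have E1 k w : E k w <= 1.
  rewrite /E; have := S0 w; case: (S w) => [r||]//=.
  by rewrite lee_fin => r0; rewrite -expR0 ler_expR lerNl oppr0 mulr_ge0// divr_ge0 ?sqr_ge0.
have mexp k : measurable_fun setT (fun r => expR (- (k ^+ 2 / 2 * r)) : R).
  exact: measurable_expRN.
have mE k : measurable_fun setT (E k) by exact: (measurableT_comp (measurable_fin_ext (mexp k)) mS).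
have mE2 : measurable_fun [set: measurableTypeR R * T] (fun z => E z.1 z.2).
  have -> : (fun z : measurableTypeR R * T => E z.1 z.2) = (fun z => expR (- (z.1 ^+ 2 / 2 * fine (S z.2))) *
      \1_[set x : \bar R | x \is a fin_num] (S z.2)).
    by apply/funext => z; rewrite /E fin_extE.
  have m1 : measurable_fun [set: measurableTypeR R * T] (fun z => z.1 : R).
    by have := @measurable_fst _ _ (measurableTypeR R) T.
  have m2 : measurable_fun [set: measurableTypeR R * T] (fun z => S z.2).
    by apply: (measurableT_comp mS); exact: measurable_snd.
  apply: measurable_funM.
    apply: measurableT_comp => //; apply: measurableT_comp => //; apply: measurable_funM.
      by apply: measurable_funM => //; exact: measurable_funX.
    by apply: (measurableT_comp _ m2); exact: fine_measurable.
  have h := measurableT_comp (@measurable_fin_indic R) m2; exact: h.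
pose phi k := Rintegral P setT (E k).
have iE k : P.-integrable setT (EFin \o E k).
  by apply: (@bounded_integrable _ _ _ _ _ _ 1) => // w _; rewrite ger0_norm.
have phiE k : ((phi k)%:E = \int[P]_w (E k w)%:E)%E by rewrite EFin_Rintegral.
have phi0 k : 0 <= phi k by apply: Rintegral_ge0 => w _; exact: E0.
have mE2' : measurable_fun [set: measurableTypeR R * T] (fun z => (E z.1 z.2)%:E).
  exact/measurable_EFinP.
have mphi : measurable_fun setT phi.
  have := measurable_fun_fubini_tonelli_F (m2 := P) _ mE2' (fun z => E0 z.1 z.2).
  move=> /(measurableT_comp (@fine_measurable R _ measurableT)).
  by [].
have phi_le r k : 0 < r -> r <= k -> phi k <= phi r.
  move=> r0 rk; rewrite -lee_fin !phiE; apply: ge0_le_integral => //.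
  - by move=> w _; rewrite lee_fin.
  - by apply/measurable_EFinP.
  - by apply/measurable_EFinP.
  - move=> w _; rewrite lee_fin /E; have := S0 w; case: (S w) => [x||]//=.
    rewrite lee_fin => x0; rewrite ler_expR lerN2 ler_wpM2r// ler_pM2r//.
    by rewrite ler_pXn2r// nnegrE ltW// (lt_le_trans r0).
pose h1 k := k * sinh (k * a) * phi k.
pose h2 k := a * (k * k).
pose Z s := Num.sqrt (2 * pi) / 2 * (a * gauss_exp s 0 / s).
have Z0 : 0 < Z 1.
  have g0 : 0 < gauss_exp 1 0 :> R by rewrite mulr_gt0 ?expR_gt0// invr_gt0 sqrtr_gt0.
  have p0 : 0 < Num.sqrt (2 * pi) :> R by rewrite sqrtr_gt0 mulr_gt0// pi_gt0.
  by rewrite /Z divr1; apply: mulr_gt0; [exact: divr_gt0|exact: mulr_gt0].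
have mh1 : measurable_fun setT h1.
  apply: measurable_funM => //; apply: measurable_funM => //.
  exact: continuous_measurable_fun.
have mh2 : measurable_fun setT h2 by apply: measurable_funM => //; exact: measurable_funM.
have h10 k : 0 <= h1 k by rewrite mulr_ge0// xsinh_ge0.
have h20 k : 0 <= h2 k by rewrite mulr_ge0 ?(ltW a0)// -expr2 sqr_ge0.
have hZ2 s : 0 < s ->
    (\int[leb]_(k in `[0%R, +oo[%classic) (h2 k * expR (- (k ^+ 2 * s / 2)))%:E = (Z s)%:E)%E.
  move=> s0; under eq_integral do rewrite /h2 -mulrA EFinM.
  rewrite ge0_integralZl//.
  - by rewrite integral_sqr_gaussian// -EFinM; congr EFin; rewrite /Z; ring.
  - apply/measurable_EFinP; apply: measurable_funTS; apply: measurable_funM; last exact: measurable_e.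
    exact: measurable_funM.
  - by move=> k _; rewrite lee_fin mulr_ge0 ?expR_ge0// -expr2 sqr_ge0.
  - by rewrite lee_fin ltW.
have hZ1 s : 0 < s ->
    (\int[leb]_(k in `[0%R, +oo[%classic) (h1 k * expR (- (k ^+ 2 * s / 2)))%:E = (Z s)%:E)%E.
  move=> s0; pose D : set R := `[0%R, +oo[%classic.
  have i0 k : 0 <= \1_D k :> R by rewrite indicE.
  have mD : measurable_fun setT (\1_D : R -> R) by apply: measurable_indic; exact: measurable_itv.
  pose g k := k * sinh (k * a) * e s k * \1_D k.
  have g0 k : 0 <= g k by apply: mulr_ge0 => //; rewrite mulr_ge0 ?expR_ge0// xsinh_ge0.
  have mg : measurable_fun setT g.
    apply: measurable_funM => //; apply: measurable_funM; last exact: measurable_e.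
    apply: measurable_funM => //; exact: continuous_measurable_fun.
  have -> : (\int[leb]_(k in D) (h1 k * e s k)%:E = \int[leb]_k \int[P]_w (g k * E k w)%:E)%E.
    rewrite -integral_mul_indic; apply: eq_integral => k _.
    under eq_integral do rewrite EFinM.
    rewrite ge0_integralZl//; last 3 first.
    - by apply/measurable_EFinP; exact: mE.
    - by move=> w _; rewrite lee_fin.
    - by rewrite lee_fin.
    by rewrite -phiE -EFinM /g /h1; congr EFin; ring.
  have mgE : measurable_fun [set: measurableTypeR R * T] (fun z => (g z.1 * E z.1 z.2)%:E).
    apply/measurable_EFinP; apply: measurable_funM => //.
    have m1 : measurable_fun [set: measurableTypeR R * T] (fun z => z.1 : R).
      by have := @measurable_fst _ _ (measurableTypeR R) T.
    exact: (measurableT_comp mg m1).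
  have gE0 (z : measurableTypeR R * T) : (0 <= (g z.1 * E z.1 z.2)%:E)%E.
    by rewrite lee_fin mulr_ge0.
  apply: etrans (fubini_tonelli (m1 := leb) (m2 := P) _ mgE gE0) _.
  have -> : ((Z s)%:E = (Num.sqrt (2 * pi) / 2 * a)%:E * \int[P]_w (fin_ext (passage_kernel a s) (S w))%:E)%E.
    by rewrite hS// -EFinM; congr EFin; rewrite /Z; ring.
  have pk0 w : 0 <= fin_ext (passage_kernel a s) (S w).
    by case: (S w) => [r||]//=; exact: passage_kernel_ge0.
  have mpk := measurable_passage_kernel a s0.
  rewrite -ge0_integralZl//; last 3 first.
  - apply/measurable_EFinP; exact: (measurableT_comp (measurable_fin_ext mpk) mS).
  - by move=> w _; rewrite lee_fin.
  - by rewrite lee_fin mulr_ge0 ?(ltW a0)// divr_ge0// sqrtr_ge0.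
  apply: eq_integral => w _; rewrite /E; have := S0 w; case: (S w) => [r||]//=; last first.
    move=> _; rewrite mule0; under eq_integral do rewrite mulr0.
    exact: integral0.
  rewrite lee_fin => r0; have sr0 : 0 < s + r by rewrite ltr_wpDr.
  transitivity (\int[leb]_k (k * sinh (k * a) * e (s + r) k * \1_D k)%:E)%E.
    apply: eq_integral => k _; congr EFin; rewrite /g.
    have -> : e (s + r) k = e s k * expR (- (k ^+ 2 / 2 * r)).
      by rewrite /e -expRD; congr expR; field.
    ring.
  rewrite integral_mul_indic integral_sinh_gaussian// passage_kernelE// -EFinM.
  by congr EFin; ring.
move=> k k0; rewrite -phiE; congr EFin.
have sh0 : 0 < sinh (k * a) by rewrite sinh_gt0// mulr_gt0.
(* The difference [h1 - h2] with [phi] frozen at [k], hence continuous. If it is positive at [k],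
   then to the left of [k], where [phi] is larger, [h1 - h2] is bounded below by a positive
   constant; if it is negative, the same argument works to the right of [k]. *)
pose D x := x * sinh (x * a) * phi k - a * (x * x).
have cD : continuous D.
  move=> x; apply: cvgB; first by apply: cvgMl; apply: cvgM; [exact: cvg_id|exact: continuous_sinh].
  by apply: cvgMr; apply: cvgM; exact: cvg_id.
have DE : D k = k * sinh (k * a) * (phi k - k * a / sinh (k * a)).
  by rewrite /D; field; exact: lt0r_neq0.
have ks0 : 0 < k * sinh (k * a) by rewrite mulr_gt0.
apply/eqP; rewrite eq_le !leNgt; apply/andP; split; apply/negP => hk.
- have Dk : 0 < D k by rewrite DE mulr_gt0// subr_gt0.
  have Dk2 : D k / 2 < D k by lra.
  have [eps /= eps0 heps] := cvgr_gt _ (cD k) _ Dk2.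
  (* The bound [k / 2] keeps the interval inside the positive half-line, where [phi_le] holds. *)
  pose r := Num.max (k / 2) (k - eps / 2).
  have rk : r < k by rewrite gt_max; apply/andP; split; lra.
  have r0 : 0 < r by rewrite lt_max divr_gt0.
  have rks : 0 <= r < k by rewrite ltW.
  apply: (@gaussian_transform_unique R h2 h1 Z mh2 mh1 h20 h10 Z0 hZ2 hZ1 r k (D k / 2) rks).
    by rewrite divr_gt0.
  move=> x /andP[rx xk]; have x0 : 0 < x by exact: lt_trans rx.
  have : D k / 2 < D x.
    apply: heps; rewrite /ball_/= ger0_norm ?subr_ge0//.
    have : k - eps / 2 <= r by rewrite le_max lexx orbT.
    lra.
  rewrite /D /h1 /h2; have := phi_le _ _ x0 xk.
  move=> /(ler_wpM2l (xsinh_ge0 x a0)); lra.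
- have Dk : D k < 0 by rewrite DE pmulr_rlt0// subr_lt0.
  have Dk2 : D k < D k / 2 by lra.
  have [eps /= eps0 heps] := cvgr_lt _ (cD k) _ Dk2.
  pose r := k + eps / 2.
  have rks : 0 <= k < r by rewrite ltW//=/r; lra.
  apply: (@gaussian_transform_unique R h1 h2 Z mh1 mh2 h10 h20 Z0 hZ1 hZ2 k r (- (D k / 2)) rks).
    by rewrite oppr_gt0; lra.
  move=> x /andP[kx xr]; have x0 : 0 < x by exact: lt_trans kx.
  have : D x < D k / 2.
    apply: heps; rewrite /ball_/= distrC ger0_norm ?subr_ge0 ?(ltW kx)//.
    by rewrite /r in xr; lra.
  rewrite /D /h1 /h2; have := phi_le _ _ k0 (ltW kx).
  move=> /(ler_wpM2l (xsinh_ge0 x a0)); lra.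
Qed.
End passage_inversion.

(** * Brownian motion along a grid *)

Section gaussian_walk.
Context (R : realType).
Implicit Types (s a b c t h : R).

Definition sqnorm (x : 'I_3 -> R) : R := \sum_(i < 3) x i ^+ 2.

Lemma sqnorm_ge0 x : 0 <= sqnorm x.
Proof. by apply: sumr_ge0 => i _; exact: sqr_ge0. Qed.

(** The function [F], kept as a product so that independent coordinates separate. *)
Definition gauss_exp3 s (x : 'I_3 -> R) : R := \prod_(i < 3) gauss_exp s (x i).

Lemma gauss_exp3_ge0 s x : 0 <= gauss_exp3 s x.
Proof. by apply: prodr_ge0 => i _; exact: gauss_exp_ge0. Qed.

Lemma gauss_exp3E s x : 0 < s ->
  gauss_exp3 s x = (Num.sqrt s)^-1 / s * expR (sqnorm x / (2 * s)).
Proof.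
move=> s0; rewrite /gauss_exp3 /gauss_exp big_split/= -expR_sum -mulr_suml.
rewrite prodr_const card_ord; congr (_ * _).
by rewrite -[X in _ / X](sqr_sqrtr (ltW s0)) -exprVn -exprS.
Qed.

Lemma gauss_exp3_sphere s x a : 0 < s -> sqnorm x = a ^+ 2 ->
  gauss_exp3 s x = gauss_exp s a / s.
Proof. by move=> s0 xa; rewrite gauss_exp3E// xa /gauss_exp mulrAC. Qed.

(** Coordinatewise, expand (c x - y)^2 / c >= 0. The weight [c] is free; [walk_overshoot] takes it
    equal to (b - a) / a and to 1. *)
Lemma sqnormD_le c x y : 0 < c ->
  sqnorm (fun i => x i + y i) <= (1 + c) * sqnorm x + (1 + c^-1) * sqnorm y.
Proof.
move=> c0; rewrite /sqnorm !mulr_sumr -big_split/=; apply: ler_sum => i _.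
have : 0 <= c^-1 * (c * x i - y i) ^+ 2 by rewrite mulr_ge0 ?sqr_ge0// invr_ge0 ltW.
have -> : c^-1 * (c * x i - y i) ^+ 2 = c * x i ^+ 2 - 2 * (x i * y i) + c^-1 * y i ^+ 2.
  by field; exact: lt0r_neq0.
move: (x i) (y i) (c^-1) => u v e; rewrite sqrrD; lra.
Qed.

Definition alive (T : Type) (X : nat -> T -> 'I_3 -> R) a (j : nat) : set T :=
  [set w | forall m, (m <= j)%N -> sqnorm (X m w) < a ^+ 2].

Lemma alive_anti (T : Type) (X : nat -> T -> 'I_3 -> R) a i j : (i <= j)%N ->
  alive X a j `<=` alive X a i.
Proof. by move=> ij w h m mi; apply: h; exact: leq_trans ij. Qed.

Lemma measurable_sqnorm d (T : measurableType d) (Y : T -> 'I_3 -> R) :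
  (forall i, measurable_fun setT (fun w => Y w i)) ->
  measurable_fun setT (fun w => sqnorm (Y w)).
Proof.
by move=> mY; apply: measurable_sum => i; exact: measurable_funX.
Qed.

Lemma measurable_gauss_exp3 d (T : measurableType d) s (Y : T -> 'I_3 -> R) :
  (forall i, measurable_fun setT (fun w => Y w i)) ->
  measurable_fun setT (fun w => gauss_exp3 s (Y w)).
Proof.
move=> mY; apply: measurable_prod => i _.
by apply: (measurableT_comp (measurable_gauss_exp s)); exact: mY.
Qed.

Lemma measurable_alive d (T : measurableType d) (X : nat -> T -> 'I_3 -> R) a j :
  (forall m i, (m <= j)%N -> measurable_fun setT (fun w => X m w i)) ->
  measurable (alive X a j).
Proof.
move=> mX.
have -> : alive X a j = \bigcap_(m in `I_j.+1) [set w | sqnorm (X m w) < a ^+ 2].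
  by apply/seteqP; split => w h m; have := h m; rewrite /= ltnS.
apply: fin_bigcap_measurable => // m; rewrite /= ltnS => mj.
rewrite -[X in measurable X]setTI.
have -> : [set w | sqnorm (X m w) < a ^+ 2] = (fun w => sqnorm (X m w)) @^-1` `]-oo, a ^+ 2[%classic.
  by apply/seteqP; split => w /=; rewrite in_itv.
have := @measurable_sqnorm _ _ (X m) (fun i => mX m i mj).
by apply => //; exact: measurable_itv.
Qed.

Context d (T : measurableType d) (P : probability T R) (B : 'I_3 -> R -> T -> R).
Hypothesis hB : standard_brownian_motion P B.

Let mB i t : 0 <= t -> measurable_fun setT (B i t).
Proof. by case: hB => mB _ _ _ _; exact: mB. Qed.

Let B0 i w : B i 0 w = 0.
Proof. by case: hB. Qed.

Lemma expectation_gauss_exp3 s t h x : 0 <= t -> 0 < h < s ->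
  (\int[P]_w (gauss_exp3 s (fun i => x i + (B i (t + h) w - B i t w)))%:E =
   (gauss_exp3 (s - h) x)%:E)%E.
Proof.
move=> t0 hs; have /andP[h0 _] := hs; case: hB => _ _ _ lawB indB.
pose tt (m : nat) := t + m%:R * h.
have tt_lt m : (m < 1)%N -> tt m < tt m.+1.
  by move=> _; rewrite ltrD2l ltr_pM2r// ltr_nat.
have tt0 : 0 <= tt 0%N by rewrite /tt mul0r addr0.
have ind := indB 1%N tt tt0 tt_lt.
have ttE0 : tt 0%N = t by rewrite /tt mul0r addr0.
have ttE1 : tt 1%N = t + h by rewrite /tt mul1r.
have th : t < t + h by rewrite ltrDl.
pose D (im : 'I_3 * 'I_1) w := B im.1 (tt im.2.+1) w - B im.1 (tt im.2) w.
have mD im : measurable_fun setT (D im).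
  by apply: measurable_funB; apply: mB; rewrite /tt addr_ge0// mulr_ge0// ltW.
have := independent_expectation_prod mD ind
  (f := fun im y => (gauss_exp s (x im.1 + y))%:E) _ _.
have mf (im : 'I_3 * 'I_1) : measurable_fun setT (fun y => (gauss_exp s (x im.1 + y))%:E).
  apply/measurable_EFinP; apply: (measurableT_comp (measurable_gauss_exp s)).
  exact: measurable_funD.
have f0 (im : 'I_3 * 'I_1) y : (0 <= (gauss_exp s (x im.1 + y))%:E)%E.
  by rewrite lee_fin gauss_exp_ge0.
move=> /(_ mf f0) h1.
transitivity (\int[P]_w \prod_(im : 'I_3 * 'I_1) (gauss_exp s (x im.1 + D im w))%:E)%E.
  apply: eq_integral => w _; rewrite prodEFin; congr EFin.
  rewrite -(pair_bigA _ (fun i m => gauss_exp s (x i + D (i, m) w)))/=.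
  apply: eq_bigr => i _; rewrite big_ord1; congr (gauss_exp _ (_ + _)).
  by rewrite /D/= ttE0 ttE1.
rewrite h1 -(pair_bigA _ (fun i m => \int[P]_w (gauss_exp s (x i + D (i, m) w))%:E)%E)/=.
rewrite /gauss_exp3 -prodEFin; apply: eq_bigr => i _; rewrite big_ord1.
apply: expectation_gauss_exp => //; rewrite /D/= ttE0 ttE1.
have := lawB i t (t + h) t0 th.
by rewrite (_ : t + h - t = h)//; ring.
Qed.


Definition walk h (j : nat) (w : T) (i : 'I_3) : R := B i (j%:R * h) w.

Lemma measurable_walk h j i : 0 <= h -> measurable_fun setT (fun w => walk h j w i).
Proof. by move=> h0; apply: mB; rewrite mulr_ge0. Qed.

Lemma measurable_alive_walk h a j : 0 <= h -> measurable (alive (walk h) a j).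
Proof. by move=> h0; apply: measurable_alive => m i _; exact: measurable_walk. Qed.

(** The martingale property on the survivors: survival up to [j] and the position at [j] depend on
    the first [j] increments only, so the next one, independent of them, can be integrated out with
    the position held fixed. *)
Lemma walk_step h a c j : 0 < h -> 0 < c ->
  (\int[P]_(w in alive (walk h) a j) (gauss_exp3 (c + h) (walk h j.+1 w))%:E =
   \int[P]_(w in alive (walk h) a j) (gauss_exp3 c (walk h j w))%:E)%E.
Proof.
move=> h0 c0; case: hB => _ _ _ _ indB.
pose tt (m : nat) := m%:R * h.
have tt_lt m : (m < j.+1)%N -> tt m < tt m.+1.
  by move=> _; rewrite ltr_pM2r// ltr_nat.
have tt0 : 0 <= tt 0%N by rewrite /tt mul0r.
have ind := indB j.+1 tt tt0 tt_lt.
pose D (im : 'I_3 * 'I_j.+1) w := B im.1 (tt im.2.+1) w - B im.1 (tt im.2) w.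
have mD im : measurable_fun setT (D im).
  by apply: measurable_funB; apply: mB; rewrite /tt mulr_ge0// ltW.
(* The past: increments over the first [j] intervals. Index [ord_max] is the interval from [j] to
   [j + 1]. *)
pose J (im : 'I_3 * 'I_j.+1) := (im.2 < j)%N.
pose T1 := g_sigma_algebraType (rectangles D J).
pose T2 := g_sigma_algebraType (rectangles D (predC J)).
have mW m i : (m <= j)%N -> measurable_fun [set: T1] (fun w : T1 => walk h m w i).
  elim: m => [_|m IHm mj].
    have -> : (fun w : T1 => walk h 0 w i) = cst 0.
      by apply/funext => w; rewrite /walk mul0r B0.
    exact: measurable_cst.
  have mj1 : (m < j.+1)%N by exact: ltnW.
  have -> : (fun w : T1 => walk h m.+1 w i) =
      (fun w : T1 => walk h m w i + D (i, Ordinal mj1) w).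
    by apply/funext => w; rewrite /walk /D /tt/= addrC subrK.
  apply: measurable_funD; first exact: IHm (ltnW mj).
  have := @measurable_fun_rectangles _ _ _ _ _ D J (i, Ordinal mj1); apply.
  exact: mj.
have mA : measurable (alive (walk h) a j : set T1).
  exact: measurable_alive.
pose f (z : T1 * T2) := (gauss_exp3 (c + h) (fun i => walk h j z.1 i + D (i, ord_max) z.2) *
  \1_(alive (walk h) a j) z.1)%:E.
have f0 z : (0 <= f z)%E by rewrite lee_fin mulr_ge0 ?gauss_exp3_ge0// indicE.
have mf : measurable_fun setT f.
  apply/measurable_EFinP; apply: measurable_funM; last first.
    have mi : measurable_fun [set: T1] (\1_(alive (walk h) a j) : T1 -> R) by exact: measurable_indic.
    have := measurableT_comp mi (@measurable_fst _ _ T1 T2); exact.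
  apply: measurable_gauss_exp3 => i; apply: measurable_funD.
    have := measurableT_comp (mW j i (leqnn j)) (@measurable_fst _ _ T1 T2); exact.
  have mDj : measurable_fun [set: T2] (D (i, ord_max)).
    by have := @measurable_fun_rectangles _ _ _ _ _ D (predC J) (i, ord_max); apply; rewrite /J/= ltnn.
  have := measurableT_comp mDj (@measurable_snd _ _ T1 T2); exact.
have split := independent_split_fubini mD ind mf f0.
rewrite -[LHS]integral_mul_indic -[RHS]integral_mul_indic.
transitivity (\int[P]_w f (w, w))%E.
  apply: eq_integral => w _; rewrite /f/=; congr ((gauss_exp3 _ _) * _)%:E.
  by apply/funext => i; rewrite /walk /D /tt/= addrC subrK.
rewrite split; apply: eq_integral => w _; rewrite /f/=.
under eq_integral do rewrite mulrC EFinM.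
rewrite ge0_integralZl//; last 2 first.
- apply/measurable_EFinP; apply: measurable_gauss_exp3 => i.
  by apply: measurable_funD => //; exact: mD.
- by move=> y _; rewrite lee_fin gauss_exp3_ge0.
have tj0 : 0 <= j%:R * h by rewrite mulr_ge0// ltW.
have hc : 0 < h < c + h by rewrite h0 ltrDr.
have E := expectation_gauss_exp3 (walk h j w) tj0 hc.
have -> : (\int[P]_y (gauss_exp3 (c + h) (fun i => walk h j w i + D (i, ord_max) y))%:E =
    (gauss_exp3 c (walk h j w))%:E)%E.
  rewrite -[in RHS](addrK h c) -E; apply: eq_integral => y _.
  congr (gauss_exp3 _ _)%:E; apply/funext => i; congr (_ + _).
  by rewrite /D/= /tt -natr1 mulrDl mul1r.
by rewrite -EFinM mulrC.
Qed.


Let alive0 h a : 0 < a -> alive (walk h) a 0 = setT.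
Proof.
move=> a0; apply/seteqP; split => // w _ m; rewrite leqn0 => /eqP ->.
by rewrite /sqnorm big1 ?exprn_gt0// => i _; rewrite /walk mul0r B0 expr0n.
Qed.

(** Optional stopping for the discrete walk: the initial value is the sum of the contributions of
    the exits at steps 1, ..., K and of the paths still inside after [K] steps. *)
Lemma walk_sum h a c K : 0 < h -> 0 < a -> 0 < c ->
  ((gauss_exp c 0 / c)%:E =
   \sum_(j < K) \int[P]_(w in alive (walk h) a j `\` alive (walk h) a j.+1)
     (gauss_exp3 (c + j.+1%:R * h) (walk h j.+1 w))%:E +
   \int[P]_(w in alive (walk h) a K) (gauss_exp3 (c + K%:R * h) (walk h K w))%:E)%E.
Proof.
move=> h0 a0 c0; elim: K => [|K IHK].
  rewrite big_ord0 add0e alive0// mul0r addr0.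
  have E w : gauss_exp3 c (walk h 0 w) = gauss_exp c 0 / c.
    apply: gauss_exp3_sphere => //; rewrite /sqnorm big1 ?expr0n// => i _.
    by rewrite /walk mul0r B0 expr0n.
  under eq_integral do rewrite E.
  by rewrite integral_cst//= probability_setT mule1.
rewrite big_ord_recr/= [LHS]IHK -addeA; congr (_ + _)%E.
have h00 := ltW h0.
have cK : 0 < c + K%:R * h by rewrite ltr_pwDl// mulr_ge0.
rewrite -walk_step// -addrA -[X in K%:R * h + X]mul1r -mulrDl natr1.
have mF : measurable_fun setT (fun w => (gauss_exp3 (c + K.+1%:R * h) (walk h K.+1 w))%:E).
  by apply/measurable_EFinP; apply: measurable_gauss_exp3 => i; exact: measurable_walk.
have {1}-> : alive (walk h) a K = (alive (walk h) a K `\` alive (walk h) a K.+1) `|` alive (walk h) a K.+1.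
  rewrite setUC setDUK//; exact: alive_anti.
rewrite ge0_integral_setU//.
- by apply: measurableD; exact: measurable_alive_walk.
- exact: measurable_alive_walk.
- exact: measurable_funTS.
- by move=> w _; rewrite lee_fin gauss_exp3_ge0.
- by rewrite disj_set2E setDE -setIA setICl setI0.
Qed.

(** Jumping in one step from inside radius [a] to outside radius [b] takes an increment [D] with |D|
    >= b - a. Part of the Gaussian weight of [D] pays for the factor exp(- (b - a)^2 / (4 h)), and
    what is left still controls the growth of [F]. *)
Lemma walk_overshoot h a b c j : 0 < h -> 0 < a -> a < b -> h <= c / 8 ->
  (\int[P]_(w in alive (walk h) a j `&` [set w | (b ^+ 2 <= sqnorm (walk h j.+1 w))%R])
     (gauss_exp3 (c + j.+1%:R * h) (walk h j.+1 w))%:E <=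
   (8 * ((Num.sqrt c)^-1 / c) * expR (a ^+ 2 / c) * expR (- ((b - a) ^+ 2 / (4 * h))))%:E)%E.
Proof.
move=> h0 a0 ab hc; have b0 : 0 < b by exact: lt_trans ab.
have c0 : 0 < c by lra.
have h00 := ltW h0.
pose D w (i : 'I_3) := walk h j.+1 w i - walk h j w i.
(* The exponents |D|^2 / (8 h), from the growth of [F], and |D|^2 / (4 h), from the extracted
   factor, add up to 3 |D|^2 / (8 h) = |D|^2 / (2 s). As h < s, [expectation_gauss_exp3] applies;
   the constant 8 of the statement is (s / (s - h))^(3/2) = 4^(3/2). *)
pose s : R := 4 / 3 * h.
have s0 : 0 < s by rewrite /s; lra.
pose C : R := (Num.sqrt c)^-1 / c * expR (a ^+ 2 / c) * expR (- ((b - a) ^+ 2 / (4 * h))).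
have C0 : 0 <= C.
  by rewrite !mulr_ge0 ?expR_ge0// invr_ge0 ?sqrtr_ge0// ltW.
set A := (X in integral _ X _).
have mW m : measurable_fun setT (fun w => sqnorm (walk h m w)).
  by apply: measurable_sqnorm => i; exact: measurable_walk.
have mA : measurable A.
  apply: measurableI; first exact: measurable_alive_walk.
  rewrite -[X in measurable X]setTI.
  have -> : [set w | b ^+ 2 <= sqnorm (walk h j.+1 w)] =
      (fun w => sqnorm (walk h j.+1 w)) @^-1` `[b ^+ 2, +oo[%classic.
    by apply/seteqP; split => w /=; rewrite in_itv/= andbT.
  by apply: mW => //; exact: measurable_itv.
have bound w : A w -> gauss_exp3 (c + j.+1%:R * h) (walk h j.+1 w) <=
    C * expR (sqnorm (D w) * (3 / (8 * h))).
  move=> [/(_ j (leqnn j)) xa /= xb].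
  have jh0 : 0 <= j.+1%:R * h by rewrite mulr_ge0.
  have WE : walk h j.+1 w = (fun i => walk h j w i + D w i).
    by apply/funext => i; rewrite /D addrC subrK.
  have q0 := sqnorm_ge0 (D w).
  have x0 := sqnorm_ge0 (walk h j w).
  have y0 := sqnorm_ge0 (walk h j.+1 w).
  (* The triangle inequality in squared form: with this weight the two coefficients of [sqnormD_le]
     become b / a and b / (b - a). *)
  have far : (b - a) ^+ 2 <= sqnorm (D w).
    have l0 : 0 < (b - a) / a by rewrite divr_gt0 ?subr_gt0.
    have := sqnormD_le (walk h j w) (D w) l0; rewrite -WE => hh.
    have {hh xb} := le_trans xb hh.
    have -> : 1 + (b - a) / a = b / a by field; exact: lt0r_neq0.
    have -> : 1 + ((b - a) / a)^-1 = b / (b - a) by field; rewrite !gt_eqF ?subr_gt0.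
    move=> hh; have h1 : b / a * sqnorm (walk h j w) <= b / a * a ^+ 2.
      by rewrite ler_wpM2l ?ltW ?divr_gt0.
    have : b * (b - a) <= b / (b - a) * sqnorm (D w).
      rewrite (_ : b / a * a ^+ 2 = b * a) in h1; last by field; exact: lt0r_neq0.
      lra.
    by rewrite -!mulrA ler_pM2l// ler_pdivlMl ?subr_gt0.
  have near_ : sqnorm (walk h j.+1 w) <= 2 * a ^+ 2 + 2 * sqnorm (D w).
    have := sqnormD_le (walk h j w) (D w) (@ltr01 R); rewrite -WE invr1; lra.
  rewrite gauss_exp3E ?ltr_wpDr//.
  apply: (@le_trans _ _ ((Num.sqrt c)^-1 / c * expR (sqnorm (walk h j.+1 w) / (2 * c)))).
    apply: ler_pM; rewrite ?expR_ge0//.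
    - by rewrite divr_ge0 ?invr_ge0 ?sqrtr_ge0// addr_ge0// ltW.
    - apply: ler_pM; rewrite ?invr_ge0 ?sqrtr_ge0 ?addr_ge0 ?(ltW c0)//.
        by rewrite lef_pV2 ?posrE ?sqrtr_gt0 ?ltr_wpDr// ler_wsqrtr// lerDl.
      by rewrite lef_pV2 ?posrE ?ltr_wpDr// lerDl.
    - rewrite ler_expR ler_wpM2l// lef_pV2 ?posrE ?mulr_gt0 ?ltr_wpDr//.
      by rewrite ler_pM2l// lerDl.
  rewrite /C -!mulrA ler_wpM2l ?invr_ge0 ?sqrtr_ge0// ler_wpM2l ?invr_ge0 ?(ltW c0)//.
  rewrite -!expRD ler_expR.
  have cV : c^-1 <= (8 * h)^-1 by rewrite lef_pV2 ?posrE ?mulr_gt0//; lra.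
  have e1 : sqnorm (walk h j.+1 w) / (2 * c) <= a ^+ 2 / c + sqnorm (D w) / c.
    have -> : a ^+ 2 / c + sqnorm (D w) / c = (2 * a ^+ 2 + 2 * sqnorm (D w)) / (2 * c).
      by field; exact: lt0r_neq0.
    by rewrite ler_wpM2r// invr_ge0 ltW// mulr_gt0.
  have e2 : sqnorm (D w) / c <= sqnorm (D w) / (8 * h) by rewrite ler_wpM2l.
  have e3 : (b - a) ^+ 2 / (4 * h) <= sqnorm (D w) / (4 * h).
    by rewrite ler_wpM2r// invr_ge0 ltW// mulr_gt0.
  have e4 : sqnorm (D w) * (3 / (8 * h)) = sqnorm (D w) / (8 * h) + sqnorm (D w) / (4 * h).
    by field; exact: lt0r_neq0.
  lra.
have mD i : measurable_fun setT (fun w => D w i).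
  by apply: measurable_funB; exact: measurable_walk.
have expE w : expR (sqnorm (D w) * (3 / (8 * h))) = Num.sqrt s * s * gauss_exp3 s (fun i => 0 + D w i).
  have -> : (fun i => 0 + D w i) = D w by apply/funext => i; rewrite add0r.
  have r0 : Num.sqrt s != 0 by rewrite gt_eqF// sqrtr_gt0.
  have -> : sqnorm (D w) * (3 / (8 * h)) = sqnorm (D w) / (2 * s).
    by rewrite /s; field; exact: lt0r_neq0.
  rewrite gauss_exp3E//; move: (expR _) (Num.sqrt s) r0 => e r r0.
  by field; rewrite r0 lt0r_neq0.
pose M := C * (Num.sqrt s * s).
have M0 : 0 <= M by rewrite mulr_ge0// mulr_ge0 ?sqrtr_ge0// ltW.
have mG : measurable_fun setT (fun w => (gauss_exp3 s (fun i => 0 + D w i))%:E).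
  by apply/measurable_EFinP; apply: measurable_gauss_exp3 => i; exact: measurable_funD.
have iG : (\int[P]_w (gauss_exp3 s (fun i => 0 + D w i))%:E = (gauss_exp3 (s - h) (fun=> 0))%:E)%E.
  have jh0 : 0 <= j%:R * h by rewrite mulr_ge0.
  have hs : 0 < h < s by rewrite h0 /s; lra.
  rewrite -(expectation_gauss_exp3 (fun=> 0) jh0 hs); apply: eq_integral => w _.
  congr (gauss_exp3 _ _)%:E; apply/funext => i.
  by rewrite /D /walk -natr1 mulrDl mul1r.
apply: (@le_trans _ _ (\int[P]_(w in A) (M%:E * (gauss_exp3 s (fun i => (0 + D w i)%R))%:E)))%E.
  apply: ge0_le_integral => //.
  - by move=> w _; rewrite lee_fin gauss_exp3_ge0.
  - apply/measurable_EFinP; apply: measurable_funTS.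
    by apply: measurable_gauss_exp3 => i; exact: measurable_walk.
  - by apply: measurable_funTS; apply: emeasurable_funM => //; exact: measurable_cst.
  - by move=> w Aw; rewrite -EFinM lee_fin /M -mulrA -expE; exact: bound.
apply: (@le_trans _ _ (\int[P]_w (M%:E * (gauss_exp3 s (fun i => (0 + D w i)%R))%:E)))%E.
  apply: ge0_subset_integral => //.
  - by apply: emeasurable_funM => //; exact: measurable_cst.
  - by move=> w _; rewrite -EFinM lee_fin mulr_ge0// gauss_exp3_ge0.
rewrite ge0_integralZl//; last by move=> w _; rewrite lee_fin gauss_exp3_ge0.
rewrite iG -EFinM lee_fin gauss_exp3E; last by rewrite /s; lra.
have -> : sqnorm (fun=> 0) = 0 by rewrite /sqnorm big1// => i _; rewrite expr0n.
rewrite mul0r expR0 mulr1 /M /s.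
have -> : 4 / 3 * h - h = h / 3 by field.
have -> : 4 / 3 * h = 4 * (h / 3) by field.
have h3 : 0 < h / 3 by rewrite divr_gt0.
rewrite sqrtrM// (_ : Num.sqrt 4 = 2) /C; last first.
  by rewrite (_ : 4 = 2 ^+ 2) ?sqrtr_sqr ?ger0_norm// -natrX.
have r0 : Num.sqrt (h / 3) != 0 by rewrite gt_eqF// sqrtr_gt0.
rewrite le_eqVlt; apply/orP; left; apply/eqP.
move: (h / 3) h3 r0 (expR _) (expR _) (Num.sqrt c)^-1 => u u0; move: (Num.sqrt u) => v v0 x y z.
by field; rewrite v0 !lt0r_neq0.
Qed.

End gaussian_walk.

(** * First passage times *)

Section passage_times.
Context (R : realType) (T : Type) (X : R -> T -> R) (w : T).
Hypothesis X0 : X 0 w = 0.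
Hypothesis cX : {within `[0%R, +oo[%classic, continuous (fun t => X t w)}.
Implicit Types (a b c r s t h : R).

Lemma first_passage_ge0 a : (0 <= first_passage X a w)%E.
Proof. by apply: le_ereal_inf_tmp => _ [t [t0 _] <-]; rewrite lee_fin. Qed.

Lemma first_passage_le a t : 0 <= a -> 0 <= t -> a <= X t w ->
  (first_passage X a w <= t%:E)%E.
Proof.
move=> a0 t0 at_.
have c0t : {within `[0%R, t]%classic, continuous (fun t => X t w)}.
  by apply: continuous_subspaceW cX => x /=; rewrite !in_itv/= => /andP[-> _].
have ha : Num.min (X 0 w) (X t w) <= a <= Num.max (X 0 w) (X t w).
  by rewrite X0 ge_min a0/= le_max at_ orbT.
have [u /[!in_itv]/= /andP[u0 ut] Xu] := IVT t0 c0t ha.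
apply: (@le_trans _ _ u%:E); last by rewrite lee_fin.
by apply: ereal_inf_lbound; exists u.
Qed.

Lemma first_passage_lt a r : (first_passage X a w < r%:E)%E ->
  exists t, [/\ 0 <= t, t < r & X t w = a].
Proof.
by move=> /ereal_inf_ltP [_ [t [t0 Xt] <-]]; rewrite lte_fin => tr; exists t.
Qed.

Lemma path_near t e : 0 <= t -> 0 < e -> exists2 h : R, 0 < h &
  forall u, 0 <= u -> `|t - u| < h -> `|X t w - X u w| < e.
Proof.
move=> t0 e0; have tI : `[0%R, +oo[%classic t by rewrite /= in_itv/= t0.
have /subspace_continuousP/(_ t tI)/cvgrPdist_lt/(_ e e0) := cX.
rewrite near_withinE => -[h /= h0 hh]; exists h => // u u0 tu.
by apply: hh => //; rewrite /= in_itv/= u0.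
Qed.

(** The last grid point before [t] is within one mesh of [t], and by continuity the path is still
    above [a] there. *)
Lemma passage_grid a t : 0 <= t -> a < X t w ->
  \forall n \near \oo, exists j : nat,
    j%:R * n.+1%:R^-1 <= t /\ a < X (j%:R * n.+1%:R^-1) w.
Proof.
move=> t0 at_; have d0 : 0 < X t w - a by rewrite subr_gt0.
have [e e0 he] := path_near t0 d0.
near=> n.
pose h : R := n.+1%:R^-1.
have h0 : 0 < h by rewrite invr_gt0.
have he' : h < e.
  rewrite /h {h h0}; near: n; exact: (cvgr_lt _ (@cvg_harmonic R) _ e0).
exists (Num.truncn (t / h)).
have th0 : 0 <= t / h by rewrite divr_ge0// ltW.
have le1 : (Num.truncn (t / h))%:R * h <= t by rewrite -ler_pdivlMr// truncn_le.
split => //; have : `|X t w - X ((Num.truncn (t / h))%:R * h) w| < X t w - a.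
  apply: he; first by rewrite mulr_ge0// ltW.
  rewrite ger0_norm ?subr_ge0// (lt_trans _ he')// ltrBlDl.
  by rewrite -[X in _ + X]mul1r -mulrDl natr1 -ltr_pdivrMr// truncnS_gt.
by move=> /ltr_normlW; rewrite /h; lra.
Unshelve. all: by end_near. Qed.

(** A countable description of the event, for measurability. On the compact interval [0, r] the path
    attains its maximum, so staying below [a] leaves a margin, and the margin can be tested on
    rational grids. *)
Lemma first_passage_gtP a r : 0 < a -> 0 <= r ->
  (r%:E < first_passage X a w)%E <->
  exists k : nat, forall n j : nat, j%:R * n.+1%:R^-1 <= r ->
    X (j%:R * n.+1%:R^-1) w <= a - k.+1%:R^-1.
Proof.
move=> a0 r0; split.
  move=> ra; have cr : {within `[0%R, r]%classic, continuous (fun t => X t w)}.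
    by apply: continuous_subspaceW cX => x /=; rewrite !in_itv/= => /andP[-> _].
  have [c /[!in_itv]/= /andP[c0 cr'] hc] := EVT_max r0 cr.
  have ca : X c w < a.
    rewrite ltNge; apply/negP => ac.
    have := lt_le_trans ra (first_passage_le (ltW a0) c0 ac).
    by rewrite lte_fin ltNge cr'.
  have d0 : 0 < a - X c w by rewrite subr_gt0.
  have [k _ hk] := cvgr_lt _ (@cvg_harmonic R) _ d0.
  exists k => n j jr; have := hk k (leqnn k); rewrite /harmonic/= => h.
  have : X (j%:R * n.+1%:R^-1) w <= X c w.
    by apply: hc; rewrite in_itv/= jr andbT mulr_ge0// invr_ge0.
  by move=> /le_trans; apply; rewrite lerBrDl -lerBrDr ltW.
move=> [k hk]; rewrite ltNge; apply/negP => ar.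
have k0 : 0 < (k.+1%:R : R)^-1 by rewrite invr_gt0.
have lek t : 0 <= t -> t <= r -> X t w <= a - k.+1%:R^-1.
  move=> t0 tr; rewrite leNgt; apply/negP => /(passage_grid t0)[n _ /(_ n (leqnn n)) [j [jt]]].
  by rewrite ltNge hk// (le_trans jt).
move: (k.+1%:R^-1) k0 lek => e k0 lek.
(* The infimum could still equal [r], approached from the right; the margin at [r] keeps the path
   below [a] on a further interval of length [h]. *)
have [h h0 hh] := path_near r0 k0.
have : (first_passage X a w < (r + h)%:E)%E.
  by rewrite (le_lt_trans ar)// lte_fin ltrDl.
move=> /first_passage_lt [t [t0 th ta]].
have [tr|rt] := leP t r; first by have := lek _ t0 tr; rewrite ta; lra.
have : `|X r w - X t w| < e.
  by apply: hh => //; rewrite distrC ger0_norm ?subr_ge0 ?(ltW rt)// ltrBlDl.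
have := lek _ r0 (lexx r); rewrite ta distrC => h1 /ltr_normlW; lra.
Qed.

End passage_times.

Lemma measurable_first_passage (R : realType) d (T : measurableType d)
    (X : R -> T -> R) a : 0 < a ->
  (forall t, 0 <= t -> measurable_fun setT (X t)) ->
  (forall w, X 0 w = 0) ->
  (forall w, {within `[0%R, +oo[%classic, continuous (fun t => X t w)}) ->
  measurable_fun setT (first_passage X a).
Proof.
move=> a0 mX X0 cX mT.
apply: (measurability _ (ErealGenOInfty.measurableE R)) => // _ [_ [r ->] <-].
rewrite setTI; have [r0|r0] := leP 0 r; last first.
  rewrite (_ : _ @^-1` _ = setT)//; apply/seteqP; split => // w _ /=.
  by rewrite in_itv/= andbT (lt_le_trans _ (first_passage_ge0 X w a))// lte_fin.
have -> : first_passage X a @^-1` `]r%:E, +oo[%classic =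
    \bigcup_(k in [set: nat]) \bigcap_(n in [set: nat])
      \bigcap_(j in [set j : nat | j%:R * n.+1%:R^-1 <= r])
        (X (j%:R * n.+1%:R^-1) @^-1` `]-oo, (a - k.+1%:R^-1)]%classic).
  apply/seteqP; split => w /=.
    rewrite in_itv/= andbT => /(first_passage_gtP (X0 w) (cX w) a0 r0)[k hk].
    by exists k => // n _ j /= jr; rewrite in_itv/=; exact: hk.
  move=> [k _ hk]; rewrite in_itv/= andbT.
  apply/(first_passage_gtP (X0 w) (cX w) a0 r0); exists k => n j jr.
  by have := hk n I j jr; rewrite /= in_itv.
apply: bigcupT_measurable => k; apply: bigcapT_measurable => n.
apply: bigcap_measurable; first by exists 0%N; rewrite /= mul0r.
by move=> j _; rewrite -[X in measurable X]setTI; apply: mX.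
Qed.

Lemma fatou_le (R : realType) d (T : measurableType d) (mu : {measure set T -> \bar R})
    (f : T -> \bar R) (g : nat -> T -> \bar R) (C : \bar R) :
  measurable_fun setT f -> (forall n, measurable_fun setT (g n)) ->
  (forall w, 0 <= f w)%E -> (forall n w, 0 <= g n w)%E ->
  (forall w, \forall n \near \oo, (f w <= g n w)%E) ->
  (forall n, \int[mu]_w g n w <= C)%E -> (\int[mu]_w f w <= C)%E.
Proof.
move=> mf mg f0 g0 fg gC.
apply: (@le_trans _ _ (\int[mu]_w limn_einf (g^~ w))%E).
  apply: ge0_le_integral => //.
  - apply: measurableT_comp => //.
    apply: (@measurable_fun_limn_esup _ _ _ _ (fun n w => - g n w)%E) => n.
    exact: measurableT_comp.
  - move=> w _; rewrite limn_einf_lim; apply: lime_ge; first exact: is_cvg_einfs.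
    have [N _ hN] := fg w; exists N => // n /= Nn.
    by apply: le_ereal_inf_tmp => _ [k /= nk <-]; apply: hN => /=; exact: leq_trans nk.
apply: le_trans (fatou _ _ _ _) _ => //.
rewrite limn_einf_lim; apply: lime_le; first exact: is_cvg_einfs.
apply: nearW => n; apply: le_trans (gC n); apply: ereal_inf_lbound.
by exists n => /=.
Qed.

Lemma ge0_integral_layers (R : realType) d (T : measurableType d)
    (mu : {measure set T -> \bar R}) (E : nat -> set T) (G : T -> \bar R) K :
  (forall j, measurable (E j)) -> (forall j, E j.+1 `<=` E j) ->
  measurable_fun setT G -> (forall w, 0 <= G w)%E ->
  (\sum_(j < K) \int[mu]_(w in E j `\` E j.+1) G w <= \int[mu]_w G w)%E.
Proof.
move=> mE nE mG G0.
have layers : (\sum_(j < K) \int[mu]_(w in E j `\` E j.+1) G w + \int[mu]_(w in E K) G w =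
    \int[mu]_(w in E 0%N) G w)%E.
  elim: K => [|K <-]; first by rewrite big_ord0 add0e.
  rewrite big_ord_recr/= -addeA; congr (_ + _)%E.
  rewrite -[in RHS](setDUK (nE K)) setUC ge0_integral_setU//.
  - exact: measurableD.
  - exact: measurable_funTS.
  - by rewrite disj_set2E setDE -setIA setICl setI0.
apply: (@le_trans _ _ (\int[mu]_(w in E 0%N) G w)%E).
  by rewrite -layers leeDl// integral_ge0.
exact: ge0_subset_integral.
Qed.

(** * The kernel identity for the Bessel passage time *)

Section passage_law.
Context (R : realType) d (T : measurableType d) (P : probability T R).
Context (B : 'I_3 -> R -> T -> R).
Hypothesis hB : standard_brownian_motion P B.
Implicit Types (a b c r s t h : R).

Lemma bessel3_sqr t w : bessel3 B t w ^+ 2 = sqnorm (fun i => B i t w).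
Proof. by rewrite /bessel3 sqr_sqrtr// sqnorm_ge0. Qed.

Lemma bessel3_ge0 t w : 0 <= bessel3 B t w.
Proof. exact: sqrtr_ge0. Qed.

Lemma bessel3_0 w : bessel3 B 0 w = 0.
Proof.
case: hB => _ B0 _ _ _; rewrite /bessel3 big1 ?sqrtr0// => i _.
by rewrite B0 expr0n.
Qed.

Lemma measurable_bessel3 t : 0 <= t -> measurable_fun setT (bessel3 B t).
Proof.
move=> t0; case: hB => mB _ _ _ _.
have mS : measurable_fun setT (fun w => sqnorm (fun i => B i t w)).
  by apply: measurable_sqnorm => i; exact: mB.
have := measurableT_comp (continuous_measurable_fun (@sqrt_continuous R)) mS.
exact.
Qed.

Lemma continuous_bessel3 w :
  {within `[0%R, +oo[%classic, continuous (fun t => bessel3 B t w)}.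
Proof.
case: hB => _ _ cB _ _; apply/subspace_continuousP => t tI.
have cBi i : B i x w @[x --> within `[0%R, +oo[%classic (nbhs t)] --> B i t w.
  by move/subspace_continuousP : (cB i w); exact.
apply: continuous_cvg; first exact: sqrt_continuous.
rewrite !big_ord_recl big_ord0.
under eq_fun do rewrite !big_ord_recl big_ord0.
have cs i : B i x w ^+ 2 @[x --> within `[0%R, +oo[%classic (nbhs t)] --> B i t w ^+ 2.
  by rewrite expr2; under eq_fun do rewrite expr2; apply: cvgM; exact: cBi.
by apply: cvgD => //; apply: cvgD => //; apply: cvgD => //; exact: cvg_cst.
Qed.

Let S a := first_passage (bessel3 B) a.

Lemma measurable_bessel3_passage a : 0 < a -> measurable_fun setT (S a).
Proof.
move=> a0; apply: measurable_first_passage => //.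
- exact: measurable_bessel3.
- exact: bessel3_0.
- exact: continuous_bessel3.
Qed.

Lemma bessel3_passage_ge0 a w : (0 <= S a w)%E.
Proof. exact: first_passage_ge0. Qed.

Let walkE h j w : sqnorm (walk B h j w) = bessel3 B (j%:R * h) w ^+ 2.
Proof. by rewrite bessel3_sqr. Qed.

Lemma passage_kernel_le a c r s : 0 < c -> r <= s ->
  passage_kernel a c s <= passage_kernel a c r.
Proof.
move=> c0 rs; rewrite /passage_kernel /gauss_exp.
have r0 : 0 < c + Num.max 0 r by rewrite ltr_pwDl// le_max lexx.
have : c + Num.max 0 r <= c + Num.max 0 s by rewrite lerD2l ge_max !le_max lexx rs orbT.
move: (c + Num.max 0 r) (c + Num.max 0 s) r0 => u v u0 uv.
have v0 : 0 < v by exact: lt_le_trans uv.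
apply: ler_pM; rewrite ?invr_ge0 ?(ltW v0)// ?lef_pV2//.
apply: ler_pM; rewrite ?expR_ge0 ?invr_ge0 ?sqrtr_ge0//.
  by rewrite lef_pV2 ?posrE ?sqrtr_gt0// ler_wsqrtr.
by rewrite ler_expR ler_wpM2l ?sqr_ge0// lef_pV2 ?posrE ?mulr_gt0// ler_pM2l.
Qed.

(** The price of moving between two radii; the factor does not depend on [r] and tends to 1 as [b]
    tends to [a]. *)
Lemma passage_kernel_radius a b c r : 0 < a <= b -> 0 < c ->
  passage_kernel b c r <= expR ((b ^+ 2 - a ^+ 2) / (2 * c)) * passage_kernel a c r.
Proof.
move=> /andP[a0 ab] c0; rewrite /passage_kernel /gauss_exp.
have r0 : c <= c + Num.max 0 r by rewrite lerDl le_max lexx.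
move: (c + Num.max 0 r) r0 => u cu; have u0 : 0 < u by exact: lt_le_trans cu.
rewrite mulrA ler_wpM2r ?invr_ge0 ?(ltW u0)// mulrCA ler_wpM2l ?invr_ge0 ?sqrtr_ge0//.
rewrite -expRD ler_expR -lerBlDr -mulrBl ler_wpM2l//.
  by rewrite subr_ge0 ler_pXn2r// nnegrE ltW// (lt_le_trans a0).
by rewrite lef_pV2 ?posrE ?mulr_gt0// ler_pM2l.
Qed.


Let mWalk h j : 0 <= h -> measurable_fun setT (fun w => sqnorm (walk B h j w)).
Proof. by move=> h0; apply: measurable_sqnorm => i; exact: (measurable_walk hB). Qed.

Let mF c h j : 0 <= h ->
  measurable_fun setT (fun w => (gauss_exp3 c (walk B h j w))%:E).
Proof.
move=> h0; apply/measurable_EFinP; apply: measurable_gauss_exp3 => i.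
exact: (measurable_walk hB).
Qed.

Let layer h a j : set T := alive (walk B h) a j `\` alive (walk B h) a j.+1.

Let mlayer h a j : 0 <= h -> measurable (layer h a j).
Proof. by move=> h0; apply: measurableD; exact: (measurable_alive_walk hB). Qed.

Let layer_sqnorm h a j w : layer h a j w -> a ^+ 2 <= sqnorm (walk B h j.+1 w).
Proof.
move=> [al nal]; rewrite leNgt; apply/negP => lt_a; apply: nal => m.
by rewrite leq_eqVlt => /predU1P[->//|]; exact: al.
Qed.

(** Soon after [S b] the path has been strictly outside radius [a], which every fine enough grid
    notices, so the grid exit from radius [a] occurs before [S b + e]. The kernel decreases in time,
    and at a grid exit it is at most [F], whose stopped sum is known. Fatou concludes. *)
Lemma passage_kernel_upper a b c : 0 < a -> a < b -> 0 < c ->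
  forall e, 0 < e ->
  (\int[P]_w (fin_ext (passage_kernel a (c + e)) (S b w))%:E <= (gauss_exp c 0 / c)%:E)%E.
Proof.
move=> a0 ab c0 e e0; have b0 : 0 < b by exact: lt_trans ab.
pose h (n : nat) : R := n.+1%:R^-1.
(* Steps of length 1 / (n + 1) reach time n + 1, which eventually passes any given passage time. *)
pose K (n : nat) := (n.+1 * n.+1)%N.
have h0 n : 0 < h n by rewrite invr_gt0.
pose g n w := (\sum_(j < K n) ((passage_kernel a c (j.+1%:R * h n))%:E * (\1_(layer (h n) a j) w)%:E))%E.
have i0 (A : set T) w : 0 <= \1_A w :> R by rewrite indicE.
have ce : 0 < c + e by exact: addr_gt0.
have mt n j : measurable_fun setT (fun w => ((passage_kernel a c (j.+1%:R * h n))%:E * (\1_(layer (h n) a j) w)%:E)%E).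
  apply: emeasurable_funM; first exact: measurable_cst.
  by apply/measurable_EFinP; apply: measurable_indic; apply: mlayer; exact: ltW.
have t0 n j w : (0 <= (passage_kernel a c (j.+1%:R * h n))%:E * (\1_(layer (h n) a j) w)%:E)%E.
  by rewrite mule_ge0 ?lee_fin ?passage_kernel_ge0.
apply: (@fatou_le _ _ _ _ _ g).
- apply/measurable_EFinP.
  exact: (measurableT_comp (measurable_fin_ext (measurable_passage_kernel a ce)) (measurable_bessel3_passage b0)).
- by move=> n; apply: emeasurable_sum.
- move=> w; rewrite lee_fin; case: (S b w) => [r||]//=; exact: passage_kernel_ge0.
- by move=> n w; apply: sume_ge0.
- move=> w; have [Sfin|] := boolP (S b w \is a fin_num); last first.
    have := bessel3_passage_ge0 b w; case: (S b w) => [r||]//= _ _.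
    by apply: nearW => n; exact: sume_ge0.
  have : (S b w < (fine (S b w) + e)%:E)%E by rewrite EFinD fineK// lteDl// lte_fin.
  move=> Se; have [t [t0' te Nt]] := @first_passage_lt R T (bessel3 B) w b _ Se.
  have aN : a < bessel3 B t w by rewrite Nt.
  have grid := passage_grid (continuous_bessel3 (w := w)) t0' aN.
  near=> n.
  have [j [jt aj]] : exists j : nat, j%:R * n.+1%:R^-1 <= t /\ a < bessel3 B (j%:R * n.+1%:R^-1) w.
    by near: n; exact: grid.
  have tn : t < n.+1%:R.
    near: n; exists (Num.truncn t) => // m /= tm.
    by rewrite (lt_le_trans (truncnS_gt _))// ler_nat ltnS.
  have dead : ~ alive (walk B (h n)) a j w.
    move=> /(_ j (leqnn j)); rewrite walkE ltNge => /negP; apply.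
    by rewrite ler_pXn2r ?nnegrE ?(ltW a0) ?bessel3_ge0// ltW.
  have [i ij [ai nai]] : exists2 i, (i < j)%N & layer (h n) a i w.
    elim: j dead {jt aj} => [|j IHj] dead.
      case: dead => m; rewrite leqn0 => /eqP ->.
      by rewrite walkE mul0r bessel3_0 expr0n exprn_gt0.
    have [al|/IHj[i ij li]] := pselect (alive (walk B (h n)) a j w).
      by exists j.
    by exists i => //; exact: ltnW.
  have it : i.+1%:R * h n <= t by rewrite (le_trans _ jt)// ler_pM2r// ler_nat.
  have iK : (i < K n)%N.
    rewrite -(@ltr_nat R) /K natrM -ltr_pdivrMr//.
    by rewrite (le_lt_trans _ tn)// (le_trans _ it)// ler_pM2r// ler_nat.
  rewrite /g (bigD1 (Ordinal iK))//= -[leLHS]adde0 leeD//; last by apply: sume_ge0.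
  have -> : \1_(layer (h n) a i) w = 1 :> R by rewrite indicE mem_set.
  rewrite mule1 lee_fin.
  have := bessel3_passage_ge0 b w; move: Sfin te; case: (S b w) => [r||]//= _ te r0.
  rewrite lee_fin in r0; apply: (@le_trans _ _ (passage_kernel a c (r + e))).
    by rewrite !passage_kernelE ?addr_ge0 ?(ltW e0)// addrAC addrA.
  by apply: passage_kernel_le => //; rewrite (le_trans it)// ltW.
- move=> n; rewrite /g ge0_integral_sum//.
  have h00 := ltW (h0 n).
  rewrite (walk_sum hB (K n) (h0 n) a0 c0).
  apply: (@le_trans _ _ (\sum_(j < K n) \int[P]_(w in layer (h n) a j)
     (gauss_exp3 (c + j.+1%:R * h n) (walk B (h n) j.+1 w))%:E)%E); last first.
    by rewrite leeDl// integral_ge0// => w _; rewrite lee_fin gauss_exp3_ge0.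
  apply: lee_sum => j _.
  under eq_integral do rewrite -EFinM.
  rewrite integral_mul_indic; apply: ge0_le_integral.
  + exact: mlayer.
  + by move=> w _; rewrite lee_fin passage_kernel_ge0.
  + exact: measurable_cst.
  + by apply: measurable_funTS; exact: mF.
  + move=> w /layer_sqnorm aw; rewrite lee_fin.
    have jh : 0 <= j.+1%:R * h n by rewrite mulr_ge0.
    rewrite passage_kernelE// gauss_exp3E ?ltr_wpDr// /gauss_exp mulrAC.
    rewrite ler_wpM2l//; last by rewrite ler_expR ler_wpM2r// invr_ge0 mulr_ge0// addr_ge0// ltW.
    by rewrite divr_ge0 ?invr_ge0 ?sqrtr_ge0// addr_ge0// ltW.
Unshelve. all: by end_near. Qed.

(** With mesh 1 / N there are N^2 possible exit steps, each with an overshoot term of order exp(- y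
    N), and their sum must vanish. The cube of exp(u) >= u at u = y N / 3 gives the constant 27. *)
Let exp_decay (y N : R) : 0 < y -> 0 < N ->
  N * N * expR (- (y * N)) <= 27 / y ^+ 3 / N.
Proof.
move=> y0 N0; have u0 : 0 < y * N / 3 by rewrite divr_gt0// mulr_gt0.
have h : (y * N / 3) ^+ 3 <= expR (y * N).
  have -> : expR (y * N) = expR (y * N / 3) ^+ 3 by rewrite -expRM_natl; congr expR; field.
  rewrite lerXn2r ?nnegrE ?expR_ge0 ?(ltW u0)//.
  by rewrite (le_trans _ (expR_ge1Dx _))// lerDr.
have -> : 27 / y ^+ 3 / N = N * N * ((y * N / 3) ^+ 3)^-1.
  by field; rewrite !gt_eqF.
rewrite expRN ler_wpM2l ?mulr_ge0 ?(ltW N0)//.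
by rewrite lef_pV2 ?posrE ?expR_gt0// exprn_gt0.
Qed.

(** Three kinds of contributions to [walk_sum]. An exit landing within radius [b] has [F] at most
    the kernel of radius [b] at the exit time; since [S a] comes no later, changing radius and time
    bounds this by the kernel at [S a]. Exits beyond [b] are overshoots, and survivors at time n + 1
    have small [F]; both vanish as the mesh shrinks. *)
Lemma passage_kernel_lower a b c : 0 < a -> a < b -> 0 < c ->
  ((gauss_exp c 0 / c)%:E <= (expR ((b ^+ 2 - a ^+ 2) / (2 * c)))%:E *
    \int[P]_w (fin_ext (passage_kernel a c) (S a w))%:E)%E.
Proof.
move=> a0 ab c0; have b0 : 0 < b by exact: lt_trans ab.
set I := (\int[P]_w _)%E; set EE := expR _.
have c00 := ltW c0.
pose h (n : nat) : R := n.+1%:R^-1.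
pose K (n : nat) := (n.+1 * n.+1)%N.
have h0 n : 0 < h n by rewrite invr_gt0.
pose M1 : R := 8 * ((Num.sqrt c)^-1 / c) * expR (a ^+ 2 / c).
pose M2 : R := (Num.sqrt c)^-1 * expR (a ^+ 2 / (2 * c)).
have M10 : 0 <= M1 by rewrite !mulr_ge0 ?expR_ge0 ?invr_ge0 ?sqrtr_ge0.
have M20 : 0 <= M2 by rewrite !mulr_ge0 ?expR_ge0 ?invr_ge0 ?sqrtr_ge0.
pose y : R := (b - a) ^+ 2 / 4.
have y0 : 0 < y by rewrite divr_gt0// exprn_gt0// subr_gt0.
(* [M1] collects the overshoots, through [exp_decay], and [M2] the survivors, for whom the factor 1
   / (c + n + 1) of [F] is at most 1 / (n + 1). *)
pose M : R := M1 * (27 / y ^+ 3) + M2.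
have mG : measurable_fun setT (fun w => (fin_ext (passage_kernel a c) (S a w))%:E).
  apply/measurable_EFinP.
  exact: (measurableT_comp (measurable_fin_ext (measurable_passage_kernel a c0)) (measurable_bessel3_passage a0)).
have G0 w : 0 <= fin_ext (passage_kernel a c) (S a w).
  by case: (S a w) => [r||]//=; exact: passage_kernel_ge0.
have EE0 : 0 <= EE by exact: expR_ge0.
have key n : h n <= c / 8 -> ((gauss_exp c 0 / c)%:E <= EE%:E * I + (M / n.+1%:R)%:E)%E.
  move=> hc; have h00 := ltW (h0 n).
  rewrite (walk_sum hB (K n) (h0 n) a0 c0).
  have -> : (M / n.+1%:R = (27 / y ^+ 3 / n.+1%:R) * M1 + M2 / n.+1%:R)%R by rewrite /M; ring.
  rewrite EFinD [leRHS]addeA; apply: leeD; last first.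
    have kh : (K n)%:R * h n = n.+1%:R by rewrite /K natrM mulfK.
    have kc : 0 < c + (K n)%:R * h n by rewrite ltr_pwDl// kh.
    apply: (@le_trans _ _ (\int[P]_(w in alive (walk B (h n)) a (K n)) (M2 / n.+1%:R)%:E)%E).
      apply: ge0_le_integral => //.
      - exact: (measurable_alive_walk hB).
      - by move=> w _; rewrite lee_fin gauss_exp3_ge0.
      - by apply: measurable_funTS; exact: mF.
      - move=> w /(_ _ (leqnn _)) wa; rewrite lee_fin gauss_exp3E//.
        rewrite /M2 mulrAC; apply: ler_pM; rewrite ?expR_ge0 ?invr_ge0 ?(ltW kc)//.
        + apply: ler_pM; rewrite ?invr_ge0 ?sqrtr_ge0 ?expR_ge0//.
            by rewrite lef_pV2 ?posrE ?sqrtr_gt0// ler_wsqrtr// lerDl kh.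
          rewrite ler_expR; apply: ler_pM; rewrite ?sqnorm_ge0 ?(ltW wa)// ?invr_ge0 ?mulr_ge0 ?(ltW kc)//.
          by rewrite lef_pV2 ?posrE ?mulr_gt0// ler_pM2l// lerDl kh.
        + by rewrite lef_pV2 ?posrE// kh lerDr.
    rewrite integral_cst; last exact: (measurable_alive_walk hB).
    rewrite -[leRHS]mule1; apply: lee_wpmul2l; first by rewrite lee_fin divr_ge0.
    by apply: probability_le1; exact: (measurable_alive_walk hB).
  pose far j := layer (h n) a j `&` [set w | b ^+ 2 <= sqnorm (walk B (h n) j.+1 w)].
  pose near_ j := layer (h n) a j `&` [set w | sqnorm (walk B (h n) j.+1 w) < b ^+ 2].
  have mset j : measurable [set w | b ^+ 2 <= sqnorm (walk B (h n) j.+1 w)].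
    rewrite -[X in measurable X]setTI.
    have -> : [set w | b ^+ 2 <= sqnorm (walk B (h n) j.+1 w)] =
        (fun w => sqnorm (walk B (h n) j.+1 w)) @^-1` `[b ^+ 2, +oo[%classic.
      by apply/seteqP; split => w /=; rewrite in_itv/= andbT.
    by apply: mWalk => //; exact: measurable_itv.
  have nearE j : near_ j = layer (h n) a j `&` ~` [set w | b ^+ 2 <= sqnorm (walk B (h n) j.+1 w)].
    by rewrite /near_; congr (_ `&` _); apply/seteqP; split => w /=; rewrite ltNge => /negP.
  have mfar j : measurable (far j) by apply: measurableI => //; exact: mlayer.
  have mnear j : measurable (near_ j).
    by rewrite nearE; apply: measurableI; [exact: mlayer|exact: measurableC].
  have farnear j : layer (h n) a j = near_ j `|` far j.
    by rewrite nearE /far -setIUr setUC setUv setIT.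
  have dis j : [disjoint near_ j & far j].
    rewrite disj_set2E nearE /far; apply/eqP; rewrite -subset0 => w /=.
    by move=> [[_ +] [_ +]].
  pose F j w := (gauss_exp3 (c + j.+1%:R * h n) (walk B (h n) j.+1 w))%:E.
  have F0 j w : (0 <= F j w)%E by rewrite lee_fin gauss_exp3_ge0.
  have near_le j : (\int[P]_(w in near_ j) F j w <=
      EE%:E * \int[P]_(w in layer (h n) a j) (fin_ext (passage_kernel a c) (S a w))%:E)%E.
    rewrite -ge0_integralZl//; last 3 first.
    - exact: mlayer.
    - exact: measurable_funTS.
    - by move=> w _; rewrite lee_fin.
    apply: (@le_trans _ _ (\int[P]_(w in near_ j) (EE%:E * (fin_ext (passage_kernel a c) (S a w))%:E))%E); last first.
      apply: ge0_subset_integral => //.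
      - exact: mlayer.
      - by apply: measurable_funTS; apply: emeasurable_funM => //; exact: measurable_cst.
      - by move=> w _; rewrite -EFinM lee_fin mulr_ge0.
      - by move=> w [].
    apply: ge0_le_integral => //.
    - by apply: measurable_funTS; exact: mF.
    - by apply: measurable_funTS; apply: emeasurable_funM => //; exact: measurable_cst.
    - move=> w [lw /= wb]; rewrite -EFinM lee_fin.
      have jh0 : 0 <= j.+1%:R * h n by rewrite mulr_ge0.
      have Sle : (S a w <= (j.+1%:R * h n)%:E)%E.
        apply: first_passage_le => //; [exact: bessel3_0|exact: continuous_bessel3|exact: ltW|].
        have := layer_sqnorm lw; rewrite walkE.
        by rewrite ler_pXn2r// nnegrE ?bessel3_ge0// ltW.
      have := bessel3_passage_ge0 a w; move: Sle; case: (S a w) => [r||]//= rj r0.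
      rewrite lee_fin in rj; rewrite lee_fin in r0.
      apply: (@le_trans _ _ (EE * passage_kernel a c (j.+1%:R * h n))); last first.
        by rewrite ler_wpM2l// passage_kernel_le.
      apply: (@le_trans _ _ (passage_kernel b c (j.+1%:R * h n))); last first.
        by apply: passage_kernel_radius => //; rewrite a0 ltW.
      rewrite passage_kernelE// gauss_exp3E ?ltr_wpDr// /gauss_exp [leRHS]mulrAC.
      rewrite ler_wpM2l ?mulr_ge0 ?invr_ge0 ?sqrtr_ge0 ?addr_ge0//.
      by rewrite ler_expR ler_wpM2r ?(ltW wb)// invr_ge0 mulr_ge0// addr_ge0.
  have far_le j : (\int[P]_(w in far j) F j w <= (M1 * expR (- (y / h n)))%:E)%E.
    apply: le_trans (_ : _ <= \int[P]_(w in alive (walk B (h n)) a j `&` [set w | (b ^+ 2 <= sqnorm (walk B (h n) j.+1 w))%R]) F j w)%E _.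
      apply: ge0_subset_integral => //.
      - by apply: measurableI => //; exact: (measurable_alive_walk hB).
      - by apply: measurable_funTS; exact: mF.
      - by move=> w [[aw _] bw].
    have := walk_overshoot hB j (h0 n) a0 ab hc.
    by rewrite /M1 /y (_ : (b - a) ^+ 2 / 4 / h n = (b - a) ^+ 2 / (4 * h n))// invfM mulrA.
  apply: (@le_trans _ _ (\sum_(j < K n) (EE%:E * \int[P]_(w in layer (h n) a j) (fin_ext (passage_kernel a c) (S a w))%:E + (M1 * expR (- (y / h n)))%:E))%E).
    apply: lee_sum => j _; rewrite -/(layer (h n) a j) [in leLHS]farnear ge0_integral_setU//.
    - exact: leeD (near_le j) (far_le j).
    - by apply: measurable_funTS; exact: mF.
    - by move=> w _; exact: F0.
  rewrite big_split/=; apply: leeD.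
    rewrite -ge0_sume_distrr; last first.
      by move=> j _; apply: integral_ge0 => w _; rewrite lee_fin.
    rewrite lee_wpmul2l ?lee_fin//.
    apply: (@ge0_integral_layers _ _ _ _ (alive (walk B (h n)) a)) => //.
    - by move=> j; exact: (measurable_alive_walk hB).
    - by move=> j; exact: alive_anti.
  rewrite sumEFin lee_fin sumr_const card_ord [leRHS]mulrC -mulrnAr ler_wpM2l//.
  by rewrite -mulr_natl /h invrK natrM exp_decay.
apply/lee_addgt0Pr => e e0.
have c8 : 0 < c / 8 by rewrite divr_gt0.
have Mh : (fun n => M / n.+1%:R) @ \oo --> (0 : R).
  by rewrite -(mulr0 M); apply: cvgMr; exact: cvg_harmonic.
have [N1 _ hN1] := cvgr_le _ Mh _ e0.
have [N2 _ hN2] := cvgr_le _ (@cvg_harmonic R) _ c8.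
pose n := maxn N1 N2.
apply: le_trans (key n (hN2 n (leq_maxr _ _))) _.
by rewrite leeD2l// lee_fin hN1//= leq_maxl.
Qed.

Let le_right_limit (f : R -> R) (x e0 : R) : 0 < e0 -> {for 0, continuous f} ->
  (forall e, 0 < e < e0 -> x <= f e) -> x <= f 0.
Proof.
move=> e00 cf xf; apply: (cvgr_to_ge (cvg_at_right_filter cf)).
near=> e; apply: xf; apply/andP; split.
  by near: e; exact: nbhs_right_gt.
by near: e; exact: nbhs_right_lt.
Unshelve. all: by end_near. Qed.

Let continuous_exp_quad (u c : R) : continuous (fun e : R => expR (((u + e) ^+ 2 - u ^+ 2) / (2 * c))).
Proof.
move=> e; apply: continuous_cvg; first exact: continuous_expR.
apply: cvgMl; apply: cvgB; last exact: cvg_cst.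
by rewrite expr2; under eq_fun do rewrite expr2; apply: cvgM; apply: cvgD;
  [exact: cvg_cst|exact: cvg_id|exact: cvg_cst|exact: cvg_id].
Qed.

(** The upper bound is used with radii a - e < a and initial time c - e, the lower one with radii a
    < a + e. All correction factors are continuous in [e] and equal to 1 at 0. *)
Theorem bessel3_passage_kernel a c : 0 < a -> 0 < c ->
  (\int[P]_w (fin_ext (passage_kernel a c) (S a w))%:E = (gauss_exp c 0 / c)%:E)%E.
Proof.
move=> a0 c0; set I := (\int[P]_w _)%E.
have G0 b t w : 0 < t -> 0 <= fin_ext (passage_kernel b t) (S a w).
  by move=> t0; case: (S a w) => [r||]//=; exact: passage_kernel_ge0.
have mG b t : 0 < t -> measurable_fun setT (fun w => (fin_ext (passage_kernel b t) (S a w))%:E).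
  move=> t0; apply/measurable_EFinP.
  exact: (measurableT_comp (measurable_fin_ext (measurable_passage_kernel b t0)) (measurable_bessel3_passage a0)).
have I0 : (0 <= I)%E by apply: integral_ge0 => w _; rewrite lee_fin G0.
pose g e : R := (Num.sqrt (c - e))^-1 / (c - e).
have gE e : gauss_exp (c - e) 0 / (c - e) = g e.
  by rewrite /gauss_exp expr0n mul0r expR0 mulr1.
have up e : 0 < e < Num.min a c ->
    (I <= (expR ((a ^+ 2 - (a - e) ^+ 2) / (2 * c)) * g e)%:E)%E.
  rewrite lt_min => /andP[e0 /andP[ea ec]].
  have ae0 : 0 < a - e by rewrite subr_gt0.
  have ce0 : 0 < c - e by rewrite subr_gt0.
  have aea : a - e < a by rewrite ltrBlDr ltrDl.
  have := passage_kernel_upper ae0 aea ce0 e0; rewrite subrK gE => h1.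
  rewrite EFinM; apply: le_trans (lee_wpmul2l _ h1); last by rewrite lee_fin expR_ge0.
  rewrite -ge0_integralZl//; last 2 first.
  - exact: mG.
  - by move=> w _; rewrite lee_fin G0.
  apply: ge0_le_integral => //.
  - by move=> w _; rewrite lee_fin G0.
  - exact: mG.
  - by apply: emeasurable_funM; [exact: measurable_cst|exact: mG].
  - move=> w _; rewrite -EFinM lee_fin; case: (S a w) => [r||]/=; rewrite ?mulr0//.
    by apply: passage_kernel_radius => //; rewrite ae0 ltW.
have m0 : 0 < Num.min a c by rewrite lt_min a0.
have Ifin : I \is a fin_num.
  have m2 : 0 < Num.min a c / 2 < Num.min a c by rewrite divr_gt0//= ltr_pdivrMr// ltr_pMr// ltr1n.
  by rewrite ge0_fin_numE// (le_lt_trans (up _ m2))// ltry.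
rewrite -(fineK Ifin); congr EFin; apply/eqP; rewrite eq_le; apply/andP; split.
  pose f e := expR ((a ^+ 2 - (a - e) ^+ 2) / (2 * c)) * g e.
  have -> : gauss_exp c 0 / c = f 0.
    by rewrite /f subr0 subrr mul0r expR0 mul1r -gE subr0.
  apply: (@le_right_limit f _ (Num.min a c)) => //; last first.
    by move=> e he; rewrite -lee_fin fineK// up.
  apply: cvgM.
    apply: continuous_cvg; first exact: continuous_expR.
    apply: cvgMl; apply: cvgB; first exact: cvg_cst.
    rewrite expr2; under eq_fun do rewrite expr2.
    by apply: cvgM; (apply: cvgB; [exact: cvg_cst|exact: cvg_id]).
  have cB : (fun e => c - e) @ (0 : R) --> c - 0 by apply: cvgB; [exact: cvg_cst|exact: cvg_id].
  apply: cvgM; last by apply: cvgV => //; rewrite subr0 gt_eqF.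
  apply: cvgV; first by rewrite subr0 gt_eqF// sqrtr_gt0.
  by apply: continuous_cvg => //; exact: sqrt_continuous.
pose f e := expR (((a + e) ^+ 2 - a ^+ 2) / (2 * c)) * fine I.
have -> : fine I = f 0 by rewrite /f addr0 subrr mul0r expR0 mul1r.
apply: (@le_right_limit f _ 1) => //.
  by apply: cvgMl; exact: continuous_exp_quad.
move=> e /andP[e0 _]; rewrite -lee_fin.
have ae : a < a + e by rewrite ltrDl.
by apply: le_trans (passage_kernel_lower a0 ae c0) _; rewrite [(f e)%:E]EFinM fineK.
Qed.

Theorem bessel3_passage_laplace a k : 0 < a -> 0 < k ->
  (\int[P]_w (fin_ext (fun r => expR (- (k ^+ 2 / 2 * r))) (S a w))%:E =
   (k * a / sinh (k * a))%:E)%E.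
Proof.
move=> a0 k0; apply: passage_inversion => //.
- exact: measurable_bessel3_passage.
- exact: bessel3_passage_ge0.
- by move=> t t0; exact: bessel3_passage_kernel.
Qed.

End passage_law.

(** * Gamma convolutions *)

Section sums_of_independent.
Context (R : realType).
Notation law := (probability (measurableTypeR R) R).

Lemma ge0_integral_law d d' (T : measurableType d) (T' : measurableType d')
    (P : probability T R) (X : T -> T') (nu : probability T' R) (g : T' -> \bar R) :
  has_law P X nu -> measurable_fun setT g -> (forall y, 0 <= g y)%E ->
  (\int[P]_w g (X w) = \int[nu]_y g y)%E.
Proof.
move=> [mX lX] mg g0; rewrite -(ge0_integral_image_prob P mX mg g0).
by apply: eq_measure_integral => A mA _; exact: lX.
Qed.

(** The law of the sum is recognized by its Laplace transform, a product by independence; the sum is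
    almost surely nonnegative because every term is. *)
Lemma sum_law d (T : measurableType d) (P : probability T R) m
    (X : 'I_m -> T -> R) (nu : 'I_m -> law) (mu : law) :
  (forall i, has_law P (X i) (nu i)) -> independent P X ->
  (forall i, nu i `]-oo, 0[%classic = 0%E) -> mu `]-oo, 0[%classic = 0%E ->
  (forall l, 0 <= l -> laplace mu l = (\prod_(i < m) laplace (nu i) l)%E) ->
  has_law P (fun x => \sum_(i < m) X i x) mu.
Proof.
move=> lX iX nu0 mu0 lmu.
have mX i : measurable_fun setT (X i) by exact: (lX i).1.
have mS : measurable_fun setT ((fun x => \sum_(i < m) X i x) : T -> measurableTypeR R).
  by apply: measurable_sum.
split; first exact: mS.
apply: (@laplace_unique _ (image_prob P mS) mu) => //.
- pose E := \bigcap_(i in [set: 'I_m]) (X i @^-1` `[0%R, +oo[%classic).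
  have mE : measurable E.
    by apply: fin_bigcap_measurable => // i _; rewrite -[X in measurable X]setTI; exact: mX.
  have PE : P E = 1%E.
    rewrite /E (iX (fun=> `[0%R, +oo[%classic))//.
    by rewrite big1// => i _; rewrite (lX i).2// half_line_law.
  have PCE : P (~` E) = 0%E by rewrite probability_setC// PE subee.
  apply/eqP; rewrite eq_le measure_ge0 andbT -PCE -[leLHS]/(P _).
  apply: le_measure; rewrite ?inE//.
  - by rewrite -[X in measurable X]setTI; apply: mS => //; exact: measurable_itv.
  - exact: measurableC.
  - move=> x /=; rewrite in_itv/= => S0 Ex; move: S0; rewrite ltNge => /negP; apply.
    by apply: sumr_ge0 => i _; have := Ex i I; rewrite /= in_itv/= andbT.
- move=> l l0; rewrite /laplace.
  rewrite (ge0_integral_image_prob P mS (g := fun y => (expR (- (l * y)))%:E))//; last first.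
    by apply/measurable_EFinP; exact: measurable_expRN.
  have me : measurable_fun setT (fun y : measurableTypeR R => (expR (- (l * y)))%:E).
    by apply/measurable_EFinP; exact: measurable_expRN.
  transitivity (\int[P]_x \prod_(i < m) (expR (- (l * X i x)))%:E)%E.
    apply: eq_integral => x _; rewrite prodEFin -expR_sum; congr (expR _)%:E.
    by rewrite mulr_sumr sumrN.
  have := independent_expectation_prod mX iX (f := fun _ y => (expR (- (l * y)))%:E) _ _.
  move=> -> //; rewrite -/(laplace mu l) lmu//; apply: eq_bigr => i _.
  exact: (@ge0_integral_law _ _ T (measurableTypeR R) P (X i) (nu i)
    (fun y => (expR (- (l * y)))%:E) (lX i) me).
Qed.

End sums_of_independent.

(** * Infinite products and the Thorin measure *)

Section thorin_products.
Context (R : realType).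
Implicit Types (a l x : R).

(** In a list where every entry occurs twice in a row, the first [m] entries make two initial
    segments, of lengths [m./2] and [uphalf m]. *)
Lemma prod_half (q : nat -> R) m :
  \prod_(j < m) q j./2 = (\prod_(k < m./2) q k) * \prod_(k < uphalf m) q k.
Proof.
elim: m => [|m IHm]; first by rewrite !big_ord0 mulr1.
by rewrite big_ord_recr/= IHm [in RHS]big_ord_recr/= -mulrA mulrCA.
Qed.

Lemma half_cvgy : half @ \oo --> \oo.
Proof.
move=> A [N _ hN]; exists N.*2 => // m /= Nm; apply: hN => /=.
by rewrite -(doubleK N) half_leq.
Qed.

Lemma uphalf_cvgy : uphalf @ \oo --> \oo.
Proof.
move=> A [N _ hN]; exists N.*2 => // m /= Nm; apply: hN => /=.
by rewrite -(doubleK N) (leq_trans (half_leq Nm))// uphalf_half leq_addl.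
Qed.

Lemma passage_rate_gt0 a k : 0 < a -> 0 < passage_rate a k.+1.
Proof. by move=> a0; rewrite mulr_gt0 ?divr_gt0 ?exprn_gt0 ?pi_gt0. Qed.

Lemma passage_product a l : 0 < a -> 0 < l ->
  (fun n => \prod_(k < n) (1 + l / passage_rate a k.+1)) @ \oo -->
  sinh (Num.sqrt (2 * l) * a) / (Num.sqrt (2 * l) * a).
Proof.
move=> a0 l0; have l2 : 0 < 2 * l by rewrite mulr_gt0.
have x0 : 0 < Num.sqrt (2 * l) * a by rewrite mulr_gt0// sqrtr_gt0.
have := sinh_product x0; set f := (fun n : nat => _); set g := (fun n : nat => _).
suff -> : f = g by [].
apply/funext => n; apply: eq_bigr => k _; congr (1 + _).
rewrite exprMn sqr_sqrtr ?(ltW l2)// /passage_rate.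
have k0 : k.+1%:R != 0 :> R by [].
have p0 := gt_eqF (pi_gt0 R).
by move: (k.+1%:R) k0 (pi) p0 => K K0 p p0; field; rewrite p0 K0 gt_eqF.
Qed.

Lemma thorin_integral a (D : set R) (g : R -> R) : 0 < a -> measurable D ->
  (forall k, D (passage_rate a k.+1)) -> measurable_fun D g ->
  (forall c, D c -> 0 <= g c) ->
  (\int[passage_thorin_measure a]_(c in D) (g c)%:E =
   2%:E * \sum_(0 <= k <oo) (g (passage_rate a k.+1))%:E)%E.
Proof.
move=> a0 mD Dr mg g0.
have mg' : measurable_fun D (EFin \o g) by apply/measurable_EFinP.
have g0' c : D c -> (0 <= (EFin \o g) c)%E by move=> Dc; rewrite lee_fin g0.
rewrite /passage_thorin_measure ge0_integral_mscale//; congr (_ * _)%E.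
transitivity (\int[mseries (fun k : nat => dirac (passage_rate a k.+1 : measurableTypeR R)) 0]_(c in D) (g c)%:E)%E.
  apply: eq_measure_integral => A mA _; rewrite /mseries.
  apply: etrans (esym (nneseries_addn
    (f := fun k => dirac (passage_rate a k : measurableTypeR R) A) 1 _)) _ => //.
  by apply: eq_eseriesr => k _; rewrite addn1.
rewrite ge0_integral_measure_series//; apply: eq_eseriesr => k _.
by rewrite integral_dirac// diracE mem_set// mul1e.
Qed.

Lemma measurable_inv_pos : measurable_fun (`]0%R, +oo[%classic : set R) (fun c : R => c^-1).
Proof.
apply: open_continuous_measurable_fun; first exact: interval_open.
by move=> c /set_mem/=; rewrite in_itv/= andbT => c0; apply: inv_continuous; rewrite gt_eqF.
Qed.

Lemma thorin_measure_integrable a : 0 < a ->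
  (\int[passage_thorin_measure a]_(c in `[1%R, +oo[%classic) (c^-1)%:E < +oo)%E.
Proof.
move=> a0; apply: (@le_lt_trans _ _ (\int[passage_thorin_measure a]_(c in `]0%R, +oo[%classic) (c^-1)%:E)%E).
  apply: ge0_subset_integral => //.
  - by apply/measurable_EFinP; exact: measurable_inv_pos.
  - by move=> c /=; rewrite in_itv/= andbT => c0; rewrite lee_fin invr_ge0 ltW.
  - by move=> c /=; rewrite !in_itv/= !andbT; exact: lt_le_trans.
rewrite (thorin_integral (g := fun c => c^-1))//; last 3 first.
- by move=> k; rewrite /= in_itv/= andbT passage_rate_gt0.
- exact: measurable_inv_pos.
- by move=> c /=; rewrite in_itv/= andbT => c0; rewrite invr_ge0 ltW.
(* The reciprocal of the k-th rate is (2 a^2 / pi^2) / k^2, and the sum of 1 / k^2 is at most 2 by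
   [sum_inv_sqr_tail] from 0; the leading 2 is the mass of the atoms. *)
apply: (@le_lt_trans _ _ (2%:E * (2 * (2 * a ^+ 2 / pi ^+ 2))%:E)%E); last by rewrite -EFinM ltry.
rewrite lee_wpmul2l//; apply: lime_le.
  by apply: is_cvg_nneseries => k _ _; rewrite lee_fin invr_ge0 ltW// passage_rate_gt0.
apply: nearW => n; rewrite sumEFin lee_fin.
have := @sum_inv_sqr_tail R 0 n (leq0n n); rewrite divr1 => h.
have c0 : 0 <= 2 * a ^+ 2 / pi ^+ 2 :> R by rewrite divr_ge0 ?sqr_ge0// mulr_ge0// sqr_ge0.
apply: le_trans (ler_wpM2r c0 h); rewrite mulr_suml; apply: ler_sum => k _.
rewrite /passage_rate; have k0 : k.+1%:R != 0 :> R by [].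
rewrite le_eqVlt; apply/orP; left; apply/eqP.
have p0 := gt_eqF (pi_gt0 R).
by move: (k.+1%:R) k0 (pi) p0 => K K0 p p0; field; rewrite p0 K0 gt_eqF.
Qed.

Lemma thorin_exponent_passage a l (s : R) : 0 < a -> 0 <= l -> 0 < s ->
  (fun n => \prod_(k < n) (1 + l / passage_rate a k.+1)) @ \oo --> s ->
  thorin_exponent (passage_thorin_measure a) l = (2 * ln s)%:E.
Proof.
move=> a0 l0 s0 cs; rewrite /thorin_exponent (thorin_integral (g := fun c => gamma_exponent c l))//.
- rewrite EFinM; congr (_ * _)%E; apply/cvg_lim => //.
  have E n : (\sum_(0 <= k < n) (gamma_exponent (passage_rate a k.+1) l)%:E =
      (ln (\prod_(k < n) (1 + l / passage_rate a k.+1)))%:E)%E.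
    rewrite sumEFin; congr EFin; rewrite big_mkord /gamma_exponent.
    elim: n => [|n IHn]; first by rewrite !big_ord0 ln1.
    rewrite !big_ord_recr/= IHn lnM// posrE ?prodr_gt0// => [k _|].
      by rewrite ltr_pwDl// divr_ge0// ltW// passage_rate_gt0.
    by rewrite ltr_pwDl// divr_ge0// ltW// passage_rate_gt0.
  under eq_fun do rewrite E.
  apply: cvg_EFin; first exact: nearW.
  by apply: continuous_cvg => //; exact: continuous_ln.
- by move=> k; rewrite /= in_itv/= andbT passage_rate_gt0.
- rewrite /gamma_exponent; apply: (measurableT_comp (f := @ln R)); first exact: measurable_ln.
  apply: measurable_funD => //; by apply: measurable_funM => //; exact: measurable_inv_pos.
- move=> c /=; rewrite in_itv/= andbT => c0.
  by apply: ln_ge0; rewrite lerDl divr_ge0// (ltW c0).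
Qed.

End thorin_products.

Section gamma_convolution_limit.
Context (R : realType) (a : R) (a0 : 0 < a).
Notation law := (probability (measurableTypeR R) R).
Context (mu : law) (s : R -> R).
Hypothesis mu0 : mu `]-oo, 0[%classic = 0%E.
Hypothesis s0 : forall l, 0 <= l -> 0 < s l.
Hypothesis prod_s : forall l, 0 <= l ->
  (fun n => \prod_(k < n) (1 + l / passage_rate a k.+1)) @ \oo --> s l.
Hypothesis laplace_mu : forall l, 0 <= l -> laplace mu l = ((s l)^-1 ^+ 2)%:E.

(* Every rate carries mass 2, so it is listed twice. *)
Let c (j : nat) := passage_rate a j./2.+1.

Let c0 j : 0 < c j. Proof. exact: passage_rate_gt0. Qed.

Let factor_gt0 l j : 0 <= l -> 0 < 1 + l / c j.
Proof. by move=> l0; rewrite ltr_pwDl// divr_ge0// ltW. Qed.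

Let product_cvg l : 0 <= l ->
  (fun m => \prod_(j < m) (1 + l / c j)^-1) @ \oo --> (s l)^-1 ^+ 2.
Proof.
move=> l0.
have -> : (fun m => \prod_(j < m) (1 + l / c j)^-1) = (fun m =>
    ((\prod_(k < m./2) (1 + l / passage_rate a k.+1)) *
      \prod_(k < uphalf m) (1 + l / passage_rate a k.+1))^-1).
  by apply/funext => m; rewrite prodfV (prod_half (fun k => 1 + l / passage_rate a k.+1)).
rewrite exprVn expr2; apply: cvgV; first by rewrite mulf_neq0// gt_eqF// s0.
apply: cvgM.
  exact: (cvg_comp _ _ half_cvgy (prod_s l0)).
exact: (cvg_comp _ _ uphalf_cvgy (prod_s l0)).
Qed.

Lemma gamma_convolution_limit : generalized_gamma_convolution mu.
Proof.
have [nu hnu] := boolp.choice (fun j => gamma1_exists (c0 j)).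
have nu0 j : nu j `]-oo, 0[%classic = 0%E by case: (hnu j).
have lnu j l : 0 <= l -> laplace (nu j) l = ((1 + l / c j)^-1)%:E.
  by case: (hnu j) => _ _; apply.
exists (convolution_seq nu); split.
  move=> m; have [d [T [P [X [lX iX]]]]] := independent_family_exists nu m.
  exists d, T, P, m, X, (fun=> 1), (fun=> 1), (fun i => c i); split => //.
    move=> i; have [mXi lXi] := lX i; split; first exact: mXi.
    by move=> A mA; case: (hnu i) => h _ _; rewrite lXi// h.
  have -> : (fun x => \sum_(i < m) 1 * X i x) = (fun x => \sum_(i < m) X i x).
    by apply/funext => x; apply: eq_bigr => i _; rewrite mul1r.
  apply: (sum_law lX iX) => //; first exact: convolution_seq_nonneg.
  by move=> l _; exact: laplace_convolution_seq.
apply: laplace_continuity => //.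
  by move=> n; exact: convolution_seq_nonneg.
move=> l l0; rewrite laplace_mu//.
have -> : (fun m => laplace (convolution_seq nu m) l) =
    (fun m => (\prod_(j < m) (1 + l / c j)^-1)%:E).
  apply/funext => m; rewrite laplace_convolution_seq -prodEFin.
  by apply: eq_bigr => j _; rewrite lnu.
by apply: cvg_EFin; [exact: nearW|exact: product_cvg].
Qed.

Lemma infinitely_divisible_limit : infinitely_divisible mu.
Proof.
move=> n n0; have nV : (n%:R : R) != 0 by rewrite pnatr_eq0 -lt0n.
have [nu hnu] := boolp.choice (fun j => gamma_root_exists n0 (c0 j)).
have nu0 j : nu j `]-oo, 0[%classic = 0%E by case: (hnu j).
have lnu j l : 0 <= l -> laplace (nu j) l = ((1 + l / c j)^-1 `^ (n%:R^-1))%:E.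
  by case: (hnu j) => _; apply.
pose phi l := ((s l)^-1 ^+ 2) `^ (n%:R^-1).
have powR_cvg (u : nat -> R) (v : R) : (forall k, 0 < u k) -> 0 < v -> u @ \oo --> v ->
    (fun k => u k `^ (n%:R^-1)) @ \oo --> v `^ (n%:R^-1).
  move=> u0 v0 uv; have powE x : 0 < x -> x `^ (n%:R^-1) = expR (n%:R^-1 * ln x) :> R.
    by move=> x0; rewrite /powR gt_eqF.
  rewrite powE//; under eq_fun do rewrite powE//.
  apply: continuous_cvg; first exact: continuous_expR.
  by apply: cvgMr; apply: continuous_cvg => //; exact: continuous_ln.
have phi_gt0 l : 0 <= l -> 0 < (s l)^-1 ^+ 2.
  by move=> l0; rewrite exprn_gt0// invr_gt0 s0.
have prod_gt0 l m : 0 <= l -> 0 < \prod_(j < m) (1 + l / c j)^-1.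
  by move=> l0; apply: prodr_gt0 => j _; rewrite invr_gt0 factor_gt0.
have [mun [mun0 lmun]] : exists mun : law, mun `]-oo, 0[%classic = 0%E /\
    forall l, 0 <= l -> laplace mun l = (phi l)%:E.
  apply: (@laplace_limit_law _ (convolution_seq nu)).
  - by move=> m; exact: convolution_seq_nonneg.
  - by move=> m r; exact: cdf_convolution_le.
  - move=> l l0.
    have -> : (fun m => laplace (convolution_seq nu m) l) =
        (fun m => ((\prod_(j < m) (1 + l / c j)^-1) `^ (n%:R^-1))%:E).
      apply/funext => m; rewrite laplace_convolution_seq.
      elim: m => [|m IHm]; first by rewrite !big_ord0 powR1.
      rewrite !big_ord_recr/= IHm lnu// -EFinM powRM//; first exact/ltW/prod_gt0.
      by rewrite invr_ge0 ltW// factor_gt0.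
    apply: cvg_EFin; first exact: nearW.
    by apply: powR_cvg; [move=> m; exact: prod_gt0|exact: phi_gt0|exact: product_cvg].
  (* Continuity of [phi] at 0 is inherited from the transform of [mu], of which [phi] is the n-th
     root. *)
  - have := powR_cvg (fun k => (s k.+1%:R^-1)^-1 ^+ 2) 1; rewrite powR1; apply => //.
      by move=> k; rewrite phi_gt0// invr_ge0.
    have := laplace_cvg1 mu0; set f := (fun k : nat => _); set g := (fun k : nat => _).
    suff -> : f = g by [].
    apply/funext => k; apply: EFin_inj; rewrite /f /g -laplaceE ?laplace_mu//.
have [d [T [P [X [lX iX]]]]] := independent_family_exists (fun=> mun) n.
exists mun, d, T, P, X; split => //.
apply: (sum_law lX iX) => // l l0.
under eq_bigr do rewrite lmun//.
rewrite prodEFin prodr_const card_ord laplace_mu//; congr EFin.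
have := phi_gt0 l l0; rewrite /phi; move: (_ ^+ 2) => v v0.
by rewrite -powR_mulrn ?powR_ge0// -powRrM mulVf// powRr1// ltW.
Qed.

End gamma_convolution_limit.

Lemma probability_setI_full (R : realType) d (T : measurableType d)
    (P : probability T R) A E :
  measurable A -> measurable E -> P E = 1%E -> P (A `&` E) = P A.
Proof.
move=> mA mE PE; apply/esym; apply: etrans (measureDI P mA mE) _.
rewrite [X in (X + _)%E](_ : _ = 0%E) ?add0e//.
have PCE : P (~` E) = 0%E by rewrite probability_setC// PE subee.
apply/eqP; rewrite eq_le measure_ge0 andbT -PCE; apply: le_measure; rewrite ?inE//.
- exact: measurableD.
- exact: measurableC.
Qed.

(** * The law of the sum of two passage times *)

Section passage_sum.
Context (R : realType) d (T : measurableType d) (P : probability T R).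
Context (B : 'I_3 -> R -> T -> R) (a : R) (S' : T -> \bar R).
Hypothesis hB : standard_brownian_motion P B.
Hypothesis a0 : 0 < a.
Let S := first_passage (bessel3 B) a.
Hypothesis lawS' : has_law P S' (pushforward P S).
Hypothesis indS : independent P (fun b : bool => if b then S' else S).
Let W w := (S w + S' w)%E.

Let mS : measurable_fun setT S.
Proof. exact: (measurable_bessel3_passage hB a0). Qed.

Let mS' : measurable_fun setT S'.
Proof. exact: lawS'.1. Qed.

Let A0 : set (\bar R) := `[0%E, +oo%E[%classic.

Let mA0 : measurable A0. Proof. exact: emeasurable_itv. Qed.

Let G l := fin_ext (fun r : R => expR (- (l * r))).

Let G0 l x : 0 <= G l x.
Proof. by rewrite /G; case: x => [r||]//=; exact: expR_ge0. Qed.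

Let mG l : measurable_fun setT (fun x : \bar R => (G l x)%:E).
Proof. by apply/measurable_EFinP; apply: measurable_fin_ext; exact: measurable_expRN. Qed.

(** The reciprocal of the Laplace transform of [S]; at [l = 0], where the quotient reads 0 / 0, its
    limit 1 is put in. *)
Definition passage_ratio l : R :=
  if l == 0 then 1 else sinh (Num.sqrt (2 * l) * a) / (Num.sqrt (2 * l) * a).

Let x0 l : 0 < l -> 0 < Num.sqrt (2 * l) * a.
Proof. by move=> l0; rewrite mulr_gt0// sqrtr_gt0 mulr_gt0. Qed.

Lemma passage_ratio_gt0 l : 0 <= l -> 0 < passage_ratio l.
Proof.
rewrite le_eqVlt /passage_ratio => /predU1P[<-|l0]; first by rewrite eqxx.
by rewrite gt_eqF// divr_gt0 ?sinh_gt0 ?x0.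
Qed.

Lemma passage_ratio_cvg l : 0 <= l ->
  (fun n => \prod_(k < n) (1 + l / passage_rate a k.+1)) @ \oo --> passage_ratio l.
Proof.
rewrite le_eqVlt /passage_ratio => /predU1P[<-|l0]; last first.
  by rewrite gt_eqF//; exact: passage_product.
rewrite eqxx; have -> : (fun n => \prod_(k < n) (1 + 0 / passage_rate a k.+1)) = cst 1.
  by apply/funext => n; rewrite big1// => k _; rewrite mul0r addr0.
exact: cvg_cst.
Qed.

Let laplaceS l : 0 < l -> (\int[P]_w (G l (S w))%:E = ((passage_ratio l)^-1)%:E)%E.
Proof.
move=> l0; have k0 : 0 < Num.sqrt (2 * l) by rewrite sqrtr_gt0 mulr_gt0.
have := bessel3_passage_laplace hB a0 k0; rewrite sqr_sqrtr; last by rewrite mulr_ge0// ltW.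
rewrite (_ : 2 * l / 2 = l); last by field.
by move=> h; rewrite /passage_ratio gt_eqF// invf_div; exact: h.
Qed.

(** Almost sure finiteness is read off the transform: E exp(- l S) <= P(S < oo), and with x = a
    sqrt(2 l) the transform x / sinh x is at least exp(- x) >= 1 - x, arbitrarily close to 1. *)
Let PS : P (S @^-1` A0) = 1%E.
Proof.
have mSA : measurable (S @^-1` A0) by rewrite -[X in measurable X]setTI; exact: mS.
apply/eqP; rewrite eq_le probability_le1//=; apply/lee_addgt0Pr => e e0.
(* Chosen so that a sqrt(2 l) = e. *)
pose l := (e / a) ^+ 2 / 2.
have ea0 : 0 < e / a by rewrite divr_gt0.
have l0 : 0 < l by rewrite divr_gt0// exprn_gt0.
have xE : Num.sqrt (2 * l) * a = e.
  have -> : 2 * l = (e / a) ^+ 2 by rewrite /l; field; exact: lt0r_neq0.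
  by rewrite sqrtr_sqr gtr0_norm// divfK// gt_eqF.
have ratio : 1 <= (passage_ratio l)^-1 + e.
  rewrite /passage_ratio gt_eqF// xE invf_div.
  have /andP[_ h] := sinh_bounds (ltW e0).
  have : expR (- e) <= e / sinh e.
    rewrite ler_pdivlMr ?sinh_gt0// expRN mulrC ler_pdivrMr ?expR_gt0//.
  have := expR_ge1Dx (- e); lra.
apply: (@le_trans _ _ ((passage_ratio l)^-1 + e)%:E); first by rewrite lee_fin.
rewrite EFinD leeD2r// -laplaceS// -(integral_indicT _ mSA).
apply: ge0_le_integral => //.
- by move=> w _; rewrite lee_fin G0.
- exact: (measurableT_comp (mG l) mS).
- by apply/measurable_EFinP; exact: measurable_indic.
- move=> w _; rewrite lee_fin /G indicE; have := first_passage_ge0 (bessel3 B) w a.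
  rewrite -/(S w); case Sw : (S w) => [r||]//=; rewrite lee_fin => r0.
  rewrite mem_set; last by rewrite /= /A0/= Sw in_itv/= lee_fin r0 ltry.
  by rewrite -expR0 ler_expR lerNl oppr0 mulr_ge0// ltW.
Qed.

Let PS' : P (S' @^-1` A0) = 1%E.
Proof. by rewrite lawS'.2. Qed.

Let E0 := S @^-1` A0 `&` S' @^-1` A0.

Let mE0 : measurable E0.
Proof.
by apply: measurableI; rewrite -[X in measurable X]setTI; [exact: mS|exact: mS'].
Qed.

Let PE0 : P E0 = 1%E.
Proof.
rewrite probability_setI_full// -[X in measurable X]setTI; [exact: mS|exact: mS'].
Qed.

Let E0W w : E0 w -> exists r r', [/\ 0 <= r, 0 <= r', S w = r%:E & S' w = r'%:E].
Proof.
rewrite /E0/= /A0/= !in_itv/=; case: (S w) (S' w) => [r||] [r'||]//=;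
  rewrite ?ltxx ?andbF//; try by case.
by move=> [/andP[+ _] /andP[+ _]]; rewrite !lee_fin => r0 r0'; exists r, r'.
Qed.

Let mW : measurable_fun setT W.
Proof. exact: emeasurable_funD. Qed.

Let mF : measurable_fun setT ((fun w => fine (W w)) : T -> measurableTypeR R).
Proof. exact: (measurableT_comp (@fine_measurable R _ measurableT) mW). Qed.

(** [W] takes extended real values, while the laws considered live on the line; [fine] changes [W]
    only where it is infinite, which is inside the complement of the full event [E0]. *)
Definition passage_sum_law : probability (measurableTypeR R) R := image_prob P mF.

Lemma has_law_passage_sum : has_law P W (pushforward passage_sum_law (@EFin R)).
Proof.
split; first exact: mW.
move=> A mA; rewrite /pushforward -[RHS]/(P _).
have mWA : measurable (W @^-1` A) by rewrite -[X in measurable X]setTI; exact: mW.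
have mWA' : measurable (mk_mfun mF @^-1` (EFin @^-1` A)).
  rewrite -[X in measurable X]setTI; apply: mF => //.
  rewrite -[X in measurable X]setTI; exact: EFin_measurable.
rewrite -(probability_setI_full mWA mE0 PE0) -(probability_setI_full mWA' mE0 PE0).
congr (P _); apply/seteqP; split => w /= [h /[dup] Ew /E0W[r [r' [_ _ Sr Sr']]]];
  by split => //; move: h; rewrite /W Sr Sr'.
Qed.

Lemma passage_sum_nonneg : passage_sum_law `]-oo, 0[%classic = 0%E.
Proof.
rewrite -[LHS]/(P _).
have mN : measurable (mk_mfun mF @^-1` `]-oo, 0%R[%classic).
  by rewrite -[X in measurable X]setTI; apply: mF => //; exact: measurable_itv.
rewrite -(probability_setI_full mN mE0 PE0) (_ : _ `&` _ = set0) ?measure0//.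
apply/seteqP; split => // w /= [+ /E0W[r [r' [r0 r0' Sr Sr']]]].
by rewrite in_itv/= /W Sr Sr'/= ltNge addr_ge0.
Qed.

Lemma laplace_passage_sum l : 0 <= l ->
  laplace passage_sum_law l = ((passage_ratio l)^-1 ^+ 2)%:E.
Proof.
rewrite le_eqVlt => /predU1P[<-|l0].
  by rewrite laplace0 /passage_ratio eqxx invr1 expr1n.
rewrite /laplace (ge0_integral_image_prob P mF (g := fun y => (expR (- (l * y)))%:E))//; last first.
  by apply/measurable_EFinP; exact: measurable_expRN.
pose X (b : bool) := if b then S' else S.
have mX b : measurable_fun setT (X b) by case: b.
have := independent_expectation_prod mX indS (f := fun _ x => (G l x)%:E) _ _.
rewrite big_bool/= => h.
transitivity (\int[P]_w \prod_(b : bool) (G l (X b w))%:E)%E; last first.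
  rewrite h//; last by move=> _ x; rewrite lee_fin G0.
  rewrite /X laplaceS//.
  have -> : (\int[P]_w (G l (S' w))%:E = \int[P]_w (G l (S w))%:E)%E.
    have g0 x : (0 <= (G l x)%:E)%E by rewrite lee_fin G0.
    rewrite -(ge0_integral_image_prob P mS (mG l) g0).
    exact: (ge0_integral_law (nu := image_prob P mS) lawS' (mG l) g0).
  by rewrite laplaceS// -EFinM expr2.
(* The two integrands agree on [E0] only: at an infinite passage time the product of the [G] is 0,
   whereas [fine] yields exp(0) = 1. *)
apply: ae_eq_integral => //.
- apply/measurable_EFinP; exact: (measurableT_comp (measurable_expRN l) mF).
- under eq_fun do rewrite big_bool/=.
  by apply: emeasurable_funM; [exact: (measurableT_comp (mG l) mS')|exact: (measurableT_comp (mG l) mS)].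
- exists (~` E0); split.
  + exact: measurableC.
  + by apply: etrans (probability_setC P mE0) _; rewrite PE0 subee.
  + move=> w /= nw Ew; apply: nw => _; have [r [r' [_ _ Sr Sr']]] := E0W Ew.
    by rewrite big_bool/= /W Sr Sr'/= -EFinM -expRD; congr (expR _)%:E; ring.
Qed.

End passage_sum.


Theorem mainTheorem1 (R : realType) (d : measure_display)
    (T : measurableType d) (P : probability T R)
    (B : 'I_3 -> R -> T -> R) (a : R) (S' : T -> \bar R) :
  standard_brownian_motion P B ->
  0 < a ->
  let S := first_passage (bessel3 B) a in
  has_law P S' (pushforward P S) ->
  independent P (fun b : bool => if b then S' else S) ->
  let W := fun w : T => (S w + S' w)%E in
  exists mu : probability (measurableTypeR R) R,
    [/\ has_law P W (pushforward mu (@EFin R)),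
        generalized_gamma_convolution mu
      & is_thorin_measure mu (passage_thorin_measure a)].
Proof.
move=> hB a0 S lawS' indS W.
pose mu := passage_sum_law hB a0 lawS'.
have mu0 : mu `]-oo, 0[%classic = 0%E by exact: passage_sum_nonneg.
have s0 l : 0 <= l -> 0 < passage_ratio a l by exact: passage_ratio_gt0.
have cs l : 0 <= l ->
    (fun n => \prod_(k < n) (1 + l / passage_rate a k.+1)) @ \oo --> passage_ratio a l.
  exact: passage_ratio_cvg.
have lmu l : 0 <= l -> laplace mu l = ((passage_ratio a l)^-1 ^+ 2)%:E.
  exact: laplace_passage_sum.
exists mu; split.
- exact: has_law_passage_sum.
- exact: (gamma_convolution_limit a0 mu0 s0 cs lmu).
- split => //.
  + exact: (infinitely_divisible_limit a0 mu0 s0 cs lmu).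
  (* The lower index 1 matters: [passage_rate a 0] is 0 and would charge this set, while all later
     rates are positive. *)
  + transitivity (2%:E * \sum_(1 <= k <oo)
        (dirac (passage_rate a k : measurableTypeR R) `]-oo, 0%R]%classic : \bar R))%E; first by [].
    rewrite eseries0 ?mule0// => k /= k1 _; rewrite diracE memNset//=.
    rewrite in_itv/= leNgt => /negP; apply.
    by rewrite -(prednK k1) passage_rate_gt0.
  + exact: thorin_measure_integrable.
  + move=> l l0; rewrite -[LHS]/(laplace mu l) lmu//.
    rewrite (thorin_exponent_passage a0 l0 (s0 l l0) (cs l l0)) /=.
    by rewrite expRN expRM_natl lnK ?posrE ?s0// exprVn.
Qed.
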